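(* Let $\alpha(x)$ be a sub-polynomial such that $\lim_{x\to+\infty}\alpha(x)=+\infty$ and such that, for every $p\in\mathbb{Q}[x]$ and every $c\in\mathbb{R}$, $$\lim_{x\to+\infty}\frac{|\alpha(x)-c\,p(x)|}{\log x}=+\infty.$$ Let $k,\ell\in\mathbb{N}$ satisfy $k\geq\ell$, and let $A\subseteq\mathbb{N}$ have positive upper density. Then there exist $x,y\in A$ and $n\in\mathbb{N}$ such that $$kx-\ell y=\lfloor\alpha(n)\rfloor.$$
   Context: $\mathbb{N}=\{1,2,\dots\}$. The upper density of $A\subseteq\mathbb{N}$ is $\overline{d}(A)=\limsup_{N\to\infty}\frac{|A\cap[1,N]|}{N}$. Let $\mathcal{G}$ be the ring (under pointwise addition and multiplication) of germs at $+\infty$ of continuous real-valued functions defined on half-lines $(a,+\infty)$; two functions have the same germ if they agree for all sufficiently large $x$. A Hardy field is a subfield of $\mathcal{G}$ closed under differentiation (each element is eventually differentiable and its derivative's germ lies in the field). A sub-polynomial is a function $\alpha$ whose germ belongs to some Hardy field and which satisfies $\lim_{x\to+\infty}\alpha(x)/x^l=0$ for some $l>0$. Functions and germs are not distinguished; when values $\alpha(n)$, $n\in\mathbb{N}$, appear, $\alpha$ denotes a fixed real-valued representative defined on $[1,+\infty)$. *)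

(* Defs.v *)
From HB Require Import structures.
From mathcomp Require Import all_boot all_order all_algebra finmap.
From mathcomp Require Import all_classical all_reals all_analysis.

Set Implicit Arguments.
Unset Strict Implicit.
Unset Printing Implicit Defensive.

Import Order.TTheory GRing.Theory Num.Theory.
Import numFieldNormedType.Exports.

Local Open Scope classical_set_scope.
Local Open Scope ring_scope.

(* A germ at +oo is represented by any total function f : R -> R in it; the
   values of f on an initial half-line carry no information. *)
Definition germ_eq (R : realType) (f g : R -> R) : Prop :=
  \forall x \near +oo, f x = g x.

Definition continuous_germ (R : realType) (f : R -> R) : Prop :=
  \forall x \near +oo, {for x, continuous f}.

(* A set of germs is encoded as a set of functions saturated under [germ_eq]
   (hardy_germ).  0 = 1 + (- 1) belongs to it, and 1 <> 0 always holds for germs.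
   [derive1 f] is a total function, meaningful only where f is derivable, hence
   the first conjunct of hardy_derive. *)
Record hardy_field (R : realType) (H : set (R -> R)) : Prop := HardyField {
  hardy_continuous : forall f, H f -> continuous_germ f ;
  hardy_germ : forall f g, germ_eq f g -> H f -> H g ;
  hardy_one : H (fun=> 1) ;
  hardy_add : forall f g, H f -> H g -> H (fun x => f x + g x) ;
  hardy_opp : forall f, H f -> H (fun x => - f x) ;
  hardy_mul : forall f g, H f -> H g -> H (fun x => f x * g x) ;
  hardy_inv : forall f, H f -> ~ germ_eq f (fun=> 0) ->
    exists2 g, H g & germ_eq (fun x => f x * g x) (fun=> 1) ;
  hardy_derive : forall f, H f ->
    (\forall x \near +oo, derivable f x 1) /\ H (derive1 f)
}.

Definition sub_polynomial (R : realType) (alpha : R -> R) : Prop :=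
  (exists2 H : set (R -> R), hardy_field H & H alpha) /\
  (exists2 l : R, 0 < l & alpha x / x `^ l @[x --> +oo] --> (0 : R)).

(* The quotient at N = 0 is the junk value 0 / 0 = 0, irrelevant to the limsup. *)
Definition upper_density (R : realType) (A : set nat) : \bar R :=
  limn_esup (fun N : nat =>
    ((#|` fset_set (A `&` [set n | (1 <= n <= N)%N]) |%fset)%:R / N%:R : R)%:E).

(* Main.v *)
(* If alpha' -> 0, then floor (alpha n) takes every large integer value and the
   result is immediate.  Otherwise choose X with alpha(X) about delta * N, so that
   on [X, cX] alpha passes all targets k x - l y with x, y <= N.  The sums of
   e(psi * alpha(n)) over X <= n < cX are then o(X), uniformly for
   K / alpha(X) <= psi <= J: let d + 1 be the least order of a derivative of alpha
   tending to 0; either some derivative psi * alpha^(j) with j <= d + 1 is small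
   but not too small on [X, cX], and the van der Corput estimates apply, or
   psi is bounded below and alpha is close to a real polynomial which, by the
   hypothesis on alpha, is not a constant plus a multiple of a rational
   polynomial, and Weyl's theorem applies.

   Without solutions, t = alpha(n) - 1/2 - k x + l y has |t| >= 1/2 for all n, x, y
   considered.  Average over these triples the Fejer kernel of t / Q, where Q is a
   large multiple of N, normalized to have mean 1.  For order J Q the average is
   small, since that kernel is concentrated on |t| < 1 / J.  For a constant order r
   it is bounded below, since |t| <= c N / r for a positive proportion of the
   triples.  The two kernels differ in frequencies j / Q up to J: those below
   K / alpha(X) have nearly equal coefficients, and for the others the exponential
   sums are small, so Parseval's identity for x and y in A bounds the difference,
   a contradiction. *)
Require Import Defs.
From HB Require Import structures.
From mathcomp Require Import all_boot all_order all_algebra finmap.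
From mathcomp Require Import all_classical all_reals all_analysis.
From mathcomp Require Import complex ring lra zify.

Set Implicit Arguments.
Unset Strict Implicit.
Unset Printing Implicit Defensive.

Import Order.TTheory GRing.Theory Num.Theory.
Import numFieldNormedType.Exports.

Local Open Scope classical_set_scope.
Local Open Scope ring_scope.

(** * Exponential sums *)

Section ExponentialSums.
Variable R : realType.
Implicit Types (t s u x y : R) (f g : nat -> R) (z w : nat -> R[i]).
Local Notation normc := (@Normc.normc R).

(** The obstacle is that the sums over n show no cancellation at frequencies up to the order of 1 /
    alpha(X). There the two kernels can only be compared, and elsewhere they can be bounded. The
    order in which the constants are fixed makes this work. The multiple Q = q N keeps the numbers k
    x, and likewise the numbers l y, distinct modulo Q, and keeps t / Q within 1/8. Next, J is fixed
    by the tail of the long kernel. All frequencies j / Q then stay below J, a bound free of N,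
    which determines the precision eta required of the exponential sums and hence their threshold K.
    Only then is r chosen, so large that j / r is small for the frequencies below K / alpha(X). A
    large r does no harm: the short kernel has height about r on a proportion about 1 / r of the
    triples, so the main term does not depend on r. The assumption l <= k gives k x - l y >= x - y
    when x >= y, so for x - y >= D the target is not below the first value alpha(X). *)

Lemma normc_sq (z : R[i]) : normc z ^+ 2 = complex.Re z ^+ 2 + complex.Im z ^+ 2.
Proof. by case: z => a b /=; rewrite sqr_sqrtr// addr_ge0 ?sqr_ge0. Qed.

Lemma normc_ge0 (z : R[i]) : 0 <= normc z.
Proof. by case: z => a b /=; rewrite sqrtr_ge0. Qed.

Lemma normcN (z : R[i]) : normc (- z) = normc z.
Proof. by case: z => a b /=; rewrite !sqrrN. Qed.

Lemma normc_sum (I : Type) (r : seq I) (P : pred I) (F : I -> R[i]) :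
  normc (\sum_(i <- r | P i) F i) <= \sum_(i <- r | P i) normc (F i).
Proof.
elim/big_rec2: _ => [|i y1 y2 _ h]; first by rewrite Normc.normc0.
by apply: le_trans (le_normcD _ _) _; rewrite lerD2l.
Qed.

Lemma normc_real (a : R) : normc (real_complex _ a) = `|a|.
Proof. by rewrite /= expr0n /= addr0 sqrtr_sqr. Qed.

(** The additive character e(t), of period 1. *)
Definition cis t : R[i] := Complex (cos (2 * pi * t)) (sin (2 * pi * t)).

Lemma normc_cis t : normc (cis t) = 1.
Proof. by rewrite /= cos2Dsin2 sqrtr1. Qed.

Lemma cis0 : cis 0 = 1.
Proof. by rewrite /cis mulr0 cos0 sin0. Qed.

Lemma cisD s t : cis (s + t) = cis s * cis t.
Proof.
rewrite /cis mulrDr cosD sinD; apply/eqP; rewrite eq_complex /=.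
by rewrite eqxx /= addrC eqxx.
Qed.

Lemma cisN t : cis (- t) = (cis t)^*%C.
Proof. by rewrite /cis mulrN cosN sinN. Qed.

Lemma cis_nat n : cis n%:R = 1.
Proof.
rewrite /cis; have -> : 2 * pi * n%:R = 0 + (pi *+ 2) *+ n :> R.
  by rewrite add0r -[in RHS]mulr_natr -(mulr_natl pi).
rewrite (periodicn (@cosD2pi R)) (periodicn (@sinD2pi R)) cos0 sin0 //.
Qed.

Lemma cis_int (m : int) : cis m%:~R = 1.
Proof.
case: m => n; first by rewrite -pmulrn cis_nat.
rewrite NegzE mulrNz -pmulrn cisN cis_nat.
by apply/eqP; rewrite eq_complex /= oppr0 !eqxx.
Qed.

Lemma cisDint t (m : int) : cis (t + m%:~R) = cis t.
Proof. by rewrite cisD cis_int mulr1. Qed.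

Lemma mvt (f df : R -> R) (a b : R) : a <= b ->
  (forall x, a <= x <= b -> is_derive x 1 f (df x)) ->
  exists2 c, a <= c <= b & f b - f a = df c * (b - a).
Proof.
move=> ab hd; apply: (MVT_segment ab) => [x xab|].
  by apply: hd; rewrite !ltW ?(itvP xab).
apply: derivable_within_continuous => x xab.
by have [] := hd x; rewrite ?(itvP xab).
Qed.

Lemma sin_le_id x : 0 <= x -> sin x <= x.
Proof.
move=> x0.
have [c _] := mvt x0 (fun y _ => is_derive_sin y); rewrite sin0 !subr0 => ->.
by rewrite -[leRHS]mul1r ler_wpM2r// cos_le1.
Qed.

Lemma cos_ge_half x : 0 <= x <= 1 -> 1 / 2 <= cos x.
Proof.
move=> /andP[x0 x1].
have -> : cos x = 1 - 2 * sin (x / 2) ^+ 2.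
  rewrite {1}(_ : x = (x / 2) *+ 2); last by rewrite -mulr_natr; field.
  by rewrite cos_mulr2n cos2sin2 -mulr_natr; ring.
have s1 : sin (x / 2) <= x / 2 by apply: sin_le_id; lra.
have s0 : 0 <= sin (x / 2).
  apply: sin_ge0_pi; apply/andP; split; first lra.
  by have := pi_ge2 R; lra.
have : sin (x / 2) ^+ 2 <= (x / 2) ^+ 2 by rewrite lerXn2r ?nnegrE//; lra.
nra.
Qed.

Lemma sin_ge_half x : 0 <= x <= 1 -> x / 2 <= sin x.
Proof.
move=> /andP[x0 x1].
have [c /andP[c0 cx]] := mvt x0 (fun y _ => is_derive_sin y); rewrite sin0 !subr0 => ->.
have : 1 / 2 <= cos c by apply: cos_ge_half; lra.
nra.
Qed.

Lemma normc_1Bcis t : normc (1 - cis t) = 2 * `|sin (pi * t)|.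
Proof.
have -> : 1 - cis t = (- (2 * sin (pi * t)))%:C%C *
    Complex (- sin (pi * t)) (cos (pi * t)).
  have e : 2 * pi * t = (pi * t) *+ 2 by rewrite -mulr_natr; ring.
  rewrite /cis e cos_mulr2n sin_mulr2n; apply/eqP; rewrite eq_complex /=.
  by apply/andP; split; apply/eqP; rewrite ?cos2sin2; ring.
rewrite Normc.normcM normc_real normrN normrM ger0_norm//.
rewrite (_ : normc _ = 1) ?mulr1// -[LHS]/(Num.sqrt _) sqrrN addrC.
by rewrite cos2Dsin2 sqrtr1.
Qed.

Lemma normc_1Bcis_le t : normc (1 - cis t) <= 2 * pi * `|t|.
Proof.
rewrite normc_1Bcis -mulrA ler_pM2l//.
have pi0 := pi_gt0 R.
have h u : 0 <= u -> `|sin u| <= u.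
  move=> u0; rewrite ler_norml sin_le_id// andbT.
  have [up|up] := lerP u pi.
    by apply: le_trans (sin_ge0_pi _); [lra|apply/andP; split].
  by have := sin_geN1 u; have := pi_ge2 R; lra.
have [t0|t0] := lerP 0 t.
  by rewrite (ger0_norm t0); apply: h; rewrite mulr_ge0 // ltW.
rewrite (ltr0_norm t0) -normrN -sinN -mulrN.
by apply: h; rewrite mulr_ge0 // ?ltW// oppr_gt0.
Qed.

Lemma normc_cisB s t : normc (cis s - cis t) <= 2 * pi * `|s - t|.
Proof.
have -> : cis s - cis t = - cis t * (1 - cis (s - t)).
  by rewrite mulrBr mulr1 mulNr -cisD (_ : t + (s - t) = s) 1?addrC ?subrK // opprK addrC.
by rewrite Normc.normcM normcN normc_cis mul1r normc_1Bcis_le.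
Qed.

(** For |t| <= 1/8 and pi < 4 the angle pi |t| stays below 1, where sin u >= u / 2; the factor 1/2
    is then recovered from pi >= 2. *)
Lemma normc_1Bcis_ge t : `|t| <= 1 / 8 -> 2 * `|t| <= normc (1 - cis t).
Proof.
move=> ht; rewrite normc_1Bcis ler_pM2l//.
have pi2 := pi_ge2 R; have pi4 : pi < 4 :> R by have := pihalf_lt2 R; lra.
have h u : 0 <= u <= 1/8 -> u <= `|sin (pi * u)|.
  move=> /andP[u0 u1]; have : pi * u / 2 <= sin (pi * u).
    by apply: sin_ge_half; apply/andP; split; nra.
  move=> h; apply: le_trans (ler_norm _); apply: le_trans h; nra.
have [t0|t0] := lerP 0 t.
  by move: ht; rewrite (ger0_norm t0) => ht; apply: h; apply/andP.
move: ht; rewrite (ltr0_norm t0) -[in X in _ -> _ <= X]normrN -sinN -mulrN => ht.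
by apply: h; apply/andP; split=> //; lra.
Qed.

Lemma abel_summation z w (N : nat) (B : R) :
  (forall m, (m <= N)%N -> normc (\sum_(n < m) z n) <= B) ->
  normc (\sum_(n < N) z n * w n) <=
    B * (normc (w N) + \sum_(n < N) normc (w n.+1 - w n)).
Proof.
move=> hB.
have -> : \sum_(n < N) z n * w n = (\sum_(n < N) z n) * w N
    - \sum_(n < N) (\sum_(m < n.+1) z m) * (w n.+1 - w n).
  elim: N {hB} => [|N IH]; first by rewrite !big_ord0 mul0r subr0.
  rewrite !(@big_ord_recr _ _ _ N) /= IH; ring.
apply: le_trans (le_normcD _ _) _; rewrite normcN mulrDr; apply: lerD.
  by rewrite Normc.normcM ler_wpM2r ?normc_ge0 ?hB.
apply: le_trans (normc_sum _ _ _) _; rewrite mulr_sumr.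
apply: ler_sum => i _; rewrite Normc.normcM ler_wpM2r ?normc_ge0 // hB //.
Qed.

End ExponentialSums.

(** * The van der Corput inequality *)

Section VanDerCorput.
Variable R : realType.
Implicit Types (f g : nat -> R) (z w : nat -> R[i]).
Local Notation normc := (@Normc.normc R).

Lemma sqr_normc_conj (z : R[i]) : ((normc z ^+ 2)%:C = z * z^*)%C.
Proof.
rewrite normc_sq; case: z => a b; apply/eqP; rewrite eq_complex /=.
by apply/andP; split; apply/eqP; ring.
Qed.

Lemma sqr_normc_sum (I : Type) (r : seq I) (w : I -> R[i]) :
  (((normc (\sum_(i <- r) w i)) ^+ 2)%:C = \sum_(i <- r) \sum_(j <- r) w i * (w j)^*)%C.
Proof.
rewrite sqr_normc_conj rmorph_sum mulr_suml; apply: eq_bigr => i _.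
by rewrite mulr_sumr.
Qed.

Lemma normc_conj (z : R[i]) : normc (z^*)%C = normc z.
Proof. by case: z => a b /=; rewrite sqrrN. Qed.

Lemma conj_sum_cis (I : Type) (r : seq I) (u : I -> R) :
  ((\sum_(i <- r) cis (u i))^*)%C = \sum_(i <- r) cis (- u i).
Proof. by rewrite rmorph_sum; apply: eq_bigr => i _; rewrite cisN. Qed.

Lemma sqr_sum_le (N : nat) (a : nat -> R) :
  (\sum_(i < N) a i) ^+ 2 <= N%:R * \sum_(i < N) a i ^+ 2.
Proof.
elim: N => [|N IH]; first by rewrite !big_ord0 mulr0 expr0n.
rewrite !big_ord_recr /= -[N.+1%:R]natr1.
set S := \sum_(j < N) a j in IH *; set T := \sum_(j < N) _ in IH *.
have [N0|N0] := posnP N.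
  by rewrite /S /T N0 !big_ord0 !add0r mul1r.
have n0 : 0 < N%:R :> R by rewrite ltr0n.
set n : R := N%:R in IH n0 *.
rewrite -(ler_pM2l n0).
have : 0 <= (n * a N - S) ^+ 2 by exact: sqr_ge0.
nra.
Qed.

Lemma sum_ord_le (M : nat) (P : pred 'I_M) (F : 'I_M -> R) (B : R) : 0 <= B ->
  (forall i, P i -> F i <= B) -> \sum_(i < M | P i) F i <= M%:R * B.
Proof.
move=> B0 hF; apply: (@le_trans _ _ (\sum_(i < M) B)).
  rewrite big_mkcond /=; apply: ler_sum => i _.
  by case: ifP => // Pi; exact: hF.
by rewrite sumr_const card_ord mulr_natl.
Qed.

Lemma shift_sum z (N t : nat) : (forall n, normc (z n) <= 1) ->
  normc (\sum_(n < N) z n - \sum_(n < N) z (n + t)%N) <= 2 * t%:R.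
Proof.
move=> hz; elim: t => [|t IH].
  under [X in _ - X]eq_bigr do rewrite addn0.
  by rewrite subrr Normc.normc0 mulr0.
have e : \sum_(n < N) z (n + t)%N - \sum_(n < N) z (n + t.+1)%N
    = z t - z (N + t)%N.
  elim: N {IH} => [|N IH]; first by rewrite !big_ord0 add0n !subrr.
  rewrite !(@big_ord_recr _ _ _ N) /= !addnS !addSn in IH *.
  set u := \sum_(i < N) z (i + t)%N in IH *.
  have -> : u = z t - z (N + t)%N + \sum_(n < N) z (n + t.+1)%N.
    by rewrite -IH subrK.
  ring.
rewrite -(subrK (\sum_(n < N) z (n + t)%N) (\sum_(n < N) z n)) -addrA e.
apply: le_trans (le_normcD _ _) _; rewrite -[t.+1%:R]natr1 mulrDr mulr1.
apply: lerD; first exact: IH.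
apply: le_trans (le_normcD _ _) _; rewrite normcN.
by have := hz t; have := hz (N + t)%N; lra.
Qed.

(** The sum is averaged over [M] shifts by multiples of [p], at a boundary cost of 2 p M, and
    squared by Cauchy-Schwarz. The diagonal pairs of shifts contribute a share 1 / M <= eta^2 / 8
    and the other pairs a share eta^2 / 8 by hypothesis; the root of the total eta^2 / 4 is eta /
    2. *)
Lemma van_der_corput f (N M p : nat) (eta : R) : 0 < eta -> 8 <= M%:R * eta ^+ 2 ->
  (forall i j, (i < j < M)%N ->
     normc (\sum_(n < N) cis (f (n + p * j)%N - f (n + p * i)%N))
       <= eta ^+ 2 / 8 * N%:R) ->
  normc (\sum_(n < N) cis (f n)) <= 2 * (p * M)%:R + eta / 2 * N%:R.
Proof.
move=> eta0 hM hij.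
pose z n := cis (f n); pose S := \sum_(n < N) z n.
have M0 : 0 < M%:R :> R.
  rewrite lt_neqAle ler0n andbT eq_sym; apply/eqP => M0.
  by move: hM; rewrite M0 mul0r; lra.
have z1 n : normc (z n) <= 1 by rewrite normc_cis.
pose T := \sum_(n < N) \sum_(h < M) z (n + p * h)%N.
have hST : normc (M%:R * S - T) <= M%:R * (2 * (p * M)%:R).
  have -> : M%:R * S - T = \sum_(h < M) (S - \sum_(n < N) z (n + p * h)%N).
    by rewrite sumrB sumr_const card_ord mulr_natl /T exchange_big.
  apply: le_trans (normc_sum _ _ _) _.
  apply: sum_ord_le; first by rewrite mulr_ge0.
  move=> h _; apply: le_trans (shift_sum _ _ z1) _.
  by rewrite ler_pM2l// ler_nat leq_mul2l ltnW ?orbT.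
have hT : normc T <= M%:R * (eta / 2 * N%:R).
  have T2 : normc T ^+ 2 <= N%:R * \sum_(n < N) normc (\sum_(h < M) z (n + p * h)%N) ^+ 2.
    apply: (@le_trans _ _ ((\sum_(n < N) normc (\sum_(h < M) z (n + p * h)%N)) ^+ 2)).
      by rewrite lerXn2r ?nnegrE ?normc_ge0 ?sumr_ge0 ?normc_sum// => i _; exact: normc_ge0.
    exact: (sqr_sum_le N (fun n => normc (\sum_(h < M) z (n + p * h)%N))).
  have e : \sum_(n < N) normc (\sum_(h < M) z (n + p * h)%N) ^+ 2
      <= M%:R * N%:R + M%:R ^+ 2 * (eta ^+ 2 / 8 * N%:R).
    set L := (X in X <= _).
    have eL : (L%:C = \sum_(i < M) \sum_(j < M) \sum_(n < N)
        cis (f (n + p * i)%N - f (n + p * j)%N))%C.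
      rewrite rmorph_sum /=; under eq_bigr do rewrite sqr_normc_sum.
      rewrite exchange_big; apply: eq_bigr => i _; rewrite exchange_big.
      by apply: eq_bigr => j _; apply: eq_bigr => n _; rewrite cisD cisN.
    have L0 : 0 <= L by apply: sumr_ge0 => n _; exact: sqr_ge0.
    rewrite -(ger0_norm L0) -normc_real eL.
    apply: le_trans (normc_sum _ _ _) _.
    have b0 : 0 <= eta ^+ 2 / 8 * N%:R by rewrite mulr_ge0// divr_ge0 ?sqr_ge0.
    rewrite (_ : _ + _ = M%:R * (N%:R + M%:R * (eta ^+ 2 / 8 * N%:R))); last by ring.
    apply: sum_ord_le; first by rewrite addr_ge0// mulr_ge0.
    move=> i _; apply: le_trans (normc_sum _ _ _) _.
    rewrite (bigD1 i) //=; apply: lerD.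
      rewrite (eq_bigr (fun=> 1)) => [|n _]; last by rewrite subrr cis0.
      rewrite sumr_const card_ord; have := normc_real (N%:R : R).
      by rewrite rmorph_nat => ->; rewrite ger0_norm.
    apply: sum_ord_le => // j; rewrite neq_ltn => /orP[ji|ij].
      by apply: hij; rewrite ji ltn_ord.
    rewrite -normc_conj conj_sum_cis; under eq_bigr do rewrite opprB.
    by apply: hij; rewrite ij ltn_ord.
  rewrite -(@ler_pXn2r _ 2) ?nnegrE ?normc_ge0 ?mulr_ge0// ?divr_ge0 ?(ltW eta0)//.
  apply: le_trans T2 _.
  apply: (@le_trans _ _ (N%:R * (M%:R * N%:R + M%:R ^+ 2 * (eta ^+ 2 / 8 * N%:R)))).
    by rewrite ler_wpM2l.
  have N2 : 0 <= (N%:R : R) ^+ 2 * M%:R by rewrite mulr_ge0 ?sqr_ge0 ?ltW.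
  have := ler_wpM2l N2 hM; lra.
rewrite -(ler_pM2l M0).
have -> : M%:R * normc S = normc (M%:R * S).
  by rewrite Normc.normcM -[M%:R in RHS](rmorph_nat (real_complex R)) normc_real ger0_norm ?ler0n.
rewrite -(subrK T (_ * S)); apply: le_trans (le_normcD _ _) _.
by rewrite mulrDr; apply: lerD.
Qed.

End VanDerCorput.

(** * The derivative test *)

Section DerivativeTest.
Variable R : realType.
Implicit Types (f g : nat -> R) (z w : nat -> R[i]).
Local Notation normc := (@Normc.normc R).

Definition dlt f : nat -> R := fun n => f n.+1 - f n.

Lemma dltnS k f n : iter k.+1 dlt f n = iter k dlt f n.+1 - iter k dlt f n.
Proof. by []. Qed.

Lemma eq_dltn k f g : f =1 g -> iter k dlt f =1 iter k dlt g.
Proof. by move=> fg; elim: k => // k IH n; rewrite !dltnS !IH. Qed.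

Lemma dltn_shift k f a n : iter k dlt (fun m => f (m + a)%N) n = iter k dlt f (n + a)%N.
Proof. by elim: k n => // k IH n; rewrite !dltnS !IH. Qed.

Lemma dltnB k f g n :
  iter k dlt (fun m => f m - g m) n = iter k dlt f n - iter k dlt g n.
Proof. by elim: k n => // k IH n; rewrite !dltnS !IH; ring. Qed.

Lemma dltnZ k c f n : iter k dlt (fun m => c * f m) n = c * iter k dlt f n.
Proof. by elim: k n => // k IH n; rewrite !dltnS !IH; ring. Qed.

(** This is how van der Corput's inequality lowers the order: a difference of two shifts has k-th
    differences of the size of the next ones times [b - a]. *)
Lemma dltn_increment k f (a b n : nat) : (a <= b)%N ->
  iter k dlt (fun m => f (m + b)%N - f (m + a)%N) n
    = \sum_(a <= i < b) iter k.+1 dlt f (n + i)%N.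
Proof.
move=> ab; rewrite dltnB !dltn_shift.
rewrite -(telescope_sumr (fun i => iter k dlt f (n + i)%N) ab).
by apply: eq_bigr => i _; rewrite dltnS addnS.
Qed.

Lemma pi_lt4 : pi < 4 :> R.
Proof. by have := pihalf_lt2 R; lra. Qed.

(** Each term is the increment of [cis (f n)] times [c n], so Abel summation reduces the claim to
    the total variation of [c]. Monotonicity of [dlt f], with direction [s], makes that variation
    telescope to at most a multiple of B / lam. *)
Lemma kusmin_landau f (N : nat) (lam B s : R) : 0 < lam -> B * lam <= 1 / 8 ->
  `|s| = 1 ->
  (forall n, (n <= N)%N -> lam <= dlt f n <= B * lam) ->
  (forall n, (n < N)%N -> 0 <= s * iter 2 dlt f n) ->
  normc (\sum_(n < N) cis (f n)) <= (1 + 4 * B) / lam.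
Proof.
move=> l0 Bl s1 hd hs.
pose w n := cis (f n); pose c n := (1 - cis (dlt f n))^-1.
have dn n : (n <= N)%N -> 2 * lam <= normc (1 - cis (dlt f n)).
  move=> /hd /andP[h1 h2]; have d0 : 0 < dlt f n by lra.
  apply: le_trans (normc_1Bcis_ge _); rewrite gtr0_norm//; lra.
have dn0 n : (n <= N)%N -> 1 - cis (dlt f n) != 0.
  by move=> /dn h; apply/eqP => e; move: h; rewrite e Normc.normc0; lra.
have e n : (n < N)%N -> w n = (w n - w n.+1) * c n.
  move=> nN; rewrite /w; have -> : f n.+1 = f n + dlt f n by rewrite /dlt addrC subrK.
  rewrite cisD -[in X in X - _](mulr1 (cis (f n))) -mulrBr mulfK//.
  by apply: dn0; exact: ltnW.
have -> : \sum_(n < N) cis (f n) = \sum_(n < N) (w n - w n.+1) * c n.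
  by apply: eq_bigr => i _; rewrite -e.
have cle n : (n <= N)%N -> normc (c n) <= (2 * lam)^-1.
  move=> nN; rewrite Normc.normcV lef_pV2 ?dn// posrE; last by lra.
  by have := dn _ nN; lra.
apply: (@le_trans _ _ (2 * (normc (c N) + \sum_(n < N) normc (c n.+1 - c n)))).
  apply: (@abel_summation _ (fun n => w n - w n.+1)) => m _.
  have -> : \sum_(n < m) (w n - w n.+1) = w 0%N - w m.
    elim: m => [|m IH]; first by rewrite big_ord0 subrr.
    by rewrite big_ord_recr /= IH; ring.
  by apply: le_trans (le_normcD _ _) _; rewrite normcN !normc_cis; lra.
have dc n : (n < N)%N ->
    normc (c n.+1 - c n) <= (2 / lam ^+ 2) * (s * iter 2 dlt f n).
  move=> nN; have a0 := dn0 _ nN; have b0 := dn0 _ (ltnW nN).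
  have -> : c n.+1 - c n = (cis (dlt f n.+1) - cis (dlt f n)) * c n.+1 * c n.
    rewrite /c; move: a0 b0; set x := cis _; set y := cis _ => a0 b0.
    by field; rewrite a0 b0.
  rewrite !Normc.normcM.
  have h1 := normc_cisB (dlt f n.+1) (dlt f n).
  have h2 := cle _ nN; have h3 := cle _ (ltnW nN).
  have es : `|dlt f n.+1 - dlt f n| = s * iter 2 dlt f n.
    by rewrite -(ger0_norm (hs _ nN)) normrM s1 mul1r.
  rewrite es in h1; set t := s * _ in h1 *.
  have t0 : 0 <= t by exact: hs.
  have h4 : normc (cis (dlt f n.+1) - cis (dlt f n)) <= 8 * t.
    by apply: le_trans h1 _; rewrite ler_wpM2r//; have := pi_lt4; lra.
  apply: (@le_trans _ _ (8 * t * (2 * lam)^-1 * (2 * lam)^-1)).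
    by rewrite !ler_pM// ?mulr_ge0 ?normc_ge0// invr_ge0; lra.
  by rewrite le_eqVlt; apply/orP; left; apply/eqP; field; lra.
have hsum : \sum_(n < N) normc (c n.+1 - c n) <= 2 * B / lam.
  apply: (@le_trans _ _ (\sum_(n < N) (2 / lam ^+ 2) * (s * iter 2 dlt f n))).
    by apply: ler_sum => i _; exact: dc.
  rewrite -!mulr_sumr (_ : \sum_(n < N) _ = dlt f N - dlt f 0%N); last first.
    rewrite -[RHS]telescope_sumr// big_mkord; apply: eq_bigr => i _.
    by rewrite dltnS.
  have := hd N (leqnn _); have := hd 0%N (leq0n _).
  move=> /andP[h1 h2] /andP[h3 h4].
  have h5 : s * (dlt f N - dlt f 0%N) <= B * lam.
    apply: le_trans (ler_norm _) _; rewrite normrM s1 mul1r ler_norml; lra.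
  rewrite (_ : 2 * B / lam = 2 / lam ^+ 2 * (B * lam)); last by field; lra.
  by rewrite ler_wpM2l// divr_ge0// sqr_ge0.
have := cle N (leqnn _).
have -> : (1 + 4 * B) / lam = 2 * ((2 * lam)^-1 + 2 * B / lam) by field; lra.
by move=> h; rewrite ler_pM2l// lerD.
Qed.

(* Induction on k, Kusmin-Landau being the case k = 0.  The shifts of length p
   in the van der Corput inequality turn the sequence into ones whose difference
   of the next lower order is about p * lam, and p is taken as large as the
   threshold eps of the previous step allows. *)
Lemma derivative_test k (eta B : R) : 0 < eta -> 1 <= B ->
  exists K eps : R, [/\ 0 < K, 0 < eps & forall f (N : nat) (lam s : R),
    `|s| = 1 ->
    (forall n, (n < k.+2 * N)%N -> lam <= iter k.+1 dlt f n <= B * lam) ->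
    (forall n, (n < k.+2 * N)%N -> 0 <= s * iter k.+2 dlt f n) ->
    K <= lam * N%:R ^+ k.+1 -> lam <= eps ->
    normc (\sum_(n < N) cis (f n)) <= eta * N%:R].
Proof.
elim: k eta B => [|k IH] eta B eta0 B1; have B0 : 0 < B by lra.
  exists ((1 + 4 * B) / eta), (1 / 8 / B); split; try by rewrite divr_gt0//; lra.
  move=> f N lam s s1 hd hs; rewrite expr1 => hK hl.
  have [->|N0] := posnP N; first by rewrite big_ord0 Normc.normc0 mulr0.
  have n0 : 0 < N%:R :> R by rewrite ltr0n.
  have K0 : 0 < (1 + 4 * B) / eta by rewrite divr_gt0//; lra.
  have l0 : 0 < lam by rewrite -(pmulr_lgt0 _ n0); lra.
  apply: le_trans (@kusmin_landau f N lam B s l0 _ s1 _ _) _.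
  - by rewrite [B * lam]mulrC -ler_pdivlMr.
  - by move=> n nN; apply: hd; lia.
  - by move=> n nN; apply: hs; lia.
  by move: hK; rewrite !ler_pdivrMr// => hK; lra.
have e80 : 0 < eta ^+ 2 / 8 by rewrite divr_gt0// exprn_gt0.
have [K' [eps' [K'0 eps'0 hD]]] := IH _ _ e80 B1.
pose M := (Num.truncn (8 / eta ^+ 2)).+1.
have hM : 8 <= M%:R * eta ^+ 2.
  rewrite -ler_pdivrMr ?exprn_gt0// ltW// truncnS_gt//.
have M0 : 0 < M%:R :> R by rewrite ltr0n.
have M1 : 1 <= M%:R :> R by rewrite ler1n.
pose e := Num.min eta 1.
have e0 : 0 < e by rewrite lt_min eta0 ltr01.
have ee : e <= eta by rewrite ge_min lexx.
have e1 : e <= 1 by rewrite ge_min lexx orbT.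
(* The first summand ensures M <= e N / 4, so that p = 1 respects the boundary error; the second
   ensures 2 M K' <= eps' N, needed when [eps'] is what limits p. *)
pose N1 := 4 * M%:R / e + 2 * M%:R * K' / eps' + 1.
have N1p : 1 <= N1.
  by rewrite /N1 lerDr addr_ge0// ?divr_ge0 ?mulr_ge0 ?ler0n// ltW.
have N1pos := lt_le_trans ltr01 N1p.
have K0 : 0 < 8 * M%:R * K' / e by rewrite divr_gt0 ?mulr_gt0.
have K1 : 0 < eps' * N1 ^+ k.+2 by rewrite mulr_gt0// exprn_gt0.
exists (8 * M%:R * K' / e + eps' * N1 ^+ k.+2), (eps' / M%:R); split.
- exact: addr_gt0.
- by rewrite divr_gt0.
move=> f N lam s s1 hd hs hK hl.
have [->|N0] := posnP N; first by rewrite big_ord0 Normc.normc0 mulr0.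
have n0 : 0 < N%:R :> R by rewrite ltr0n.
have l0 : 0 < lam by rewrite -(pmulr_lgt0 _ (exprn_gt0 k.+2 n0)); lra.
(* As lam <= eps', the second summand of the threshold on lam N^(k+2) forces N to be large. *)
have N1N : N1 <= N%:R.
  rewrite -(@ler_pXn2r _ k.+2)// ?nnegrE// ?(ltW N1pos)//.
  rewrite -(ler_pM2l eps'0).
  have : lam * N%:R ^+ k.+2 <= eps' * N%:R ^+ k.+2.
    rewrite ler_wpM2r// ?exprn_ge0//; apply: le_trans hl _.
    by rewrite ler_pdivrMr// ler_peMr// ltW.
  by lra.
have t1 : 0 <= 4 * M%:R / e by rewrite divr_ge0 ?mulr_ge0 ?(ltW e0).
have t2 : 0 <= 2 * M%:R * K' / eps' by rewrite divr_ge0 ?mulr_ge0 ?(ltW eps'0)// ltW.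
have NM : 4 * M%:R <= e * N%:R.
  by rewrite (mulrC e) -ler_pdivrMr//; move: N1N; rewrite /N1; lra.
have NK : 2 * M%:R * K' <= eps' * N%:R.
  by rewrite (mulrC eps') -ler_pdivrMr//; move: N1N; rewrite /N1; lra.
(* The largest total shift p M allowed: e N / 4 for the boundary error, eps' / lam for the smallness
   required by the induction hypothesis. *)
pose m := Num.min (e * N%:R / 4) (eps' / lam).
have mM : 1 <= m / M%:R.
  rewrite ler_pdivlMr// mul1r /m le_min; apply/andP; split; first by lra.
  by rewrite ler_pdivlMr// mulrC -ler_pdivlMr.
pose p := Num.truncn (m / M%:R).
have m0 : 0 <= m / M%:R by lra.
have /andP[p1 p2] := truncn_itv m0; rewrite -/p in p1 p2.
have p3 : m / M%:R <= 2 * p%:R.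
  have : (1 <= p)%N by rewrite /p truncn_gt0.
  by rewrite -(ler_nat R) => h; move: p2; rewrite -natr1; lra.
have pM : p%:R * M%:R <= m by rewrite -ler_pdivlMr.
have pM1 : p%:R * M%:R <= e * N%:R / 4.
  by apply: le_trans pM _; rewrite /m ge_min lexx.
have pM2 : p%:R * M%:R * lam <= eps'.
  by rewrite -ler_pdivlMr//; apply: le_trans pM _; rewrite /m ge_min lexx orbT.
have plam : K' <= p%:R * lam * N%:R ^+ k.+1.
  have h : m * (lam * N%:R ^+ k.+1) <= (2 * M%:R) * (p%:R * lam * N%:R ^+ k.+1).
    have := p3; rewrite ler_pdivrMr// => h.
    have h' : 0 <= lam * N%:R ^+ k.+1 by rewrite mulr_ge0 ?exprn_ge0// ltW.
    have := ler_wpM2r h' h; clear; lra.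
  have M20 : 0 < 2 * M%:R :> R by rewrite mulr_gt0.
  rewrite -(ler_pM2l M20); apply: le_trans h.
  rewrite /m; case: (leP (e * N%:R / 4) (eps' / lam)) => _.
    have : 8 * M%:R * K' <= e * (lam * N%:R ^+ k.+2).
      by rewrite (mulrC e) -ler_pdivrMr//; lra.
    by rewrite exprS; lra.
  rewrite mulrA divfK ?gt_eqF//; apply: le_trans NK _.
  by rewrite ler_pM2l// exprS ler_peMr// exprn_ege1// ler1n.
apply: (@le_trans _ _ (2 * (p * M)%:R + eta / 2 * N%:R)); last first.
  have : e * N%:R <= eta * N%:R by rewrite ler_wpM2r.
  by rewrite natrM; lra.
apply: van_der_corput => // i j /andP[ij jM].
have pp : (0 < p)%N.
  by rewrite lt0n; apply/eqP => p00; move: plam; rewrite p00 !mul0r; lra.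
have pN : (p * j <= N)%N.
  rewrite -(ler_nat R) natrM.
  have : p%:R * j%:R <= p%:R * M%:R :> R by rewrite ler_wpM2l// ler_nat ltnW.
  have : e * N%:R <= 1 * N%:R by rewrite ler_wpM2r.
  by lra.
have pij : (p * i <= p * j)%N by rewrite leq_mul2l ltnW// orbT.
have ipj : (1 <= j - i)%N by rewrite subn_gt0.
pose q : R := (p * j - p * i)%:R.
have q1 : p%:R <= q by rewrite ler_nat -mulnBr leq_pmulr.
have q2 : q <= p%:R * M%:R.
  by rewrite -natrM ler_nat -mulnBr leq_mul2l (leq_trans (leq_subr _ _)) ?orbT// ltnW.
(* The shifts reach up to N beyond the range of the previous order; this is why the hypotheses cover
   a range proportional to the order. *)
have idx n i' : (n < k.+2 * N)%N -> (i' < p * j)%N -> (n + i' < k.+3 * N)%N.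
  by move=> h1 h2; rewrite mulSn addnC -addnS leq_add// (leq_trans _ pN)// ltnW.
apply: (hD (fun n => f (n + p * j)%N - f (n + p * i)%N) N (q * lam) s s1).
- move=> n nN; rewrite dltn_increment//.
  have hb i' : (p * i <= i' < p * j)%N -> lam <= iter k.+2 dlt f (n + i') <= B * lam.
    by move=> /andP[h1 h2]; apply: hd; exact: idx.
  rewrite /q; apply/andP; split.
    rewrite mulr_natl -sumr_const_nat; apply: ler_sum_nat => i' /hb /andP[]//.
  rewrite mulrCA mulr_natl -sumr_const_nat; apply: ler_sum_nat => i' /hb /andP[]//.
- move=> n nN; rewrite dltn_increment// mulr_sumr big_nat sumr_ge0// => i' /andP[h1 h2].
  by apply: hs; exact: idx.
- apply: le_trans plam _; rewrite !ler_wpM2r ?exprn_ge0//; exact: ltW.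
- by apply: le_trans pM2; rewrite ler_wpM2r// ltW.
Qed.

End DerivativeTest.
Arguments dlt {R} f n.

(** * Weyl sums *)

Section Weyl.
Variable R : realType.
Implicit Types (f g : nat -> R) (z w : nat -> R[i]) (P Q F : {poly R}).
Local Notation normc := (@Normc.normc R).

(** The induction takes one difference of the whole family of derivatives at once, and uses the mean
    value theorem only at the top order. *)
Lemma dltn_ge k (F : nat -> R -> R) (a lo : R) :
  (forall j x, (j < k)%N -> a <= x <= a + k%:R -> is_derive x 1 (F j) (F j.+1 x)) ->
  (forall x, a <= x <= a + k%:R -> lo <= F k x) ->
  lo <= iter k dlt (fun n => F 0%N (a + n%:R)) 0.
Proof.
elim: k F a => [|k IH] F a hd hb.
  by apply: hb; rewrite /= addr0 lexx.
rewrite iterSr; pose G j x := F j (x + 1) - F j x.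
rewrite (@eq_dltn _ k _ (fun n => G 0%N (a + n%:R))); last first.
  by move=> n; rewrite /dlt /G -addrA natr1.
have hk : a + k.+1%:R = a + k%:R + 1 by rewrite -natr1 addrA.
apply: IH => [j x jk /andP[x1 x2]|x /andP[x1 x2]]; last first.
  have [|y /andP[y1 y2]|c /andP[c1 c2] e] := @mvt R (F k) (F k.+1) x (x + 1).
  - by rewrite lerDl.
  - by apply: hd => //; rewrite hk; lra.
  have : lo <= F k.+1 c by apply: hb; rewrite hk; lra.
  by rewrite /G e; lra.
have d1 : is_derive (x + 1) 1 (F j) (F j.+1 (x + 1)).
  by apply: hd; rewrite ?ltnS 1?ltnW// hk; lra.
have d2 : is_derive x 1 (F j) (F j.+1 x).
  by apply: hd; rewrite ?ltnS 1?ltnW// hk; lra.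
have d3 : is_derive x 1 (fun y : R => y + 1) 1.
  by have := is_deriveD (is_derive_id x (1 : R)) (is_derive_cst (1 : R) x (1 : R)); rewrite addr0.
have := is_deriveB (@is_derive1_comp R (F j) _ x _ _ d1 d3) d2.
by rewrite mulr1.
Qed.

Lemma dltn_mvt k (F : nat -> R -> R) (a lo hi : R) :
  (forall j x, (j < k)%N -> a <= x <= a + k%:R -> is_derive x 1 (F j) (F j.+1 x)) ->
  (forall x, a <= x <= a + k%:R -> lo <= F k x <= hi) ->
  lo <= iter k dlt (fun n => F 0%N (a + n%:R)) 0 <= hi.
Proof.
move=> hd hb; apply/andP; split; first by apply: dltn_ge => // x /hb /andP[].
rewrite -lerN2 (_ : - iter k dlt _ 0 = iter k dlt (fun n => - F 0%N (a + n%:R)) 0); last first.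
  by rewrite -mulN1r -dltnZ; apply: eq_dltn => n; rewrite mulN1r.
apply: (@dltn_ge k (fun j x => - F j x)) => [j x jk hx|x /hb /andP[_]]; last by rewrite lerN2.
by apply: is_deriveN; exact: hd.
Qed.

(** The d-th derivative is constant, so the two bounds of [dltn_mvt] coincide. *)
Lemma dltn_poly_lead d Q n : (size Q <= d.+1)%N ->
  iter d dlt (fun m => Q.[m%:R]) n = Q`_d *+ d`!.
Proof.
move=> sQ; rewrite -[n]add0n -dltn_shift.
pose F j (x : R) := Q^`(j).[x].
have e : Q^`(d) = (Q`_d *+ d`!)%:P.
  have s1 : (size Q^`(d) <= 1)%N.
    apply/leq_sizeP => i i1; rewrite coef_derivn nth_default ?mul0rn//.
    by rewrite (leq_trans sQ)// -addn1 leq_add2l.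
  by rewrite (size1_polyC s1) coef_derivn addn0 ffactnn.
have /(_ (Q`_d *+ d`!) (Q`_d *+ d`!)) := @dltn_mvt d F n%:R.
rewrite -eq_le => h.
rewrite (@eq_dltn _ d _ (fun m => F 0%N (n%:R + m%:R))); last first.
  by move=> m; rewrite /F derivn0 addnC natrD.
apply/esym/eqP/h => [j x _ _|x _].
  by rewrite /F derivnS; exact: is_derive_poly.
by rewrite /F e hornerC lexx.
Qed.

Lemma irrationalP (t : R) :
  irrational t <-> forall (m : nat) (z : int), (0 < m)%N -> m%:R * t != z%:~R.
Proof.
split=> [ht m z m0|h /rationalP[a [b e]]].
  apply/eqP => e; apply: ht; apply/rationalP; exists z, m.
  by rewrite -e mulrAC divff ?mul1r// pnatr_eq0 -lt0n.
have [b0|b0] := posnP b.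
  have /eqP[] := h 1%N 0 isT; by rewrite e b0 invr0 !mulr0.
have /eqP[] := h b a b0.
by rewrite e mulrCA divff ?mulr1// pnatr_eq0 -lt0n.
Qed.

Lemma irrationalZ (t : R) (m : nat) : (0 < m)%N -> irrational t -> irrational (m%:R * t).
Proof.
move=> m0 /irrationalP ht; apply/irrationalP => k z k0.
by rewrite mulrA -natrM ht// muln_gt0 k0.
Qed.

Lemma rational_multiple (t : R) : ~ irrational t ->
  exists2 m : nat, (0 < m)%N & exists z : int, m%:R * t = z%:~R.
Proof.
move=> h; apply: contra_notP h => h; apply/irrationalP => m z m0.
by apply/eqP => e; apply: h; exists m => //; exists z.
Qed.

Lemma cis_neq1 (t : R) : irrational t -> 0 < normc (1 - cis t).
Proof.
move=> ht; rewrite lt_neqAle normc_ge0 andbT eq_sym.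
apply/eqP; rewrite -(subrK (Num.floor t)%:~R t) cisDint normc_1Bcis.
set u := t - _.
have u0 : 0 <= u by rewrite subr_ge0 floor_le.
have u1 : u < 1 by rewrite ltrBlDl -[1]/(1%:~R) -rmorphD /= floorD1_gt.
have [u00|u00] := eqVneq u 0.
  have /eqP[] := (irrationalP t).1 ht 1%N (Num.floor t) isT.
  by apply/eqP; rewrite mul1r -subr_eq0 -/u u00.
have up : 0 < u by rewrite lt_def u00.
have : 0 < sin (pi * u).
  apply: sin_gt0_pi; rewrite mulr_gt0 ?pi_gt0//=.
  by rewrite -[ltRHS]mulr1 ltr_pM2l ?pi_gt0.
by move=> s0; rewrite gtr0_norm//; lra.
Qed.

(** Weyl differencing down to a geometric sum. The bound is uniform in [f] and holds for all leading
    differences near [th], as the later compactness argument requires. *)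
Lemma weyl_lead d (th eta : R) : irrational th -> 0 < eta ->
  exists (rho : R) (N0 : nat), 0 < rho /\ forall f (th' : R) (N : nat),
    `|th' - th| < rho -> (forall n, iter d.+1 dlt f n = th') -> (N0 <= N)%N ->
    normc (\sum_(n < N) cis (f n)) <= eta * N%:R.
Proof.
elim: d th eta => [|d IH] th eta hth eta0.
  have c0 := cis_neq1 hth; set c := normc _ in c0.
  (* As 2 pi < 8, moving by less than c / 16 keeps |1 - cis th'| >= c / 2, and the geometric sum is
     at most 4 / c. *)
  exists (c / 16), (Num.truncn (4 / c / eta)).+1; split; first by rewrite divr_gt0.
  move=> f th' N hth' hf hN.
  have hc : c / 2 <= normc (1 - cis th').
    have : c <= normc (1 - cis th') + normc (cis th' - cis th).
      apply: le_trans (le_normcD _ _); rewrite /c le_eqVlt; apply/orP; left.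
      by apply/eqP; congr normc; ring.
    have := normc_cisB th' th; have p4 := @pi_lt4 R.
    have : 2 * pi * `|th' - th| <= 8 * `|th' - th|.
      by rewrite ler_wpM2r//; lra.
    by lra.
  have e : (\sum_(n < N) cis (f n)) * (1 - cis th') = cis (f 0%N) - cis (f N).
    elim: N {hN} => [|N IHN]; first by rewrite big_ord0 mul0r subrr.
    rewrite big_ord_recr /= mulrDl IHN.
    have -> : f N.+1 = f N + th' by rewrite -(hf N) /= /dlt addrC subrK.
    by rewrite cisD; ring.
  have h2 : normc (\sum_(n < N) cis (f n)) * normc (1 - cis th') <= 2.
    rewrite -Normc.normcM e; apply: le_trans (le_normcD _ _) _.
    by rewrite normcN !normc_cis; lra.
  have h3 : 4 / c <= eta * N%:R.
    rewrite (mulrC eta) -ler_pdivrMr//; apply: ltW.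
    by apply: lt_le_trans (truncnS_gt _) _; rewrite ler_nat.
  apply: le_trans h3; rewrite ler_pdivlMr//.
  have := normc_ge0 (\sum_(n < N) cis (f n)); nra.
have e80 : 0 < eta ^+ 2 / 8 by rewrite divr_gt0// exprn_gt0.
pose M := (Num.truncn (8 / eta ^+ 2)).+1.
have hM : 8 <= M%:R * eta ^+ 2.
  by rewrite -ler_pdivrMr ?exprn_gt0// ltW// truncnS_gt.
(* A shift by p multiplies the leading difference by p. Only the finitely many irrationals p th with
   p <= M occur, so common constants exist. *)
have [rho [N0 [rho0 h]]] : exists (rho : R) (N0 : nat), 0 < rho /\
    forall p, (0 < p <= M)%N -> forall f (th' : R) (N : nat),
    `|th' - th| < rho -> (forall n, iter d.+1 dlt f n = p%:R * th') -> (N0 <= N)%N ->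
    normc (\sum_(n < N) cis (f n)) <= eta ^+ 2 / 8 * N%:R.
  elim: M {hM} => [|M [rho [N0 [rho0 h]]]].
    by exists 1, 0%N; split=> // -[].
  have hirr := irrationalZ (ltn0Sn M) hth.
  have [rho1 [N1 [rho10 h1]]] := IH _ _ hirr e80.
  exists (Num.min rho (rho1 / M.+1%:R)), (maxn N0 N1); split.
    by rewrite lt_min rho0 divr_gt0.
  move=> p /andP[p0]; rewrite leq_eqVlt => /orP[/eqP ->|pM] f th' N;
    rewrite lt_min => /andP[ha hb] hf; rewrite geq_max => /andP[hN0 hN1].
    apply: (h1 f _ N _ hf hN1).
    by rewrite -mulrBr normrM ger0_norm// mulrC -ltr_pdivlMr// ltr0n.
  by apply: (h p _ f th' N ha hf hN0); rewrite p0.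
exists rho, (maxn N0 (Num.truncn (4 * M%:R / eta)).+1); split=> // f th' N hth' hf.
rewrite geq_max => /andP[hN0 hN1].
have hN2 : 4 * M%:R <= eta * N%:R.
  rewrite (mulrC eta) -ler_pdivrMr//; apply: ltW.
  by apply: lt_le_trans (truncnS_gt _) _; rewrite ler_nat.
apply: (@le_trans _ _ (2 * (1 * M)%:R + eta / 2 * N%:R)).
  apply: van_der_corput => // i j /andP[ij jM].
  apply: (h (j - i)%N _ (fun n => f (n + 1 * j)%N - f (n + 1 * i)%N) th' N hth' _ hN0).
    by rewrite subn_gt0 ij (leq_trans (leq_subr _ _))// ltnW.
  move=> n; rewrite dltn_increment ?mul1n; last by rewrite ltnW.
  rewrite (eq_bigr (fun=> th')) => [|i' _]; last exact: hf.
  by rewrite sumr_const_nat mulr_natl.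
by rewrite mul1n; lra.
Qed.

Lemma sum_residues z (q N : nat) : (0 < q)%N -> (forall n, normc (z n) <= 1) ->
  normc (\sum_(n < N) z n) <=
    \sum_(b < q) normc (\sum_(m < N %/ q) z (q * m + b)%N) + q%:R.
Proof.
move=> q0 hz.
have e M : \sum_(n < M * q) z n = \sum_(b < q) \sum_(m < M) z (q * m + b)%N.
  elim: M => [|M IH]; first by rewrite mul0n big_ord0 big1// => b _; rewrite big_ord0.
  rewrite mulSnr big_split_ord /= IH -big_split /=; apply: eq_bigr => b _.
  by rewrite big_ord_recr /= mulnC.
have -> : \sum_(n < N) z n = \sum_(n < N %/ q * q + N %% q) z n.
  by rewrite -divn_eq.
rewrite big_split_ord /= e.
apply: le_trans (le_normcD _ _) _; apply: lerD; first exact: normc_sum.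
apply: le_trans (normc_sum _ _ _) _.
apply: (@le_trans _ _ ((N %% q)%:R * 1)).
  by apply: sum_ord_le => // i _; exact: hz.
by rewrite mulr1 ler_nat ltnW// ltn_mod.
Qed.

Lemma dltn_poly_affine F (q b d n : nat) : (0 < q)%N -> size F = d.+1 ->
  iter d dlt (fun m => F.[(q * m + b)%:R]) n = (q ^ d * d`!)%:R * F`_d.
Proof.
move=> q0 es; pose L : {poly R} := q%:R *: 'X + b%:R%:P.
have s1 : (size (b%:R%:P : {poly R}) < size (q%:R *: 'X : {poly R}))%N.
  rewrite size_scale ?size_polyX ?pnatr_eq0 -?lt0n//.
  by rewrite (leq_ltn_trans (size_polyC_leq1 _)).
have s2 : size L = 2%N.
  by rewrite size_polyDl// size_scale ?size_polyX// pnatr_eq0 -lt0n.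
have l2 : lead_coef L = q%:R by rewrite lead_coefDl ?lead_coefZ ?lead_coefX ?mulr1.
have sQ : size (F \Po L) = d.+1 by rewrite size_comp_poly2.
have lQ : (F \Po L)`_d = F`_d * q%:R ^+ d.
  have := @lead_coef_comp _ F L; rewrite s2 => /(_ isT).
  by rewrite !lead_coefE sQ es -lead_coefE l2.
rewrite (@eq_dltn _ d _ (fun m => (F \Po L).[m%:R])); last first.
  by move=> m; rewrite horner_comp !hornerE natrD natrM.
by rewrite dltn_poly_lead ?sQ// lQ natrM natrX -mulr_natr; ring.
Qed.

Lemma uniform_below (P : nat -> nat -> Prop) (q : nat) :
  (forall b, (b < q)%N -> exists N0, forall N, (N0 <= N)%N -> P b N) ->
  exists N0, forall b N, (b < q)%N -> (N0 <= N)%N -> P b N.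
Proof.
elim: q => [|q IH] h; first by exists 0%N.
have [|N0 h0] := IH; first by move=> b bq; apply: h; rewrite ltnW.
have [N1 h1] := h q (ltnSn q).
exists (maxn N0 N1) => b N; rewrite ltnS leq_eqVlt geq_max => /orP[/eqP->|bq] /andP[a0 a1].
  exact: h1.
exact: h0.
Qed.

Lemma nat_ge (x : R) : exists N0 : nat, forall N, (N0 <= N)%N -> x <= N%:R.
Proof.
exists (Num.truncn x).+1 => N hN; apply: ltW.
by apply: lt_le_trans (truncnS_gt _) _; rewrite ler_nat.
Qed.

Lemma irrational_size F i : irrational F`_i -> (i < size F)%N.
Proof.
move=> irr; rewrite ltnNge; apply/negP => h.
by have := (irrationalP _).1 irr 1%N 0 isT; rewrite mul1r nth_default ?eqxx.
Qed.

Lemma sum_residues_le z (q N : nat) (eta : R) : (0 < q)%N -> 0 <= eta ->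
  (forall n, normc (z n) <= 1) ->
  (forall b, (b < q)%N ->
    normc (\sum_(m < N %/ q) z (q * m + b)%N) <= eta * (N %/ q)%:R) ->
  normc (\sum_(n < N) z n) <= eta * N%:R + q%:R.
Proof.
move=> q0 eta0 hz hb; apply: le_trans (sum_residues _ q0 hz) _; rewrite lerD2r.
apply: (@le_trans _ _ (q%:R * (eta * (N %/ q)%:R))).
  by apply: sum_ord_le => [|b _]; rewrite ?mulr_ge0// hb.
by rewrite mulrCA -natrM ler_wpM2l// ler_nat mulnC leq_trunc_div.
Qed.

Lemma weyl_poly F (q b : nat) (eta : R) :
  (exists2 i, (0 < i)%N & irrational F`_i) -> (0 < q)%N -> 0 < eta ->
  exists N0 : nat, forall N, (N0 <= N)%N ->
    normc (\sum_(m < N) cis F.[(q * m + b)%:R]) <= eta * N%:R.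
Proof.
have [n] := ubnP (size F); elim: n F q b eta => // n IH F q b eta.
rewrite ltnS => sF [i i0 irr] q0 eta0.
have := irrational_size irr; case es : (size F) => [//|d] si; rewrite ltnS in si.
have d0 : (0 < d)%N by rewrite (leq_trans i0).
have [irrd|] := pselect (irrational F`_d).
  have Q0 : (0 < q ^ d * d`!)%N by rewrite muln_gt0 expn_gt0 q0 fact_gt0.
  have [rho [N0 [rho0 h]]] := @weyl_lead d.-1 _ _ (irrationalZ Q0 irrd) eta0.
  exists N0 => N hN.
  apply: (h (fun m => F.[(q * m + b)%:R]) ((q ^ d * d`!)%:R * F`_d) N _ _ hN); first by rewrite subrr normr0.
  by move=> m; rewrite prednK// dltn_poly_affine.
move=> /rational_multiple[m0 m00 [z ez]].
pose F0 := \poly_(j < d) F`_j.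
have sF0 : (size F0 < n)%N by rewrite (leq_ltn_trans (size_poly _ _))// -es.
have irr0 : exists2 j, (0 < j)%N & irrational F0`_j.
  exists i => //; rewrite coef_poly; case: ifP => // /negbT; rewrite -leqNgt => di.
  have id : i = d by apply/eqP; rewrite eqn_leq si.
  by move: irr; rewrite id => /irrationalP/(_ m0 z m00); rewrite ez eqxx.
have eta20 : 0 < eta / 2 by rewrite divr_gt0.
have [N1 hN1] := @uniform_below (fun b' N => normc (\sum_(m < N)
    cis F0.[(q * m0 * m + (q * b' + b))%:R]) <= eta / 2 * N%:R) m0
  (fun b' _ => IH F0 (q * m0)%N (q * b' + b)%N (eta / 2) sF0 irr0
    (etrans (muln_gt0 _ _) (introT andP (conj q0 m00))) eta20).
have [N2 hN2] := nat_ge (2 * m0%:R / eta).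
exists (maxn (N1 * m0) N2) => N; rewrite geq_max => /andP[h1 h2].
apply: (@le_trans _ _ (eta / 2 * N%:R + m0%:R)).
  apply: (@sum_residues_le (fun n => cis F.[(q * n + b)%:R])) => // [|n'|b' bm].
  - exact: ltW.
  - by rewrite normc_cis.
  have hN : (N1 <= N %/ m0)%N by rewrite leq_divRL.
  apply: le_trans (hN1 _ _ bm hN).
  set c := (q * b' + b)%N.
  rewrite (eq_bigr (fun m : 'I_(N %/ m0) => cis (F`_d * (c%:R ^+ d)) * cis F0.[(q * m0 * m + c)%:R])).
    by rewrite -mulr_sumr Normc.normcM normc_cis mul1r.
  move=> m _; rewrite -cisD.
  have -> : (q * (m0 * m + b') + b = q * m0 * m + c)%N by rewrite /c; ring.
  set u := (q * m0 * m)%N.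
  (* As m0 divides u, the powers of u + c and c agree modulo m0, and the leading terms differ by an
     integer. *)
  have [t et] : exists t : nat, ((u + c) ^ d = c ^ d + m0 * t)%N.
    have : ((u + c) ^ d = c ^ d %[mod m0])%N.
      by rewrite -modnXm /u mulnAC modnMDl modnXm.
    move=> /eqP; rewrite eqn_mod_dvd; last by rewrite leq_exp2r// leq_addl.
    move=> /dvdnP[t et]; exists t; rewrite mulnC -et subnKC// leq_exp2r// leq_addl//.
  have e1 x : F.[x] = F0.[x] + F`_d * x ^+ d.
    by rewrite horner_coef es big_ord_recr /= horner_poly.
  have e2 : F`_d * (u + c)%:R ^+ d = F`_d * c%:R ^+ d + (t%:Z * z)%:~R.
    rewrite -!natrX et natrD natrM mulrDr intrM -ez -pmulrn.
    by ring.
  by rewrite e1 e2 addrA cisDint addrC.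
have : 2 * m0%:R <= eta * N%:R by rewrite (mulrC eta) -ler_pdivrMr// hN2.
lra.
Qed.

End Weyl.

(** * Weyl sums uniformly in the frequency *)

Section WeylUniform.
Variable R : realType.
Implicit Types (f g : nat -> R) (z w : nat -> R[i]) (P Q F : {poly R}).
Local Notation normc := (@Normc.normc R).

Lemma horner_bound Q : exists2 C : R, 0 < C & forall (x Y : R),
  `|x| <= Y -> 1 <= Y -> `|Q.[x]| <= C * Y ^+ (size Q).-1.
Proof.
exists (1 + \sum_(i < size Q) `|Q`_i|).
  by rewrite ltr_pwDl// sumr_ge0.
move=> x Y xY Y1; rewrite horner_coef; apply: le_trans (ler_norm_sum _ _ _) _.
apply: (@le_trans _ _ ((\sum_(i < size Q) `|Q`_i|) * Y ^+ (size Q).-1)).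
  rewrite mulr_suml; apply: ler_sum => i _; rewrite normrM normrX ler_wpM2l//.
  apply: (@le_trans _ _ (Y ^+ i)); first by rewrite lerXn2r ?nnegrE//; lra.
  by rewrite ler_weXn2l// -ltnS prednK// (leq_ltn_trans _ (ltn_ord i)).
by rewrite ler_wpM2r ?exprn_ge0 ?lerDr//; lra.
Qed.

Lemma horner_increment P d : (size P <= d.+2)%N -> exists2 C : R, 0 < C &
  forall (n N : nat), (n < N)%N -> `|P.[n.+1%:R] - P.[n%:R]| <= C * N%:R ^+ d.
Proof.
move=> sP; have [C C0 hC] := horner_bound P^`(); exists C => // n N nN.
have [|c /andP[c1 c2] ->] := @mvt R (horner P) (horner P^`()) n%:R n.+1%:R _
    (fun x _ => is_derive_poly P x).
  by rewrite ler_nat.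
have N1 : 1 <= N%:R :> R by rewrite ler1n (leq_trans _ nN).
rewrite -[n.+1%:R]natr1 addrAC subrr add0r mulr1.
have c3 : `|c| <= N%:R.
  rewrite ger0_norm; last by rewrite (le_trans _ c1).
  by rewrite (le_trans c2)// ler_nat.
apply: le_trans (hC _ _ c3 N1) _; rewrite ler_pM2l// ler_weXn2l//.
have [P0|P0] := eqVneq P 0; first by rewrite P0 deriv0 size_poly0.
by have := lt_size_deriv P0; move: sP; lia.
Qed.

(** Abel summation needs all partial sums bounded in terms of the full length; the short ones are
    bounded trivially. *)
Lemma partial_sums z (eta : R) : 0 < eta -> (forall n, normc (z n) <= 1) ->
  (exists N0 : nat, forall N, (N0 <= N)%N -> normc (\sum_(n < N) z n) <= eta * N%:R) ->
  exists N0 : nat, forall N m, (N0 <= N)%N -> (m <= N)%N ->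
    normc (\sum_(n < m) z n) <= eta * N%:R.
Proof.
move=> eta0 hz [N0 h0]; have [N1 h1] := nat_ge (N0%:R / eta).
exists N1 => N m /h1; rewrite ler_pdivrMr// mulrC => hN mN.
have [hm|hm] := leqP N0 m.
  by apply: le_trans (h0 _ hm) _; rewrite ler_pM2l// ler_nat.
apply: le_trans hN; apply: le_trans (normc_sum _ _ _) _.
apply: (@le_trans _ _ (m%:R * 1)); first by apply: sum_ord_le.
by rewrite mulr1 ler_nat ltnW.
Qed.

(** Subtracting an integer multiple of this binomial coefficient removes an integer from the top
    difference without changing [cis]. *)
Lemma dltn_bin d n : iter d dlt (fun m => 'C(m, d)%:R : R) n = 1.
Proof.
elim: d n => [|d IH] n; first by rewrite /= bin0.
rewrite iterSr -[RHS](IH n); apply: eq_dltn => m.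
by rewrite /dlt binS natrD addrAC subrr add0r.
Qed.

(* If the leading coefficient of psi0 *: P is rational, its contribution at
   psi = psi0 is removed along residue classes.  For psi near psi0, either the
   derivative test applies to the top difference of (psi - psi0) *: P, or this
   perturbation is so small that Abel summation reduces to psi0. *)
Lemma weyl_near P (psi0 eta : R) :
  (exists2 i, (0 < i)%N & irrational (psi0 * P`_i)) -> 0 < eta ->
  exists (rho : R) (N0 : nat), 0 < rho /\ forall (psi : R) (N : nat),
    `|psi - psi0| < rho -> (N0 <= N)%N ->
    normc (\sum_(n < N) cis (psi * P.[n%:R])) <= eta * N%:R.
Proof.
move=> [i i0 irr] eta0; pose F := psi0 *: P.
have irrF : irrational F`_i by rewrite coefZ.
have psi00 : psi0 != 0.
  by apply/eqP => e; have := (irrationalP _).1 irr 1%N 0 isT; rewrite e mul0r mulr0 eqxx.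
have := irrational_size irrF; rewrite size_scale//.
case es : (size P) => [//|[|d]] si; first by move: i0; rewrite ltnNge -ltnS si.
pose c := P`_d.+1.
have c0 : c != 0 by rewrite /c -[d.+1]/(d.+2.-1) -es -lead_coefE lead_coef_eq0 -size_poly_eq0 es.
have nc0 : 0 < `|c| by rewrite normr_gt0.
have f0 : 0 < (d.+1)`!%:R :> R by rewrite ltr0n fact_gt0.
have hD q b n psi : (0 < q)%N -> iter d.+1 dlt (fun m => psi * P.[(q * m + b)%:R]) n
    = psi * ((q ^ d.+1 * (d.+1)`!)%:R * c).
  by move=> q0; rewrite dltnZ dltn_poly_affine.
have [irrd|] := pselect (irrational (psi0 * c)).
  have [rho [N0 [rho0 h]]] := @weyl_lead _ d _ _ (irrationalZ (fact_gt0 d.+1) irrd) eta0.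
  exists (rho / ((d.+1)`!%:R * `|c|)), N0; split; first by rewrite divr_gt0// mulr_gt0.
  move=> psi N hpsi hN.
  apply: (h (fun m => psi * P.[m%:R]) ((d.+1)`!%:R * (psi * c)) N _ _ hN).
    rewrite -mulrBr -mulrBl !normrM mulrCA (ger0_norm (ltW f0)).
    by rewrite -ltr_pdivlMr// mulr_gt0.
  move=> n; rewrite -(mul1n d.+1`!) -(exp1n d.+1) mulrCA -(hD 1%N 0%N n)//.
  by apply: eq_dltn => m; rewrite mul1n addn0.
move=> /rational_multiple[q q0 [t ez]].
have [||K [eps [K0 eps0 hT]]] := @derivative_test R d (eta / 4) 1 => //.
  by rewrite divr_gt0.
(* The top difference of P along a residue class modulo q; multiplied by [psi0] it is an integer,
   because q clears the denominator of the leading coefficient. *)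
pose G : R := (q ^ d.+1 * (d.+1)`!)%:R * c.
have nG : `|G| = (q ^ d.+1 * (d.+1)`!)%:R * `|c| by rewrite normrM ger0_norm.
have nG0 : 0 < `|G| by rewrite nG mulr_gt0// ltr0n muln_gt0 expn_gt0 q0 fact_gt0.
have [Z eZ] : exists Z : int, psi0 * G = Z%:~R.
  exists ((q ^ d * (d.+1)`!)%N%:Z * t); rewrite intrM -ez -pmulrn /G.
  by rewrite expnS -mulnA natrM; ring.
have [C C0 hC] := @horner_increment P d (eq_leq es).
(* Bounds the variation of the factor [cis ((psi - psi0) * P)] when the derivative test fails: 8
   bounds 2 pi, C comes from the increments of P, and the last factor from |nu| N'^(d+1) < K
   together with N <= 2 q N'. *)
pose V := 8 * C * (2 ^+ d.+1 * K / ((d.+1)`!%:R * `|c|)).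
have V0 : 0 < V.
  have h1 : 0 < 2 ^+ d.+1 * K by rewrite mulr_gt0// exprn_gt0.
  by apply: mulr_gt0; [exact: mulr_gt0|rewrite divr_gt0// mulr_gt0].
pose eta' := eta / (1 + V).
have eta'0 : 0 < eta' by rewrite divr_gt0// addr_gt0.
have [N0 hN0] : exists N0 : nat, forall N m, (N0 <= N)%N -> (m <= N)%N ->
    normc (\sum_(n < m) cis (psi0 * P.[n%:R])) <= eta' * N%:R.
  apply: (@partial_sums (fun n => cis (psi0 * P.[n%:R]))) => // [n|].
    by rewrite normc_cis.
  have [||N0 h] := @weyl_poly R F 1 0 eta' _ _ eta'0 => //; first by exists i.
  exists N0 => N /h; under eq_bigr do rewrite mul1n addn0 hornerZ; exact.
have [N1 hN1] := nat_ge (2 * q%:R / eta).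
exists (eps / `|G|), (maxn q.+1 (maxn N0 N1)); split; first by rewrite divr_gt0.
move=> psi N; rewrite ltr_pdivlMr// => hpsi; rewrite !geq_max => /and3P[qN /hN0 hN /hN1 hq].
have N0p : (0 < N)%N by rewrite (leq_trans _ qN).
have Np : 0 < N%:R :> R by rewrite ltr0n.
pose N' := (N %/ q)%N; pose nu := (psi - psi0) * G.
have nnu : `|nu| = `|psi - psi0| * `|G| by rewrite normrM.
have [hK|hK] := lerP K (`|nu| * N'%:R ^+ d.+1).
  apply: (@le_trans _ _ (eta / 4 * N%:R + q%:R)); last first.
    have : 2 * q%:R <= eta * N%:R by rewrite (mulrC eta) -ler_pdivrMr.
    have : 0 < eta * N%:R by rewrite mulr_gt0.
    lra.
  apply: (@sum_residues_le _ (fun n => cis (psi * P.[n%:R]))) => // [|n|b bq].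
  - by rewrite divr_ge0// ltW.
  - by rewrite normc_cis.
  pose s : R := if 0 <= nu then 1 else -1.
  have s1 : `|s| = 1 by rewrite /s; case: ifP => _; rewrite ?normrN normr1.
  have snu : s * nu = `|nu|.
    rewrite /s; case: (lerP 0 nu) => h; first by rewrite mul1r ger0_norm.
    by rewrite mulN1r ltr0_norm.
  (* The values of [cis] are unchanged, but the top difference is now nu, which is small, instead of
     psi G. *)
  pose g m := psi * P.[(q * m + b)%:R] - Z%:~R * 'C(m, d.+1)%:R.
  have cg m : cis (g m) = cis (psi * P.[(q * m + b)%:R]).
    rewrite /g [X in _ - X](_ : _ = (Z * 'C(m, d.+1)%:Z)%:~R); last by rewrite intrM.
    by rewrite -rmorphN cisDint.
  have Dg m : iter d.+1 dlt (fun m => s * g m) m = `|nu|.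
    rewrite dltnZ dltnB hD// dltnZ dltn_bin mulr1 -eZ -snu /nu -/G.
    by ring.
  have := hT (fun m => s * g m) N' `|nu| 1 (normr1 _) _ _ hK _.
  have -> : normc (\sum_(n < N') cis (s * g n)) =
      normc (\sum_(m < N') cis (psi * P.[(q * m + b)%:R])).
    rewrite /s; case: ifP => _.
      by congr normc; apply: eq_bigr => m _; rewrite mul1r cg.
    rewrite -normc_conj conj_sum_cis; congr normc; apply: eq_bigr => m _.
    by rewrite mulN1r opprK cg.
  apply => [m _|m _|]; first by rewrite Dg mul1r lexx.
    by rewrite dltnS !Dg subrr mulr0.
  by rewrite nnu ltW.
have hV : 8 * C * (`|psi - psi0| * N%:R ^+ d.+1) <= V.
  rewrite /V ler_pM2l ?mulr_gt0// ler_pdivlMr ?mulr_gt0//.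
  have qN' : N%:R <= 2 * q%:R * N'%:R :> R.
    rewrite -!natrM ler_nat {1}(divn_eq N q) -/N'.
    have r1 : (N %% q <= q)%N by rewrite ltnW// ltn_mod.
    have r2 : (0 < N')%N by rewrite divn_gt0// ltnW.
    by rewrite -mulnA mul2n -addnn mulnC leq_add2l (leq_trans r1)// leq_pmulr.
  have : N%:R ^+ d.+1 <= (2 * q%:R * N'%:R) ^+ d.+1 :> R.
    by rewrite lerXn2r ?nnegrE// !mulr_ge0.
  have q0r : 0 < q%:R ^+ d.+1 :> R by rewrite exprn_gt0// ltr0n.
  rewrite !exprMn => h; move: hK; rewrite nnu nG natrM natrX => hK.
  have X0 : 0 <= `|psi - psi0| * ((d.+1)`!%:R * `|c|) by rewrite mulr_ge0// mulr_ge0// ltW.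
  have := ler_wpM2l X0 h; have P2 : 0 < 2 ^+ d.+1 :> R by rewrite exprn_gt0.
  have := ltr_pM2l P2; move=> /(_ (`|psi - psi0| * (q%:R ^+ d.+1 * (d.+1)`!%:R * `|c|) * N'%:R ^+ d.+1) K).
  rewrite hK => h1 h2; apply: ltW.
  by apply: le_lt_trans h1; rewrite mulrAC; apply: le_trans h2 _; rewrite le_eqVlt; apply/orP; left; apply/eqP; ring.
pose w n := cis ((psi - psi0) * P.[n%:R]).
rewrite (eq_bigr (fun n : 'I_N => cis (psi0 * P.[n%:R]) * w n)); last first.
  by move=> n _; rewrite -cisD; congr cis; ring.
apply: le_trans (@abel_summation _ (fun n => cis (psi0 * P.[n%:R])) w N _ hN) _.
have -> : eta * N%:R = eta' * N%:R * (1 + V).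
  by rewrite /eta'; field; lra.
rewrite ler_pM2l; last exact: (mulr_gt0 eta'0).
rewrite /w normc_cis lerD2l -/w.
apply: le_trans hV.
apply: (@le_trans _ _ (N%:R * (8 * `|psi - psi0| * (C * N%:R ^+ d)))); last first.
  by rewrite exprS le_eqVlt; apply/orP; left; apply/eqP; ring.
apply: sum_ord_le => [|n _]; first by rewrite !mulr_ge0 ?exprn_ge0// ltW.
apply: le_trans (normc_cisB _ _) _; rewrite -mulrBr normrM mulrA.
have := @pi_lt4 R => p4.
apply: ler_pM; rewrite ?mulr_ge0 ?pi_ge0//; last exact: hC.
by rewrite ler_wpM2r//; lra.
Qed.

(** Finitely many of the neighborhoods given by [weyl_near] cover [a, b]; a > 0 keeps the frequency
    0, where nothing cancels, away. *)
Lemma weyl_uniform P (a b eta : R) : 0 < a ->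
  (forall psi, psi != 0 -> exists2 i, (0 < i)%N & irrational (psi * P`_i)) ->
  0 < eta ->
  exists N0 : nat, forall (psi : R) (N : nat), a <= psi <= b -> (N0 <= N)%N ->
    normc (\sum_(n < N) cis (psi * P.[n%:R])) <= eta * N%:R.
Proof.
move=> a0 hP eta0.
have /compact_near_coveringP hc := @segment_compact R a b.
have [] := hc _ \oo (fun N psi =>
    normc (\sum_(n < N) cis (psi * P.[n%:R])) <= eta * N%:R) _ _.
  move=> psi0; rewrite /= in_itv /= => /andP[p1 p2].
  have [|rho [N0 [rho0 h]]] := @weyl_near P psi0 eta _ eta0.
    by apply: hP; rewrite gt_eqF//; lra.
  exists (ball psi0 rho, [set N | (N0 <= N)%N]) => /=.
    by split; [exact: nbhsx_ballx|exists N0].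
  by move=> [psi N] /= [h1 h2]; apply: h => //; rewrite distrC.
move=> N0 _ h; exists N0 => psi N hp hN.
by apply: (h N hN); rewrite /= in_itv.
Qed.

End WeylUniform.

(** * Growth of functions in a Hardy field *)

Section Asymptotics.
Variable R : realType.
Implicit Types (f g df : R -> R).

Lemma eventuallyP (P : R -> Prop) :
  (\forall x \near +oo, P x) <-> exists2 M : R, 1 <= M & forall x, M <= x -> P x.
Proof.
split=> [[M [_ hM]]|[M _ hM]]; last first.
  by exists M; split=> [|x /ltW /hM]; first exact: num_real.
exists (Num.max 1 (M + 1)); first by rewrite le_max lexx.
by move=> x; rewrite ge_max => /andP[_ Mx]; apply: hM; lra.
Qed.

Lemma eventually_ge (M : R) : \forall x \near +oo, M <= x.
Proof. by apply: nbhs_pinfty_ge; rewrite num_real. Qed.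

Lemma eventually_False : ~ (\forall x \near (+oo : set_system R), False).
Proof. by move=> /eventuallyP[M _ h]; exact: (h M). Qed.

Lemma nondecreasing_of_derive f df (M : R) :
  (forall x, M <= x -> is_derive x 1 f (df x)) -> (forall x, M <= x -> 0 <= df x) ->
  forall x y, M <= x -> x <= y -> f x <= f y.
Proof.
move=> hd h0 x y Mx xy.
have [|c /andP[c1 c2] e] := @mvt R f df x y xy.
  by move=> z /andP[z1 _]; apply: hd; lra.
by rewrite -subr_ge0 e mulr_ge0 ?subr_ge0// h0; lra.
Qed.

Lemma is_deriveXn (n : nat) (x : R) : is_derive x 1 (fun y : R => y ^+ n) (n%:R * x ^+ n.-1).
Proof.
have := is_deriveX n (is_derive_id x (1 : R)).
by rewrite exprfctE /GRing.scale /= mulr1.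
Qed.

Lemma is_derive_MXn f (n : nat) (x d : R) : is_derive x 1 f d ->
  is_derive x 1 (fun y => f y * y ^+ n) (f x * (n%:R * x ^+ n.-1) + x ^+ n * d).
Proof. by move=> hd; exact: (is_deriveM hd (is_deriveXn n x)). Qed.

Lemma is_derive_MXnV f (n : nat) (x d : R) : x != 0 -> is_derive x 1 f d ->
  is_derive x 1 (fun y => f y * y^-1 ^+ n) (x^-1 ^+ n.+1 * (x * d - n%:R * f x)).
Proof.
move=> x0 hd.
have hV := is_deriveV x0 (is_derive_id x (1 : R)).
have := is_deriveM hd (is_deriveX n hV).
rewrite exprfctE => h; apply: is_derive_eq h _; rewrite /GRing.scale /= mulr1.
case: n => [|n] /=; rewrite ?expr0 ?exprS; field.
all: by rewrite ?x0.
Qed.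

(** The differential inequality says that f / x^m is nondecreasing. The two lemmas that follow are
    the analogues for the other monotonicity and for f x^m. *)
Lemma power_lower f df (M : R) (m : nat) : 0 < M ->
  (forall x, M <= x -> is_derive x 1 f (df x)) ->
  (forall x, M <= x -> m%:R * f x <= x * df x) ->
  forall x y, M <= x -> x <= y -> f x * y ^+ m <= f y * x ^+ m.
Proof.
move=> M0 hd hm x y Mx xy.
have x0 : 0 < x by lra. have y0 : 0 < y by lra.
have : f x * x^-1 ^+ m <= f y * y^-1 ^+ m.
  apply: (@nondecreasing_of_derive (fun y => f y * y^-1 ^+ m)
    (fun x => x^-1 ^+ m.+1 * (x * df x - m%:R * f x)) M) => // z Mz.
    by apply: is_derive_MXnV; [rewrite gt_eqF//; lra|exact: hd].
  by rewrite mulr_ge0 ?subr_ge0 ?hm// exprn_ge0// invr_ge0; lra.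
rewrite !exprVn ler_pdivrMr ?exprn_gt0// mulrAC ler_pdivlMr ?exprn_gt0//.
Qed.

Lemma power_upper f df (M : R) (m : nat) : 0 < M ->
  (forall x, M <= x -> is_derive x 1 f (df x)) ->
  (forall x, M <= x -> x * df x <= m%:R * f x) ->
  forall x y, M <= x -> x <= y -> f y * x ^+ m <= f x * y ^+ m.
Proof.
move=> M0 hd hm x y Mx xy.
rewrite -lerN2 -!mulNr; apply: (@power_lower (fun x => - f x) (fun x => - df x) M) => // z Mz.
  exact: is_deriveN (hd _ Mz).
by rewrite !mulrN lerN2 hm.
Qed.

Lemma power_decay f df (M : R) (m : nat) : 0 < M ->
  (forall x, M <= x -> is_derive x 1 f (df x)) ->
  (forall x, M <= x -> x * df x <= - (m%:R * f x)) ->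
  forall x y, M <= x -> x <= y -> f y * y ^+ m <= f x * x ^+ m.
Proof.
move=> M0 hd hm x y Mx xy; rewrite -lerN2.
apply: (@nondecreasing_of_derive (fun y => - (f y * y ^+ m))
    (fun x => - (f x * (m%:R * x ^+ m.-1) + x ^+ m * df x)) M) => // z Mz.
  apply: is_deriveN; exact: (is_derive_MXn m (hd _ Mz)).
have z0 : 0 < z by lra.
rewrite -oppr0 lerN2; case: m hm => [|m] hm.
  have := hm _ Mz; rewrite !mul0r oppr0 mulr0 add0r expr0 mul1r.
  by rewrite pmulr_rle0.
have := hm _ Mz; rewrite -lerBrDr sub0r /= exprS => h.
have := ler_wpM2r (exprn_ge0 m (ltW z0)) h; lra.
Qed.

Lemma derive_lower f df (j : nat) (c : R) : 0 < c ->
  (\forall x \near +oo, is_derive (x : R) (1 : R) f (df x)) ->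
  (\forall x \near +oo, c * x ^+ j <= df x) ->
  exists2 c', 0 < c' & \forall x \near +oo, c' * x ^+ j.+1 <= f x.
Proof.
move=> c0 hd hc.
have /eventuallyP[M M1 hM] : \forall x \near +oo, is_derive (x : R) (1 : R) f (df x) /\ c * x ^+ j <= df x.
  by near=> x; split; near: x.
pose e := c / j.+1%:R; have e0 : 0 < e by rewrite divr_gt0.
exists (e / 2); first by rewrite divr_gt0.
pose B := `|f M - e * M ^+ j.+1|.
near=> x.
have Mx : M <= x by near: x; exact: eventually_ge.
have : f M - e * M ^+ j.+1 <= f x - e * x ^+ j.+1.
  apply: (@nondecreasing_of_derive (fun x => f x - e * x ^+ j.+1)
     (fun x => df x - e * (j.+1%:R * x ^+ j)) M) => // z Mz.
    apply: is_deriveB; first by have [] := hM _ Mz.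
    exact: (is_deriveZ e (is_deriveXn j.+1 z)).
  have [_] := hM _ Mz; rewrite subr_ge0 mulrA /e divfK ?pnatr_eq0//.
have : - B <= f M - e * M ^+ j.+1 by rewrite lerNl /B -normrN ler_norm.
have hx : 2 * B / e <= x by near: x; exact: eventually_ge.
have : x <= x ^+ j.+1 by rewrite exprS ler_peMr ?exprn_ege1//; lra.
move: hx; rewrite ler_pdivrMr// => hx hx2 h1 h2.
have := ler_wpM2l (ltW e0) hx2; lra.
Unshelve. all: by end_near. Qed.

Lemma derive_upper f df (j : nat) :
  (\forall x \near +oo, is_derive (x : R) (1 : R) f (df x)) ->
  (forall e : R, 0 < e -> \forall x \near +oo, `|df x| <= e * x ^+ j) ->
  forall e : R, 0 < e -> \forall x \near +oo, `|f x| <= e * x ^+ j.+1.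
Proof.
move=> hd hc e e0; have e20 : 0 < e / 2 by rewrite divr_gt0.
have /eventuallyP[M M1 hM] : \forall x \near +oo,
    is_derive (x : R) (1 : R) f (df x) /\ `|df x| <= e / 2 * x ^+ j.
  by near=> x; split; near: x => //; exact: hc.
near=> x.
have Mx : M <= x by near: x; exact: eventually_ge.
have h s : `|s| = 1 -> s * f x <= `|f M| + e / 2 * x ^+ j.+1.
  move=> s1.
  have sM : s * f M <= `|f M| by rewrite (le_trans (ler_norm _))// normrM s1 mul1r.
  have pM : 0 <= e / 2 * M ^+ j.+1 by rewrite mulr_ge0 ?exprn_ge0//; lra.
  have : e / 2 * M ^+ j.+1 - s * f M <= e / 2 * x ^+ j.+1 - s * f x; last by lra.
  apply: (@nondecreasing_of_derive (fun x => e / 2 * x ^+ j.+1 - s * f x)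
     (fun x => e / 2 * (j.+1%:R * x ^+ j) - s * df x) M _ _ M x (lexx M) Mx) => z Mz.
    apply: is_deriveB; first exact: (is_deriveZ (e / 2) (is_deriveXn j.+1 z)).
    by apply: is_deriveZ; have [] := hM _ Mz.
  have [_ hz] := hM _ Mz; rewrite subr_ge0.
  apply: (@le_trans _ _ `|df z|); first by rewrite (le_trans (ler_norm _))// normrM s1 mul1r.
  apply: le_trans hz _; rewrite ler_pM2l// ler_peMl ?exprn_ge0 ?ler1n//; lra.
have h1 := h 1 (normr1 _); have h2 := h (-1) _.
have hx : 2 * `|f M| / e <= x by near: x; exact: eventually_ge.
have : x <= x ^+ j.+1 by rewrite exprS ler_peMr ?exprn_ege1//; lra.
move: hx; rewrite ler_pdivrMr// => hx hx2.
have := ler_wpM2l (ltW e0) hx2.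
rewrite ler_norml; have := h2 (etrans (normrN _) (normr1 _)).
by move=> ? ?; apply/andP; split; lra.
Unshelve. all: by end_near. Qed.

(* The error term 1/x^(j+1) of the derivative integrates to 1/x^j, up to a
   constant of integration. *)
Lemma derive_limit f df (j : nat) (C : R) : (0 < j)%N -> 0 <= C ->
  (\forall x \near +oo, is_derive (x : R) (1 : R) f (df x)) ->
  (\forall x \near +oo, `|df x| * x ^+ j.+1 <= C) ->
  exists c, \forall x \near +oo, `|f x - c| * x ^+ j <= C.
Proof.
move=> j0 C0 hd hC.
have /eventuallyP[M M1 hM] : \forall x \near +oo,
    is_derive (x : R) (1 : R) f (df x) /\ `|df x| * x ^+ j.+1 <= C.
  by near=> x; split; near: x.
have mono s : `|s| = 1 -> forall x y, M <= x -> x <= y ->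
    s * f x - C * x^-1 ^+ j <= s * f y - C * y^-1 ^+ j.
  move=> s1.
  apply: (@nondecreasing_of_derive (fun x => s * f x - C * x^-1 ^+ j)
     (fun x => s * df x - C * (x^-1 ^+ j.+1 * (x * 0 - j%:R * 1)))) => // z Mz.
    apply: is_deriveB; first by apply: is_deriveZ; have [] := hM _ Mz.
    apply: is_deriveZ.
    have := @is_derive_MXnV (cst 1) j z 0 _ (is_derive_cst _ _ _).
    rewrite gt_eqF; last by lra.
    move=> /(_ isT); congr is_derive; apply/funext => y /=; exact: mul1r.
  have [_ hz] := hM _ Mz; have z0 : 0 < z by lra.
  rewrite mulr0 mulr1 sub0r mulrN mulrN opprK.
  have : - `|df z| <= s * df z by rewrite lerNl -mulNr (le_trans (ler_norm _))// normrM normrN s1 mul1r.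
  have : `|df z| <= C * (z^-1 ^+ j.+1 * j%:R).
    apply: (@le_trans _ _ (C * z^-1 ^+ j.+1)).
      by rewrite exprVn ler_pdivlMr ?exprn_gt0.
    rewrite ler_wpM2l// ler_peMr ?ler1n// exprn_ge0// invr_ge0; lra.
  lra.
have h1 := mono 1 (normr1 _); have h2 := mono (-1) (etrans (normrN _) (normr1 _)).
(* By [mono], f - C / x^j is nondecreasing and f + C / x^j is nonincreasing; c is the supremum of
   the former and lies below the latter. *)
pose S := [set f x - C * x^-1 ^+ j | x in [set x | M <= x]].
have ub y : M <= y -> ubound S (f y + C * y^-1 ^+ j).
  move=> My _ [x /= Mx <-].
  have [xy|/ltW yx] := leP x y.
    have := h1 _ _ Mx xy; have : 0 <= C * y^-1 ^+ j.
      by rewrite mulr_ge0// exprn_ge0// invr_ge0; lra.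
    lra.
  have := h2 _ _ My yx; have : 0 <= C * x^-1 ^+ j.
    by rewrite mulr_ge0// exprn_ge0// invr_ge0; lra.
  lra.
have S0 : S (f M - C * M^-1 ^+ j) by exists M => /=.
exists (sup S); apply/eventuallyP; exists M => // x Mx.
have x0 : 0 < x by lra.
have i1 : sup S <= f x + C * x^-1 ^+ j.
  by apply: ge_sup; [exists (f M - C * M^-1 ^+ j)|exact: ub].
have i2 : f x - C * x^-1 ^+ j <= sup S.
  apply: ub_le_sup; last by exists x.
  by exists (f x + C * x^-1 ^+ j); exact: ub.
rewrite -ler_pdivlMr ?exprn_gt0// -exprVn ler_norml; apply/andP; split; lra.
Unshelve. all: by end_near. Qed.

End Asymptotics.

(** * Signs, monotonicity and logarithmic derivatives of germs *)

Section HardyFields.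
Variables (R : realType) (H : set (R -> R)).
Hypothesis hH : hardy_field H.
Implicit Types (f g : R -> R).

Lemma hardy_is_derive f : H f ->
  \forall x \near +oo, is_derive (x : R) (1 : R) f (f^`()%classic x).
Proof.
move=> /(hardy_derive hH)[h _]; near=> x; rewrite derive1E; apply/derivableP.
by near: x.
Unshelve. all: by end_near. Qed.

Lemma hardy_derive1n k f : H f -> H (derive1n k f).
Proof. by move=> hf; elim: k => // k IH; exact: (hardy_derive hH IH).2. Qed.

(** A nonzero germ is invertible, hence has no zeros far out, and continuity then fixes its sign. *)
Lemma hardy_sign f : H f -> (\forall x \near +oo, f x = 0) \/
  exists2 s : R, `|s| = 1 & \forall x \near +oo, 0 < s * f x.
Proof.
move=> hf; have [f0|f0] := pselect (germ_eq f (fun=> 0)); first by left.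
right; have [g hg hfg] := hardy_inv hH hf f0.
have /eventuallyP[M M1 hM] : \forall x \near +oo, f x * g x = 1 /\ {for x, continuous f}.
  by near=> x; split; near: x => //; exact: (hardy_continuous hH hf).
have fn0 x : M <= x -> f x != 0.
  move=> /hM[h _]; apply/eqP => e; move: h; rewrite e mul0r => /eqP.
  by rewrite eq_sym oner_eq0.
pose s : R := if 0 < f M then 1 else -1.
have s1 : `|s| = 1 by rewrite /s; case: ifP => _; rewrite ?normrN normr1.
have sn0 : s != 0 by rewrite -normr_gt0 s1.
have sM : 0 < s * f M.
  rewrite /s; case: (ltP 0 (f M)) => h; rewrite ?mul1r ?mulN1r// oppr_gt0.
  by rewrite lt_neqAle h fn0.
exists s => //; apply/eventuallyP; exists M => // x Mx.
rewrite ltNge; apply/negP => sx.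
have [||c] := @IVT R (fun y => s * f y) M x 0 Mx.
- apply: continuous_in_subspaceT => y; rewrite inE /= in_itv /= => /andP[My _].
  by apply: continuousM; [exact: cst_continuous|have [] := hM _ My].
- by rewrite ge_min le_max sx (ltW sM) orbT.
rewrite in_itv /= => /andP[Mc _] /eqP; rewrite mulf_eq0 (negPf sn0) /=.
by rewrite (negPf (fn0 _ Mc)).
Unshelve. all: by end_near. Qed.

Lemma hardy_weak_sign f : H f ->
  exists2 s : R, `|s| = 1 & \forall x \near +oo, 0 <= s * f x.
Proof.
move=> /hardy_sign[h|[s s1 h]]; [exists 1; rewrite ?normr1//|exists s => //]; near=> x.
  by rewrite mul1r le_eqVlt eq_sym; apply/orP; left; apply/eqP; near: x.
by apply: ltW; near: x.
Unshelve. all: by end_near. Qed.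

Lemma sign_mul (s x : R) : `|s| = 1 -> 0 <= s * x -> s * x = `|x|.
Proof. by move=> s1 h; rewrite -(ger0_norm h) normrM s1 mul1r. Qed.

Lemma hardy_monotone f : H f -> exists2 M : R, 1 <= M &
  (forall x y, M <= x -> x <= y -> `|f x| <= `|f y|) \/
  (forall x y, M <= x -> x <= y -> `|f y| <= `|f x|).
Proof.
move=> hf; have hf' := (hardy_derive hH hf).2; have hd := hardy_is_derive hf.
have [s s1 hs] := hardy_weak_sign hf; have [t t1 ht] := hardy_weak_sign hf'.
have /eventuallyP[M M1 hM] : \forall x \near +oo, [/\ 0 <= s * f x, 0 <= t * f^`()%classic x
    & is_derive (x : R) (1 : R) f (f^`()%classic x)].
  by near=> x; split; near: x.
exists M => //.
have fs x : M <= x -> s * f x = `|f x| by move=> /hM[h _ _]; exact: sign_mul.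
have mono := @nondecreasing_of_derive R (fun x => t * f x) _ M
  (fun x Mx => is_deriveZ t (let: And3 _ _ h := hM x Mx in h))
  (fun x Mx => let: And3 _ h _ := hM x Mx in h).
have /eqP : `|s| = `|t| by rewrite s1.
rewrite eqr_norm2 => /orP[]/eqP est; [left|right] => x y Mx xy.
  by rewrite -!fs ?est ?mono//; lra.
by rewrite -!fs ?est ?mulNr ?lerN2 ?mono//; lra.
Unshelve. all: by end_near. Qed.

(** Eventually |f| is monotone, so it either falls below every positive bound for good or stays
    above one of them. *)
Lemma hardy_dichotomy f : H f -> (forall e : R, 0 < e -> \forall x \near +oo, `|f x| <= e) \/
  exists2 c : R, 0 < c & \forall x \near +oo, c <= `|f x|.
Proof.
move=> hf; have [f0|[s s1 hs]] := hardy_sign hf.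
  left=> e e0; near=> x; have -> : f x = 0 by near: x.
  by rewrite normr0 ltW.
have [M M1 [mono|mono]] := hardy_monotone hf.
  have /eventuallyP[M' M'1 hM'] : \forall x \near +oo, 0 < s * f x /\ M <= x.
    by near=> x; split; near: x => //; exact: eventually_ge.
  have [h1 h2] := hM' M' (lexx _).
  right; exists `|f M'|; first by rewrite -[ltRHS]mul1r -s1 -normrM gtr0_norm.
  apply/eventuallyP; exists M' => // x Mx; exact: mono.
have [h|h] := pselect (exists2 e : R, 0 < e & forall x, M <= x -> e <= `|f x|).
  by right; have [e e0 he] := h; exists e => //; apply/eventuallyP; exists M.
left=> e e0; apply: contra_notP h => h; exists e => // x Mx.
rewrite leNgt; apply/negP => fx; apply: h; apply/eventuallyP; exists x; first by lra.
by move=> y xy; apply: ltW; apply: le_lt_trans fx; exact: mono.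
Unshelve. all: by end_near. Qed.

Lemma hardy_quotient f g : H f -> H g -> ~ (\forall x \near +oo, g x = 0) ->
  exists2 q, H q & \forall x \near +oo, f x = q x * g x.
Proof.
move=> hf hg g0; have [v hv hgv] := hardy_inv hH hg g0.
exists (fun x => f x * v x); first exact: (hardy_mul hH).
near=> x; rewrite -mulrA [v x * _]mulrC; have -> : g x * v x = 1 by near: x.
by rewrite mulr1.
Unshelve. all: by end_near. Qed.

Lemma hardy_derive_lower f (j : nat) (c : R) : H f -> 0 < c ->
  (\forall x \near +oo, c * x ^+ j <= `|f^`()%classic x|) ->
  exists2 c', 0 < c' & \forall x \near +oo, c' * x ^+ j.+1 <= `|f x|.
Proof.
move=> hf c0 hc; have hf' := (hardy_derive hH hf).2.
have [s s1 hs] := hardy_weak_sign hf'; have hd := hardy_is_derive hf.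
have [||c' c'0 h] := @derive_lower R (fun x => s * f x) (fun x => s * f^`()%classic x) j c c0.
- by near=> x; apply: is_deriveZ; near: x.
- by near=> x; rewrite (sign_mul s1)//; near: x.
exists c' => //; near=> x; apply: (@le_trans _ _ (s * f x)); first by near: x.
by rewrite (le_trans (ler_norm _))// normrM s1 mul1r.
Unshelve. all: by end_near. Qed.

Lemma hardy_derive1n_lower f (j : nat) (c : R) : H f -> 0 < c ->
  (\forall x \near +oo, c <= `|derive1n j f x|) ->
  exists2 c', 0 < c' & \forall x \near +oo, c' * x ^+ j <= `|f x|.
Proof.
move=> hf c0 hc.
have h i : (i <= j)%N -> exists2 c', 0 < c' &
    \forall x \near +oo, c' * x ^+ i <= `|derive1n (j - i) f x|.
  elim: i => [|i IH] ij.
    by exists c => //; near=> x; rewrite mulr1 subn0; near: x.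
  have [c1 c10 h1] := IH (ltnW ij).
  apply: (@hardy_derive_lower _ i c1 (hardy_derive1n _ hf) c10).
  by rewrite -(subnSK ij) in h1.
by have := h j (leqnn _); rewrite subnn.
Unshelve. all: by end_near. Qed.

Lemma hardy_derive1n_upper f (j : nat) : H f ->
  (forall e : R, 0 < e -> \forall x \near +oo, `|derive1n j f x| <= e) ->
  forall e : R, 0 < e -> \forall x \near +oo, `|f x| <= e * x ^+ j.
Proof.
move=> hf hc.
have h i : (i <= j)%N -> forall e : R, 0 < e ->
    \forall x \near +oo, `|derive1n (j - i) f x| <= e * x ^+ i.
  elim: i => [|i IH] ij.
    by move=> e /hc h; near=> x; rewrite mulr1 subn0; near: x.
  apply: (@derive_upper R _ (derive1n (j - i) f)); last exact: (IH (ltnW ij)).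
  by rewrite -(subnSK ij); exact: (hardy_is_derive (hardy_derive1n _ hf)).
by have := h j (leqnn _); rewrite subnn.
Unshelve. all: by end_near. Qed.

(* The derivative of f/f' has a limit since it is monotone; this limit is
   nonzero, otherwise f would be either larger or smaller than every power of x. *)
Lemma hardy_regular f (A : nat) (c C : R) : H f -> 0 < c ->
  (\forall x \near +oo, `|f x| <= C * x ^+ A) ->
  (\forall x \near +oo, c <= `|f x| * x ^+ A) ->
  exists2 B : nat, (0 < B)%N & \forall x \near +oo, x * `|f^`()%classic x| <= B%:R * `|f x|.
Proof.
move=> hf c0 hC hc; have hf' := (hardy_derive hH hf).2.
have hd := hardy_is_derive hf.
have [f'0|f'0] := pselect (\forall x \near +oo, f^`()%classic x = 0).
  exists 1%N => //; near=> x; have -> : f^`()%classic x = 0 by near: x.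
  by rewrite normr0 mulr0 mulr_ge0.
have [q hq eq] := hardy_quotient hf hf' f'0.
have [q0|[e e0 he]] := hardy_dichotomy (hardy_derive hH hq).2; last first.
  have [|e' e'0 h] := @hardy_derive_lower q 0 e hq e0.
    by near=> x; rewrite mulr1; near: x.
  exists (Num.truncn e'^-1).+1 => //; near=> x.
  have -> : f x = q x * f^`()%classic x by near: x.
  rewrite normrM mulrA ler_wpM2r//.
  have : e' * x ^+ 1 <= `|q x| by near: x.
  rewrite expr1 -ler_pdivlMl// => h1; apply: le_trans h1 _.
  by rewrite ler_wpM2r// ltW// truncnS_gt.
(* If q' tends to 0 then q = o(x), so x |f'| >= (A + 1) |f|: one power more than the two bounds on f
   permit. *)
have hq1 : \forall x \near +oo, `|q x| <= (A.+1)%:R^-1 * x ^+ 1.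
  apply: (@derive_upper R q _ 0 (hardy_is_derive hq)).
    by move=> e /q0 h; near=> x; rewrite mulr1; near: x.
  by rewrite invr_gt0.
exfalso.
have [f0|[s s1 hs]] := hardy_sign hf.
  apply: eventually_False; near=> x.
  have : c <= `|f x| * x ^+ A by near: x.
  have -> : f x = 0 by near: x.
  by rewrite normr0 mul0r; lra.
have [t t1 ht] := hardy_weak_sign hf'.
have /eventuallyP[M M1 hM] : \forall x \near +oo, [/\ is_derive (x : R) (1 : R) f (f^`()%classic x),
    0 < s * f x, 0 <= t * f^`()%classic x, (A.+1)%:R * `|f x| <= x * `|f^`()%classic x| &
    `|f x| <= C * x ^+ A /\ c <= `|f x| * x ^+ A].
  near=> x; split; [by near: x|by near: x|by near: x| |by split; near: x].
  have -> : f x = q x * f^`()%classic x by near: x.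
  rewrite normrM mulrA ler_wpM2r// -ler_pdivlMl// -[X in _ * X]expr1; near: x; exact: hq1.
have M0 : 0 < M by lra.
have fs x : M <= x -> s * f x = `|f x|.
  by move=> /hM[_ h _ _ _]; apply: sign_mul; rewrite // ltW.
have ft x : M <= x -> t * f^`()%classic x = `|f^`()%classic x|.
  by move=> /hM[_ _ h _ _]; apply: sign_mul.
have dsf x : M <= x -> is_derive x 1 (fun x => s * f x) (s * f^`()%classic x).
  by move=> /hM[h _ _ _ _]; apply: is_deriveZ.
have [_ fM _ _ [_ _]] := hM M (lexx _).
have st : s = t \/ s = - t.
  have : `|s| = `|t| by rewrite s1.
  by move=> /eqP; rewrite eqr_norm2 => /orP[]/eqP; [left|right].
have MA : 0 < M ^+ A.+1 by rewrite exprn_gt0.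
(* With equal signs f grows at least like x^(A+1), with opposite signs it decays at least like
   x^-(A+1); in each case an explicit large x contradicts the bounds. *)
case: st => est.
  have h := @power_lower R _ _ M A.+1 M0 dsf _ M _ (lexx M).
  pose x := M + C * M ^+ A.+1 / (s * f M) + 1.
  have C0 : 0 <= C.
    have [_ _ _ _ [h1 _]] := hM M (lexx _).
    by have := le_trans (normr_ge0 _) h1; rewrite pmulr_lge0// exprn_gt0.
  have Mx : M <= x.
    have : 0 <= C * M ^+ A.+1 / (s * f M) by rewrite divr_ge0 ?(ltW fM)// mulr_ge0// ltW.
    by rewrite /x; lra.
  have x0 : 0 < x by lra.
  have [_ _ _ _ [h1 _]] := hM x Mx.
  have : s * f M * x ^+ A.+1 <= s * f x * M ^+ A.+1.
    apply: h => // y My; rewrite fs// est ft//; by have [] := hM y My.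
  rewrite (fs x)// exprS => h2.
  have : s * f M * x <= C * M ^+ A.+1.
    rewrite -(ler_pM2r (exprn_gt0 A x0)); apply: le_trans (_ : `|f x| * M ^+ A.+1 <= _).
      by move: h2; rewrite mulrA.
    by rewrite mulrAC ler_wpM2r// ltW.
  rewrite mulrC -ler_pdivlMr// /x; lra.
have h := @power_decay R _ _ M A.+1 M0 dsf _ M _ (lexx M).
pose x := M + s * f M * M ^+ A.+1 / c + 1.
have Mx : M <= x.
  have : 0 <= s * f M * M ^+ A.+1 / c by apply: divr_ge0; [exact: mulr_ge0 (ltW fM) (ltW MA)|exact: ltW].
  by rewrite /x; lra.
have x0 : 0 < x by lra.
have [_ _ _ _ [_ h1]] := hM x Mx.
have : s * f x * x ^+ A.+1 <= s * f M * M ^+ A.+1.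
  apply: h => // y My; rewrite fs// est mulNr mulrN lerN2 ft//; by have [] := hM y My.
rewrite (fs x)// exprSr mulrA => h2.
have := ler_wpM2r (ltW x0) h1 => h3.
have : c * x <= s * f M * M ^+ A.+1 by lra.
rewrite mulrC -ler_pdivlMr// /x; lra.
Unshelve. all: by end_near. Qed.

End HardyFields.

(** * Successive derivatives of a sub-polynomial *)

Section HardyStructure.
Variables (R : realType) (H : set (R -> R)).
Hypothesis hH : hardy_field H.
Implicit Types (f g : R -> R).

(** A decreasing |f| remains between c and |f M|, so it is increasing up to a constant factor. *)
Lemma hardy_quasi_increasing f (c : R) : H f -> 0 < c ->
  (\forall x \near +oo, c <= `|f x|) ->
  exists B M : R, [/\ 1 <= B, 1 <= M & forall x y, M <= x -> x <= y -> `|f x| <= B * `|f y|].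
Proof.
move=> hf c0 /eventuallyP[M1 M11 hM1]; have [M2 M21 hM2] := hardy_monotone hH hf.
pose M := Num.max M1 M2.
have MM1 : M1 <= M by rewrite le_max lexx.
have MM2 : M2 <= M by rewrite le_max lexx orbT.
case: hM2 => mono.
  by exists 1, M; split=> // [|x y Mx xy]; rewrite ?mul1r ?mono//; lra.
exists (1 + `|f M| / c), M; split=> // [||x y Mx xy]; rewrite ?lerDl ?divr_ge0 ?(ltW c0)//.
  lra.
apply: (@le_trans _ _ `|f M|); first by apply: mono.
apply: (@le_trans _ _ (`|f M| / c * `|f y|)).
  by rewrite mulrAC ler_pdivlMr// ler_wpM2l// hM1//; lra.
by rewrite ler_wpM2r// lerDr.
Qed.

(** In the mean value theorem from a fixed point to x, the intermediate derivative is at most a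
    constant times the one at x, by [hardy_quasi_increasing]. *)
Lemma hardy_le_derive f (c : R) : H f -> 0 < c ->
  (\forall x \near +oo, c <= `|f^`()%classic x|) ->
  exists2 C : R, 0 < C & \forall x \near +oo, `|f x| <= C * (x * `|f^`()%classic x|).
Proof.
move=> hf c0 hc; have hf' := (hardy_derive hH hf).2.
have [B [M [B1 M1 hB]]] := hardy_quasi_increasing hf' c0 hc.
have /eventuallyP[M' M'1 hM'] : \forall x \near +oo, [/\ M <= x, c <= `|f^`()%classic x| &
    is_derive (x : R) (1 : R) f (f^`()%classic x)].
  near=> x; split; [near: x; exact: eventually_ge|by near: x|].
  by near: x; exact: (hardy_is_derive hH hf).
exists (`|f M'| / c + B); first by rewrite ltr_wpDl ?divr_ge0// ?(ltW c0)//; lra.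
apply/eventuallyP; exists M' => // x Mx.
have [|z /andP[z1 z2] e] := @mvt R f (f^`()%classic) M' x Mx.
  by move=> z /andP[/hM'[_ _ h] _].
have [MM' cx _] := hM' x Mx.
have MM : M <= z by have [h _ _] := hM' z z1.
have x1 : 1 <= x by lra.
have -> : f x = f M' + f^`()%classic z * (x - M') by rewrite -e; ring.
apply: le_trans (ler_normD _ _) _; rewrite mulrDl; apply: lerD.
  rewrite mulrAC ler_pdivlMr// ler_wpM2l//; apply: le_trans cx _.
  by rewrite ler_peMl.
rewrite normrM mulrCA mulrC; apply: ler_pM => //.
  by rewrite ger0_norm; lra.
exact: hB.
Unshelve. all: by end_near. Qed.

(** The logarithmic derivative is O(1 / x^2), hence integrable. Concretely, |f| (1 + 2 C / x) is
    nonincreasing once x >= 2 C. *)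
Lemma hardy_bounded f (C : R) : H f -> 0 <= C ->
  (\forall x \near +oo, x ^+ 2 * `|f^`()%classic x| <= C * `|f x|) ->
  exists C', \forall x \near +oo, `|f x| <= C'.
Proof.
move=> hf C0 hC; have [f0|[s s1 hs]] := hardy_sign hH hf.
  exists 0; near=> x; have -> : f x = 0 by near: x.
  by rewrite normr0.
have hd := hardy_is_derive hH hf.
have /eventuallyP[M M1 hM] : \forall x \near +oo, [/\ 2 * C <= x, 0 < s * f x,
    is_derive (x : R) (1 : R) f (f^`()%classic x) & x ^+ 2 * `|f^`()%classic x| <= C * `|f x|].
  near=> x; split; [near: x; exact: eventually_ge|by near: x|by near: x|by near: x].
pose phi x := - (s * f x + 2 * C * (s * f x * x^-1 ^+ 1)).
exists (- phi M); apply/eventuallyP; exists M => // x Mx.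
have [Cx fx dx hx] := hM x Mx.
rewrite -[leLHS]mul1r -s1 -normrM gtr0_norm//.
apply: (@le_trans _ _ (- phi x)).
  rewrite /phi opprK lerDl; apply: mulr_ge0; first exact: mulr_ge0.
  by apply: mulr_ge0; [exact: ltW|rewrite expr1 invr_ge0; lra].
rewrite lerN2.
apply: (@nondecreasing_of_derive R phi (fun x => - (s * f^`()%classic x +
   2 * C * (x^-1 ^+ 2 * (x * (s * f^`()%classic x) - 1%:R * (s * f x))))) M) => //.
  move=> z Mz; have [_ _ h _] := hM z Mz.
  have z0 : z != 0 by rewrite gt_eqF//; lra.
  exact: (is_deriveN (is_deriveD (is_deriveZ s h)
    (is_deriveZ (2 * C) (is_derive_MXnV 1 z0 (is_deriveZ s h))))).
move=> z Mz; have [Cz fz _ hz] := hM z Mz.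
have z0 : 0 < z by lra.
have e : `|f z| = s * f z by rewrite -[LHS]mul1r -s1 -normrM gtr0_norm.
rewrite e in hz; set F := s * f z in fz hz *; set D := s * _.
have DD : D <= `|f^`()%classic z| by rewrite (le_trans (ler_norm _))// normrM s1 mul1r.
have z20 : 0 < z ^+ 2 by rewrite exprn_gt0.
rewrite oppr_ge0 -(pmulr_rle0 _ z20).
rewrite (_ : z ^+ 2 * _ = z ^+ 2 * D + 2 * C * (z * D - F)); last by field; rewrite gt_eqF.
have h1 : z ^+ 2 * D <= C * F by apply: le_trans hz; rewrite ler_pM2l.
have h2 : 2 * C * (z * D) <= C * F.
  have : 2 * C * (z ^+ 2 * D) <= z * (C * F).
    apply: (@le_trans _ _ (2 * C * (C * F))); first by rewrite ler_wpM2l ?mulr_ge0.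
    by rewrite ler_wpM2r// mulr_ge0// ltW.
  by move=> h; rewrite -(ler_pM2l z0); lra.
lra.
Unshelve. all: by end_near. Qed.

(* d.+1 is the least order of a derivative of f tending to 0, and the final
   alternative comes from the ratio of the d-th to the d.+1-st derivative: in
   the second case f differs from a polynomial of degree d by O(1/x) in its
   derivative. *)
Lemma hardy_structure f : H f ->
  (exists2 l : R, 0 < l & f x / x `^ l @[x --> +oo] --> (0 : R)) ->
  f x @[x --> +oo] --> +oo ->
  exists d : nat, [/\
    forall e : R, 0 < e -> \forall x \near +oo, `|derive1n d.+1 f x| <= e,
    forall k, (k <= d)%N -> exists2 c : R, 0 < c & \forall x \near +oo, c <= `|derive1n k f x|,
    forall k, (k <= d)%N -> exists2 B : nat, (0 < B)%N &
      \forall x \near +oo, x * `|derive1n k.+1 f x| <= B%:R * `|derive1n k f x|,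
    forall k, (k < d)%N -> exists2 C : R, 0 < C &
      \forall x \near +oo, `|derive1n k f x| <= C * (x * `|derive1n k.+1 f x|) &
    (0 < d)%N ->
    ((forall K : R, \forall x \near +oo,
        K * `|derive1n d f x| <= x ^+ d.+1 * `|derive1n d.+1 f x|) /\
     exists2 B : nat, (0 < B)%N &
      \forall x \near +oo, x * `|derive1n d.+2 f x| <= B%:R * `|derive1n d.+1 f x|) \/
    exists2 C : R, 0 <= C & \forall x \near +oo, `|derive1n d f x| <= C /\
      `|derive1n d.+1 f x| * x ^+ d.+1 <= C].
Proof.
move=> hf [l l0 hl] foo.
pose A := (Num.truncn l).+1.
have hA : \forall x \near +oo, `|f x| <= x ^+ A.
  have : \forall x \near +oo, `|f x / x `^ l| <= 1.
    move/cvgrPdist_le : hl => /(_ 1 ltr01) h; near=> x.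
    by rewrite -normrN -sub0r; near: x.
  move=> h; near=> x.
  have x1 : 1 <= x by near: x; exact: eventually_ge.
  have xl : 0 < x `^ l by rewrite powR_gt0//; lra.
  have : `|f x / x `^ l| <= 1 by near: x.
  rewrite normrM normfV (gtr0_norm xl) ler_pdivrMr// mul1r => h1.
  apply: le_trans h1 _; rewrite -powR_mulrn; last by lra.
  by rewrite ler_powR// ltW// truncnS_gt.
pose P (j : nat) := forall e : R, 0 < e -> \forall x \near +oo, `|derive1n j f x| <= e.
(* Otherwise the derivative of order A + 1 would be bounded away from 0, and integration would give
   |f| >= c x^(A+1), against |f| <= x^A. *)
have exP : exists j, `[< P j >].
  exists A.+1; apply/asboolP.
  have [//|[c c0 hc]] := hardy_dichotomy hH (hardy_derive1n hH A.+1 hf).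
  have [c' c'0 h] := hardy_derive1n_lower hH hf c0 hc.
  case: (@eventually_False R); near=> x.
  have x1 : 1 <= x by near: x; exact: eventually_ge.
  have : c' * x ^+ A.+1 <= x ^+ A.
    by apply: (@le_trans _ _ `|f x|); near: x.
  rewrite exprS mulrA -[leRHS]mul1r ler_pM2r ?exprn_gt0 ?(lt_le_trans ltr01)//.
  have : 2 / c' <= x by near: x; exact: eventually_ge.
  by rewrite ler_pdivrMr//; lra.
case: (ex_minnP exP) => -[/asboolP h0 _|d /asboolP hd mind].
  case: (@eventually_False R); near=> x.
  have : `|f x| <= 1 by near: x; exact: h0.
  have : 2 <= f x by near: x; exact: (cvgry_ge foo).
  by have := ler_norm (f x); lra.
have hlow k : (k <= d)%N -> exists2 c : R, 0 < c & \forall x \near +oo, c <= `|derive1n k f x|.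
  move=> kd; have [hk|//] := hardy_dichotomy hH (hardy_derive1n hH k hf).
  by have := mind k (introT (asboolP _) hk); rewrite leqNgt ltnS kd.
have hlow' k : (k <= d)%N -> exists2 c : R, 0 < c & \forall x \near +oo, c <= `|derive1n k f x| * x ^+ A.
  move=> /hlow[c c0 hc]; exists c => //; near=> x.
  have x1 : 1 <= x by near: x; exact: eventually_ge.
  by apply: (@le_trans _ _ `|derive1n k f x|); [near: x|rewrite ler_peMr ?exprn_ege1].
have hup k : (k <= d)%N -> exists C : R, \forall x \near +oo, `|derive1n k f x| <= C * x ^+ A.
  elim: k => [|k IH] kd; first by exists 1; near=> x; rewrite mul1r; near: x.
  have [C hC] := IH (ltnW kd); have [c c0 hc] := hlow' k (ltnW kd).
  have [B B0 hB] := hardy_regular hH (hardy_derive1n hH k hf) c0 hC hc.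
  exists (B%:R * C); near=> x.
  have x1 : 1 <= x by near: x; exact: eventually_ge.
  apply: (@le_trans _ _ (x * `|derive1n k.+1 f x|)); first by rewrite ler_peMl.
  apply: (@le_trans _ _ (B%:R * `|derive1n k f x|)); first by near: x.
  by rewrite -mulrA ler_wpM2l//; near: x.
exists d; split => //.
- move=> k kd; have [C hC] := hup k kd; have [c c0 hc] := hlow' k kd.
  exact: (hardy_regular hH (hardy_derive1n hH k hf) c0 hC hc).
- move=> k kd; have [c c0 hc] := hlow k.+1 kd.
  exact: (hardy_le_derive (hardy_derive1n hH k hf) c0 hc).
move=> d0; have hu := hardy_derive1n hH d hf; have hv := hardy_derive1n hH d.+1 hf.
(* As d >= 1, the assumption contains that of [hardy_bounded], so the d-th derivative is bounded;
   inserting this bound gives the second alternative. *)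
have slow (C : R) : 0 <= C -> (\forall x \near +oo, x ^+ d.+1 * `|derive1n d.+1 f x| <= C * `|derive1n d f x|) ->
  exists2 C : R, 0 <= C & \forall x \near +oo, `|derive1n d f x| <= C /\
      `|derive1n d.+1 f x| * x ^+ d.+1 <= C.
  move=> C0 hC; have [C' hC'] : exists C', \forall x \near +oo, `|derive1n d f x| <= C'.
    apply: (hardy_bounded hu C0); near=> x.
    have x1 : 1 <= x by near: x; exact: eventually_ge.
    apply: (@le_trans _ _ (x ^+ d.+1 * `|derive1n d.+1 f x|)); last by near: x.
    by rewrite ler_wpM2r// ler_weXn2l.
  have C'0 : 0 <= `|C'| by [].
  exists (`|C'| + C * `|C'|); first by rewrite addr_ge0// mulr_ge0.
  near=> x.
  have h : `|derive1n d f x| <= `|C'| by rewrite (le_trans _ (ler_norm _))//; near: x.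
  split; first by rewrite (le_trans h)// lerDl mulr_ge0.
  rewrite mulrC; apply: (@le_trans _ _ (C * `|derive1n d f x|)); first by near: x.
  by rewrite (le_trans (ler_wpM2l C0 h))// lerDr.
have [v0|v0] := pselect (\forall x \near +oo, derive1n d.+1 f x = 0).
  right; apply: (slow 0) => //; near=> x; have -> : derive1n d.+1 f x = 0 by near: x.
  by rewrite normr0 mulr0 mul0r.
have [q hq eq] := hardy_quotient hH hu hv v0.
(* The derivative of order d + 1 of the ratio q decides: if it tends to 0, then q = o(x^(d+1)), the
   first alternative; otherwise |q| >= c' x^(d+1), the second. *)
have [q0|[c c0 hc]] := hardy_dichotomy hH (hardy_derive1n hH d.+1 hq); last first.
  right; have [c' c'0 h] := hardy_derive1n_lower hH hq c0 hc.
  apply: (slow c'^-1); first by rewrite invr_ge0 ltW.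
  near=> x; rewrite ler_pdivlMl// mulrA.
  have -> : derive1n d f x = q x * derive1n d.+1 f x by near: x.
  by rewrite normrM ler_wpM2r//; near: x.
left; have hN (K : R) : \forall x \near +oo, K * `|derive1n d f x| <= x ^+ d.+1 * `|derive1n d.+1 f x|.
  pose K' := `|K| + 1; have K'0 : 0 < K' by rewrite ltr_wpDl.
  have hK := hardy_derive1n_upper hH hq q0 (e := K'^-1).
  have {}hK : \forall x \near +oo, `|q x| <= K'^-1 * x ^+ d.+1 by apply: hK; rewrite invr_gt0.
  near=> x; apply: (@le_trans _ _ (K' * `|derive1n d f x|)).
    by rewrite ler_wpM2r// /K' (le_trans (ler_norm _))// lerDl.
  have -> : derive1n d f x = q x * derive1n d.+1 f x by near: x.
  rewrite normrM mulrA ler_wpM2r// -ler_pdivlMl//; near: x; exact: hK.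
split=> //.
have [c c0 hc] := hlow d (leqnn _).
(* The derivative of order d + 1 tends to 0, but no faster than a power: the case K = 1 of [hN]
   bounds it below by c / x^(d+1). *)
apply: (@hardy_regular R H hH _ d.+1 c 1 hv c0).
  near=> x; rewrite mul1r; apply: (@le_trans _ _ 1); first by near: x; exact: hd.
  by rewrite exprn_ege1//; near: x; exact: eventually_ge.
near=> x; apply: (@le_trans _ _ (1 * `|derive1n d f x|)); first by rewrite mul1r; near: x.
by rewrite [leRHS]mulrC; near: x; exact: hN.
Unshelve. all: by end_near. Qed.

End HardyStructure.

(** * Exponential sums along functions in a Hardy field *)

Section RegularSums.
Variables (R : realType) (H : set (R -> R)).
Hypothesis hH : hardy_field H.
Implicit Types (f g : R -> R).
Local Notation normc := (@Normc.normc R).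

(** Since |g' / g| <= B / x, the function |g| / x^B is nonincreasing and |g| x^B is nondecreasing,
    which costs a factor L^B on [x, L x]. *)
Lemma regular_ratio g (B L : nat) : H g -> (0 < L)%N ->
  (\forall x \near +oo, x * `|g^`()%classic x| <= B%:R * `|g x|) ->
  exists s : R, `|s| = 1 /\ \forall x \near +oo, forall y, x <= y <= L%:R * x ->
    [/\ s * g y = `|g y|, `|g y| <= L%:R ^+ B * `|g x| & `|g x| <= L%:R ^+ B * `|g y|].
Proof.
move=> hg L0 hB; have [s s1 hs] := hardy_weak_sign hH hg; exists s; split=> //.
have /eventuallyP[M M1 hM] : \forall x \near +oo, [/\ s * g x = `|g x|,
    x * `|g^`()%classic x| <= B%:R * `|g x| &
    is_derive (x : R) (1 : R) g (g^`()%classic x)].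
  near=> x; split; [|by near: x|by near: x; exact: (hardy_is_derive hH hg)].
  by apply: sign_mul => //; near: x.
have M0 : 0 < M by lra.
have dsg x : M <= x -> is_derive x 1 (fun x => s * g x) (s * g^`()%classic x).
  by move=> /hM[_ _ h]; exact: (is_deriveZ s h).
have dsgN x : M <= x -> is_derive x 1 (fun x => - (s * g x)) (- (s * g^`()%classic x)).
  by move=> /hM[_ _ h]; exact: (is_deriveN (is_deriveZ s h)).
have sD x : s * g^`()%classic x <= `|g^`()%classic x|.
  by rewrite (le_trans (ler_norm _))// normrM s1 mul1r.
have sDN x : - (s * g^`()%classic x) <= `|g^`()%classic x|.
  by rewrite (le_trans (ler_norm _))// normrN normrM s1 mul1r.
apply/eventuallyP; exists M => // x Mx y /andP[xy yL].
have My : M <= y by lra. have x0 : 0 < x by lra. have y0 : 0 < y by lra.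
have [gx _ _] := hM x Mx; have [gy _ _] := hM y My.
have xB : 0 < x ^+ B by rewrite exprn_gt0.
have yB : y ^+ B <= L%:R ^+ B * x ^+ B.
  by rewrite -exprMn lerXn2r ?nnegrE ?mulr_ge0//; lra.
have h1 : s * g y * x ^+ B <= s * g x * y ^+ B.
  apply: (power_upper M0 dsg _ Mx xy) => z Mz.
  have [gz hz _] := hM z Mz; rewrite gz; apply: le_trans hz.
  by rewrite ler_wpM2l//; lra.
have h2 : - (s * g y) * y ^+ B <= - (s * g x) * x ^+ B.
  apply: (power_decay M0 dsgN _ Mx xy) => z Mz.
  have [gz hz _] := hM z Mz; rewrite gz !mulrN opprK; apply: le_trans hz.
  by rewrite -mulrN ler_wpM2l//; lra.
rewrite gx gy in h1; rewrite gx gy !mulNr lerN2 in h2.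
split=> //; rewrite -(ler_pM2r xB).
  by have := ler_wpM2l (normr_ge0 (g x)) yB; lra.
by have := ler_wpM2l (normr_ge0 (g y)) yB; lra.
Unshelve. all: by end_near. Qed.

Lemma derive1n_is_derive f k : H f -> \forall x \near +oo, forall j, (j <= k)%N ->
  is_derive (x : R) (1 : R) (derive1n j f) (derive1n j.+1 f x).
Proof.
move=> hf; elim: k => [|k IH].
  have h := hardy_is_derive hH hf.
  by near=> x => j; rewrite leqn0 => /eqP ->; near: x.
have h := hardy_is_derive hH (hardy_derive1n hH k.+1 hf).
near=> x => j; rewrite leq_eqVlt => /orP[/eqP ->|]; first by near: x.
by move: j; near: x.
Unshelve. all: by end_near. Qed.

(** By [regular_ratio] the relevant derivative keeps its size and sign on the window, and the next
    one keeps its sign, as the derivative test requires. The equation [x = X%:R] lets a statement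
    about large reals speak of integer starting points. *)
Lemma derivative_range f (k c : nat) (eta : R) : H f -> (0 < c)%N -> 0 < eta ->
  (exists B : nat, \forall x \near +oo, x * `|derive1n k.+2 f x| <= B%:R * `|derive1n k.+1 f x|) ->
  exists K eps : R, [/\ 0 < K, 0 < eps & \forall x \near +oo, forall (X : nat) (psi : R),
    x = X%:R -> 0 <= psi -> K <= psi * (x ^+ k.+1 * `|derive1n k.+1 f x|) ->
    psi * `|derive1n k.+1 f x| <= eps ->
    normc (\sum_(n < c * X) cis (psi * f (X%:R + n%:R))) <= eta * x].
Proof.
move=> hf c0 eta0 [B hB].
(* Covers the range k.+2 c X of the derivative test, the k.+2 further units reached by the
   differences, and the starting point X >= 1. *)
pose L := (k.+2 * c + k.+3)%N; have L0 : (0 < L)%N by rewrite /L addnS.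
have hv := hardy_derive1n hH k.+1 hf.
have [s [s1 hreg]] := regular_ratio hv L0 hB.
have [t t1 ht] := hardy_weak_sign hH (hardy_derive1n hH k.+2 hf).
have hd := derive1n_is_derive k.+2 hf.
have /eventuallyP[M M1 hM] : \forall x \near +oo, [/\ forall y, x <= y <= L%:R * x ->
    [/\ s * derive1n k.+1 f y = `|derive1n k.+1 f y|,
      `|derive1n k.+1 f y| <= L%:R ^+ B * `|derive1n k.+1 f x| &
      `|derive1n k.+1 f x| <= L%:R ^+ B * `|derive1n k.+1 f y|],
    0 <= t * derive1n k.+2 f x & forall j, (j <= k.+2)%N ->
  is_derive (x : R) (1 : R) (derive1n j f) (derive1n j.+1 f x)].
  by near=> x; split; near: x.
pose LB : R := L%:R ^+ B.
have LB1 : 1 <= LB by rewrite exprn_ege1// ler1n.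
have LB0 : 0 < LB by lra.
have c0r : 0 < c%:R :> R by rewrite ltr0n.
have ec0 : 0 < eta / c%:R by rewrite divr_gt0.
have LB21 : 1 <= LB ^+ 2 by rewrite exprn_ege1.
have [K [eps [K0 eps0 hT]]] := @derivative_test R k _ _ ec0 LB21.
exists (K * LB), eps; split=> //; first by rewrite mulr_gt0.
apply/eventuallyP; exists M => // x Mx X psi eX psi0 hK he.
have [h1 _ _] := hM x Mx.
have x1 : 1 <= x by lra.
have X0 : (0 < X)%N by rewrite -(ltr0n R) -eX; lra.
set V := `|derive1n k.+1 f x| in hK he.
have V0 : 0 <= V by exact: normr_ge0.
have rng n z : (n < k.+2 * (c * X))%N -> x + n%:R <= z <= x + n%:R + k.+2%:R -> x <= z <= L%:R * x.
  move=> nN /andP[z1 z2]; apply/andP; split.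
    by apply: le_trans z1; rewrite lerDl.
  apply: le_trans z2 _; rewrite eX -!natrD -natrM ler_nat.
  rewrite /L mulnDl -mulnA -addnA addnCA; apply: leq_add; first exact: ltnW.
  by rewrite (mulSn k.+2) leq_add2l leq_pmulr.
(* The derivative lies between V / LB and LB V, hence lam = psi V / LB and the ratio LB^2. *)
have := hT (fun n => psi * s * f (X%:R + n%:R)) (c * X)%N (psi * V / LB) (s * t) _ _ _ _ _.
have -> : normc (\sum_(n < c * X) cis (psi * s * f (X%:R + n%:R)))
   = normc (\sum_(n < c * X) cis (psi * f (X%:R + n%:R))).
  have : s = 1 \/ s = -1.
    have : `|s| == `|1| by rewrite s1 normr1.
    by rewrite eqr_norm2 => /orP[]/eqP; [left|right].
  case=> ->; first by congr normc; apply: eq_bigr => n _; rewrite mulr1.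
  rewrite -normc_conj conj_sum_cis; congr normc; apply: eq_bigr => n _.
  by rewrite mulrN1 mulNr opprK.
have -> : eta / c%:R * (c * X)%:R = eta * x by rewrite eX natrM; field; rewrite gt_eqF.
have shift j n : iter j dlt (fun n => psi * s * f (X%:R + n%:R)) n
    = iter j dlt (fun m => psi * s * f (x + n%:R + m%:R)) 0.
  rewrite -[n in LHS]add0n -dltn_shift; apply: eq_dltn => m.
  by rewrite natrD eX; congr (_ * f _); ring.
apply.
- by rewrite normrM s1 t1 mulr1.
- move=> n nN; rewrite shift.
  apply: (@dltn_mvt R k.+1 (fun j y => psi * s * derive1n j f y) (x + n%:R)) => [j z jk zk|z zk].
    have zr : x <= z <= L%:R * x.
      apply: (rng n) => //; move/andP: zk => [-> zk] /=; apply: le_trans zk _.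
      by rewrite lerD2l ler_nat.
    have Mz : M <= z by move/andP: zr => [zr _]; exact: le_trans Mx zr.
    have [_ _ hz] := hM z Mz.
    by apply: (is_deriveZ (psi * s)); apply: hz; rewrite ltnW// ltnW.
  have zr : x <= z <= L%:R * x.
    apply: (rng n) => //; move/andP: zk => [-> zk] /=; apply: le_trans zk _.
    by rewrite lerD2l ler_nat.
  have [h2 h3 h4] := h1 z zr.
  change (psi * V / LB <= psi * s * derive1n k.+1 f z <= LB ^+ 2 * (psi * V / LB)).
  rewrite -(mulrA psi s) h2; apply/andP; split.
    by rewrite ler_pdivrMr// -mulrA ler_wpM2l// mulrC.
  apply: (@le_trans _ _ (psi * (LB * V))); first by rewrite ler_wpM2l.
  by rewrite le_eqVlt; apply/orP; left; apply/eqP; field; rewrite gt_eqF.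
- move=> n nN; rewrite shift -dltnZ.
  rewrite (@eq_dltn _ k.+2 _ (fun m => psi * t * f (x + n%:R + m%:R))); last first.
    move=> m; have ss : s * s = 1 by rewrite -[s * s]ger0_norm ?normrM ?s1 ?mulr1// -expr2 sqr_ge0.
    set F := f _; rewrite (_ : s * t * (psi * s * F) = s * s * (psi * t * F)); last by ring.
    by rewrite ss mul1r.
  apply: (@dltn_ge R k.+2 (fun j y => psi * t * derive1n j f y) (x + n%:R)) => [j z jk zk|z zk].
    have zr := rng n z nN zk.
    have Mz : M <= z by move/andP: zr => [zr _]; exact: le_trans Mx zr.
    have [_ _ hz] := hM z Mz.
    by apply: (is_deriveZ (psi * t)); apply: hz; rewrite ltnW.
  have zr := rng n z nN zk.
  have Mz : M <= z by move/andP: zr => [zr _]; exact: le_trans Mx zr.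
  by have [_ hz _] := hM z Mz; rewrite -(mulrA psi t); exact: mulr_ge0.
- rewrite mulrAC ler_pdivlMr// natrM exprMn -eX; apply: le_trans hK _.
  have x0 : 0 <= x ^+ k.+1 by apply: exprn_ge0; lra.
  have cx : x ^+ k.+1 <= c%:R ^+ k.+1 * x ^+ k.+1.
    by rewrite ler_peMl// exprn_ege1// ler1n.
  by have := ler_wpM2l (mulr_ge0 psi0 V0) cx; lra.
- apply: le_trans he; rewrite ler_pdivrMr// ler_peMr// mulr_ge0//.
Unshelve. all: by end_near. Qed.

End RegularSums.

(** * Functions close to a real polynomial *)

Section PolynomialCase.
Variable R : realType.
Implicit Types (f g : R -> R) (P : {poly R}).
Local Notation normc := (@Normc.normc R).

(** Each integration produces a constant, absorbed by a monomial of P. The process stops at the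
    first derivative, because integrating an error O(1 / x) once more costs the logarithm of
    [derive_log_bound]. *)
Lemma derive_polynomial (m : nat) (F : nat -> R -> R) (C : R) : 0 <= C ->
  (forall j, \forall x \near +oo, is_derive (x : R) (1 : R) (F j) (F j.+1 x)) ->
  (\forall x \near +oo, `|F m.+1 x| * x ^+ m.+1 <= C) ->
  exists P, \forall x \near +oo, `|F 1%N x - P^`().[x]| * x <= C.
Proof.
move=> C0; elim: m F => [|m IH] F hd hC.
  by exists 0; near=> x; rewrite deriv0 horner0 subr0 -[X in _ * X]expr1; near: x.
have [c hc] := derive_limit (ltn0Sn m) C0 (hd m.+1) hC.
pose Q : {poly R} := (c / (m.+1)`!%:R) *: 'X^(m.+1).
have [||P hP] := IH (fun j x => F j x - Q^`(j).[x]).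
- move=> j; near=> x; rewrite derivnS; apply: is_deriveB; last exact: is_derive_poly.
  by near: x.
- near=> x; have -> : Q^`(m.+1).[x] = c; last by near: x.
  rewrite /Q derivnZ derivnXn ffactnn subnn expr0 hornerZ hornerMn hornerC.
  by rewrite divfK// pnatr_eq0 -lt0n fact_gt0.
exists (P + Q); near=> x; rewrite derivD hornerD opprD addrA addrAC.
by have : `|F 1%N x - Q^`(1).[x] - P^`().[x]| * x <= C by near: x.
Unshelve. all: by end_near. Qed.

Lemma derive_log_bound f df (C : R) : 0 <= C ->
  (\forall x \near +oo, is_derive (x : R) (1 : R) f (df x)) ->
  (\forall x \near +oo, `|df x| * x <= C) ->
  exists C', \forall x \near +oo, `|f x| <= C' * ln x.
Proof.
move=> C0 hd hC.
have /eventuallyP[M M1 hM] : \forall x \near +oo,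
    is_derive (x : R) (1 : R) f (df x) /\ `|df x| * x <= C.
  by near=> x; split; near: x.
exists (`|f M| + C); near=> x.
have Mx : M <= x by near: x; exact: eventually_ge.
have lx : 1 <= ln x.
  have h : expR 1 <= x by near: x; exact: eventually_ge.
  by rewrite -(@expRK R 1) ler_ln ?posrE ?expR_gt0.
have h s : `|s| = 1 -> s * f x <= `|f M| + C * ln x.
  move=> s1.
  have sM : s * f M <= `|f M| by rewrite (le_trans (ler_norm _))// normrM s1 mul1r.
  have pM : 0 <= C * ln M by rewrite mulr_ge0// ln_ge0.
  have : C * ln M - s * f M <= C * ln x - s * f x; last by lra.
  apply: (@nondecreasing_of_derive R (fun x => C * ln x - s * f x)
     (fun x => C * x^-1 - s * df x) M _ _ M x (lexx M) Mx) => z Mz; have z0 : 0 < z by lra.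
    apply: is_deriveB; first exact: (is_deriveZ C (is_derive1_ln z0)).
    by apply: is_deriveZ; have [] := hM _ Mz.
  have [_ hz] := hM _ Mz; rewrite subr_ge0.
  apply: (@le_trans _ _ `|df z|); first by rewrite (le_trans (ler_norm _))// normrM s1 mul1r.
  by rewrite ler_pdivlMr.
have h1 := h 1 (normr1 _); have h2 := h (-1) (etrans (normrN _) (normr1 _)).
have fl : `|f M| <= `|f M| * ln x by rewrite ler_peMr.
by rewrite ler_norml; apply/andP; split; lra.
Unshelve. all: by end_near. Qed.

(** If all nonconstant coefficients of psi P were rational, f would be within O(log x) of psi^-1
    times a rational polynomial. The constant coefficient is itself O(log x), so it may be
    arbitrary. *)
Lemma irrational_coefficient f P :
  (forall (p : {poly rat}) (c : R),
     `|f x - c * (map_poly ratr p).[x]| / ln x @[x --> +oo] --> +oo) ->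
  (exists C', \forall x \near +oo, `|f x - P.[x]| <= C' * ln x) ->
  forall psi, psi != 0 -> exists2 i, (0 < i)%N & irrational (psi * P`_i).
Proof.
move=> hlog [C' hC'] psi psi0; apply: contrapT => hno.
have rat_coef i : exists q : rat, (0 < i)%N -> psi * P`_i = ratr q.
  have [i0|] := posnP i; first by exists 0; rewrite i0.
  move=> i0; have : rational (psi * P`_i).
    by apply: contrapT => h; apply: hno; exists i.
  by move=> [q _ e]; exists q.
have [q hq] := choice rat_coef.
pose p : {poly rat} := \poly_(i < size P) (if i == 0%N then 0 else q i).
have hp x : P.[x] = P`_0 + psi^-1 * (map_poly ratr p).[x].
  have -> : map_poly ratr p = psi *: (P - (P`_0)%:P) :> {poly R}.
    apply/polyP => i; rewrite coef_map /= coef_poly coefZ coefB coefC.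
    have [->|i0] := eqVneq i 0%N; first by rewrite subrr mulr0; case: ifP; rewrite rmorph0.
    rewrite subr0; case: ltnP => [_|h]; first by rewrite -hq// lt0n.
    by rewrite nth_default// mulr0 rmorph0.
  by rewrite hornerZ hornerD hornerN hornerC mulrA mulVf// mul1r addrC subrK.
apply: (@eventually_False R).
have h1 := cvgry_ge (hlog p psi^-1) (C' + `|P`_0| + 1).
near=> x.
have lx : 1 <= ln x.
  have h : expR 1 <= x by near: x; exact: eventually_ge.
  by rewrite -(@expRK R 1) ler_ln ?posrE ?expR_gt0.
have : C' + `|P`_0| + 1 <= `|f x - psi^-1 * (map_poly ratr p).[x]| / ln x.
  by near: x; exact: h1.
rewrite ler_pdivlMr; last by lra.
have -> : f x - psi^-1 * (map_poly ratr p).[x] = (f x - P.[x]) + P`_0 by rewrite hp; ring.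
have : `|f x - P.[x]| <= C' * ln x by near: x.
have := ler_normD (f x - P.[x]) P`_0.
have : `|P`_0| <= `|P`_0| * ln x by rewrite ler_peMr.
lra.
Unshelve. all: by end_near. Qed.

(** The remainder r = f - P may be unbounded, but r' = O(1 / x) makes its variation on
    [X, (c + 1) X] bounded, so Abel summation reduces to the Weyl sums of P. *)
Lemma polynomial_range (F : nat -> R -> R) (d c : nat) (C a J eta : R) : 0 <= C -> 0 < a -> 0 < J ->
  0 < eta -> (0 < d)%N ->
  (forall j, \forall x \near +oo, is_derive (x : R) (1 : R) (F j) (F j.+1 x)) ->
  (\forall x \near +oo, `|F d.+1 x| * x ^+ d.+1 <= C) ->
  (forall (p : {poly rat}) (c : R),
     `|F 0%N x - c * (map_poly ratr p).[x]| / ln x @[x --> +oo] --> +oo) ->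
  \forall x \near +oo, forall (X : nat) (psi : R), x = X%:R -> a <= psi <= J ->
    normc (\sum_(n < c * X) cis (psi * F 0%N (X%:R + n%:R))) <= eta * x.
Proof.
move=> C0 a0 J0 eta0 d0 hd hC hlog.
have [P hP] := derive_polynomial C0 hd hC.
pose r x := F 0%N x - P.[x].
have hr : \forall x \near +oo, is_derive (x : R) (1 : R) r (F 1%N x - P^`().[x]).
  near=> x; apply: is_deriveB; last exact: is_derive_poly.
  by near: x; exact: hd.
have irr := irrational_coefficient hlog (derive_log_bound C0 hr hP).
(* Value plus variation of [cis (psi * r)] over c X steps of size at most 8 J C / X. The factor
   [c.+2] in [eta'] comes from writing a sum over [X, X + m) as a difference of two initial sums. *)
pose V := 1 + c%:R * (8 * J * C).
have V1 : 1 <= V by rewrite lerDl !mulr_ge0// ltW.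
pose eta' := eta / (V * c.+2%:R).
have eta'0 : 0 < eta' by rewrite divr_gt0// mulr_gt0//; lra.
have [N0 hN0] := @weyl_uniform R P a J eta' a0 irr eta'0.
have /eventuallyP[M M1 hM] : \forall x \near +oo,
    is_derive (x : R) (1 : R) r (F 1%N x - P^`().[x]) /\ `|F 1%N x - P^`().[x]| * x <= C.
  by near=> x; split; near: x.
near=> x => X psi eX hpsi.
have Mx : M <= x by near: x; exact: eventually_ge.
have N0X : (N0 <= X)%N by rewrite -(ler_nat R) -eX; near: x; exact: eventually_ge.
have x0 : 0 < x by lra.
pose z n := cis (psi * P.[(X + n)%:R]); pose w n := cis (psi * r (X + n)%:R).
rewrite (eq_bigr (fun n : 'I_(c * X) => z n * w n)); last first.
  by move=> n _; rewrite -cisD -mulrDr /r natrD; congr (cis (psi * _)); ring.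
have hz m : (m <= c * X)%N -> normc (\sum_(n < m) z n) <= eta' * (c.+2%:R * x).
  move=> mc; have -> : \sum_(n < m) z n = \sum_(n < X + m) cis (psi * P.[n%:R])
      - \sum_(n < X) cis (psi * P.[n%:R]).
    by rewrite big_split_ord /= addrAC subrr add0r.
  apply: le_trans (le_normcD _ _) _; rewrite normcN.
  have h1 := hN0 psi X hpsi N0X.
  have h2 := hN0 psi (X + m)%N hpsi (leq_trans N0X (leq_addr _ _)).
  apply: le_trans (lerD h2 h1) _; rewrite -mulrDr ler_wpM2l ?(ltW eta'0)//.
  by rewrite eX -natrD -natrM ler_nat !mulSn -addnA leq_add2l addnC leq_add2l.
apply: le_trans (abel_summation w hz) _.
have -> : eta * x = eta' * (c.+2%:R * x) * V.
  rewrite (_ : eta' * _ * V = eta' * (V * c.+2%:R) * x); last by ring.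
  by rewrite /eta' divfK// mulf_neq0 ?pnatr_eq0// gt_eqF//; lra.
have cx0 : 0 <= c.+2%:R * x by rewrite mulr_ge0// ltW.
rewrite ler_wpM2l ?(mulr_ge0 (ltW eta'0))//.
rewrite {1}/w normc_cis lerD2l.
apply: (@le_trans _ _ ((c * X)%:R * (8 * J * C / x))); last first.
  by rewrite natrM -eX le_eqVlt; apply/orP; left; apply/eqP; field; rewrite gt_eqF.
apply: sum_ord_le => [|n _]; first by rewrite divr_ge0 ?mulr_ge0// ltW.
apply: le_trans (normc_cisB _ _) _; rewrite -mulrBr normrM.
have Xn : x <= (X + n)%:R by rewrite eX ler_nat leq_addr.
have [||y /andP[y1 y2] e] := @mvt R r (fun x => F 1%N x - P^`().[x]) (X + n)%:R (X + n.+1)%:R.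
- by rewrite ler_nat leq_add2l.
- by move=> y /andP[y1 _]; have [] := hM y (le_trans Mx (le_trans Xn y1)).
have e2 : (X + n.+1)%:R - (X + n)%:R = 1 :> R by rewrite addnS -[(X + n).+1%:R]natr1; ring.
rewrite e e2 mulr1.
have xy : x <= y by lra.
have [_ hy] := hM y (le_trans Mx xy).
have dy : `|F 1%N y - P^`().[y]| <= C / x.
  by rewrite ler_pdivlMr//; apply: le_trans hy; rewrite ler_wpM2l.
have pJ : `|psi| <= J by rewrite ger0_norm; lra.
have -> : 8 * J * C / x = 8 * (J * (C / x)) by ring.
rewrite -!mulrA; have p4 := @pi_lt4 R; have p0 := pi_ge0 R.
rewrite mulrA; apply: ler_pM; rewrite ?mulr_ge0//; first by lra.
by apply: ler_pM.
Unshelve. all: by end_near. Qed.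

End PolynomialCase.

(** * Uniform bounds for all frequencies between K / f and J *)

Section HardyExponentialSums.
Variables (R : realType) (H : set (R -> R)).
Hypothesis hH : hardy_field H.
Implicit Types (f g : R -> R).
Local Notation normc := (@Normc.normc R).

Lemma eventually_below (m : nat) (P : nat -> R -> Prop) :
  (forall k, (k < m)%N -> \forall x \near +oo, P k x) ->
  \forall x \near +oo, forall k, (k < m)%N -> P k x.
Proof.
elim: m => [|m IH] hP; first by near=> x.
have h1 : \forall x \near +oo, forall k, (k < m)%N -> P k x.
  by apply: IH => k km; apply: hP; rewrite ltnW.
have h2 := hP m (ltnSn m).
near=> x => k; rewrite ltnS leq_eqVlt => /orP[/eqP ->|]; first by near: x.
by move: k; near: x.
Unshelve. all: by end_near. Qed.

Lemma hardy_exponential_sums f (d c : nat) (eta J : R) : H f -> (0 < d)%N ->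
  (forall e : R, 0 < e -> \forall x \near +oo, `|derive1n d.+1 f x| <= e) ->
  (forall k, (k <= d)%N -> exists2 B : nat, (0 < B)%N &
      \forall x \near +oo, x * `|derive1n k.+1 f x| <= B%:R * `|derive1n k f x|) ->
  (forall k, (k < d)%N -> exists2 C : R, 0 < C &
      \forall x \near +oo, `|derive1n k f x| <= C * (x * `|derive1n k.+1 f x|)) ->
  ((forall K : R, \forall x \near +oo,
        K * `|derive1n d f x| <= x ^+ d.+1 * `|derive1n d.+1 f x|) /\
     exists2 B : nat, (0 < B)%N &
      \forall x \near +oo, x * `|derive1n d.+2 f x| <= B%:R * `|derive1n d.+1 f x|) \/
    (exists2 C : R, 0 <= C & \forall x \near +oo, `|derive1n d f x| <= C /\
      `|derive1n d.+1 f x| * x ^+ d.+1 <= C) ->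
  (forall (p : {poly rat}) (c : R),
     `|f x - c * (map_poly ratr p).[x]| / ln x @[x --> +oo] --> +oo) ->
  (0 < c)%N -> 0 < eta -> 0 < J ->
  exists2 K : R, 0 < K & \forall x \near +oo, forall (X : nat) (psi : R),
    x = X%:R -> 0 <= psi <= J -> K <= psi * `|f x| ->
    normc (\sum_(n < c * X) cis (psi * f (X%:R + n%:R))) <= eta * x.
Proof.
move=> hf d0 hd0 hreg hlow hNP hlog c0 eta0 J0.
pose small x X psi := normc (\sum_(n < c * X) cis (psi * f (X%:R + n%:R))) <= eta * x.
(* Descent on the order. If psi |f^(k)| is still at most [eps], pass to the lower order; if not,
   steepness makes x^(k+1) psi |f^(k+1)| at least K and the test of order k + 1 applies. At order 1
   the lower bound on psi |f| suffices. *)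
have reduce m : (0 < m)%N -> (forall k, (k < m)%N -> exists2 B : nat, (0 < B)%N &
      \forall x \near +oo, x * `|derive1n k.+2 f x| <= B%:R * `|derive1n k.+1 f x|) ->
    (forall k, (0 < k < m)%N -> forall T : R, \forall x \near +oo,
      T * `|derive1n k f x| <= x ^+ k.+1 * `|derive1n k.+1 f x|) ->
    exists K eps : R, [/\ 0 < K, 0 < eps & \forall x \near +oo, forall k, (k < m)%N ->
      forall (X : nat) (psi : R), x = X%:R -> 0 <= psi -> K <= psi * `|f x| ->
      psi * `|derive1n k.+1 f x| <= eps -> small x X psi].
  move=> m0 hB hT.
  have [K [eps [K0 eps0 hr]]] : exists K eps : R, [/\ 0 < K, 0 < eps &
      forall k, (k < m)%N -> \forall x \near +oo, forall (X : nat) (psi : R),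
      x = X%:R -> 0 <= psi -> K <= psi * (x ^+ k.+1 * `|derive1n k.+1 f x|) ->
      psi * `|derive1n k.+1 f x| <= eps -> small x X psi].
    elim: (m) hB => [|m' IH] hB; first by exists 1, 1.
    have [|K [eps [K0 eps0 h]]] := IH; first by move=> k km; apply: hB; rewrite ltnW.
    have hBm : exists B : nat, \forall x \near +oo,
        x * `|derive1n m'.+2 f x| <= B%:R * `|derive1n m'.+1 f x|.
      by have [B _ hBB] := hB m' (ltnSn _); exists B.
    have [K1 [eps1 [K10 eps10 h1]]] := derivative_range hH hf c0 eta0 hBm.
    exists (Num.max K K1), (Num.min eps eps1); split.
    - by rewrite lt_max K0.
    - by rewrite lt_min eps0 eps10.
    move=> k; rewrite ltnS leq_eqVlt => /orP[/eqP ->|km].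
      move: h1; apply: filterS => x h1 X psi eX psi0; rewrite ge_max le_min.
      by move=> /andP[_ b1] /andP[_ b2]; exact: (h1 X).
    move: (h k km); apply: filterS => x h2 X psi eX psi0; rewrite ge_max le_min.
    by move=> /andP[b1 _] /andP[b2 _]; exact: (h2 X).
  have [C C0 hC] := hlow 0%N d0.
  exists (K * C), eps; split=> //; first by rewrite mulr_gt0.
  have hr' := eventually_below hr.
  have hT' := eventually_below (m := m) (P := fun k x => (0 < k)%N ->
     K / eps * `|derive1n k f x| <= x ^+ k.+1 * `|derive1n k.+1 f x|).
  have {}hT' : \forall x \near +oo, forall k, (k < m)%N -> (0 < k)%N ->
     K / eps * `|derive1n k f x| <= x ^+ k.+1 * `|derive1n k.+1 f x|.
    apply: hT' => -[|k] km; first by near=> x.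
    by move: (hT k.+1 km (K / eps)); apply: filterS => x h _.
  near=> x => k km X psi eX psi0 hK.
  have hx : forall k, (k < m)%N -> forall (X : nat) (psi : R),
      x = X%:R -> 0 <= psi -> K <= psi * (x ^+ k.+1 * `|derive1n k.+1 f x|) ->
      psi * `|derive1n k.+1 f x| <= eps -> small x X psi by near: x.
  have hTx : forall k, (k < m)%N -> (0 < k)%N ->
     K / eps * `|derive1n k f x| <= x ^+ k.+1 * `|derive1n k.+1 f x| by near: x.
  have hCx : `|f x| <= C * (x * `|derive1n 1 f x|) by near: x.
  elim: k km => [|k IH] km he.
    apply: (hx 0%N km X psi) => //; rewrite expr1 -(ler_pM2r C0).
    apply: le_trans hK _; rewrite -mulrA ler_wpM2l// mulrC //.
  have [hk|hk] := leP (psi * `|derive1n k.+1 f x|) eps; first exact: IH (ltnW km) hk.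
  apply: (hx k.+1 km X psi) => //.
  apply: le_trans (ler_wpM2l psi0 (hTx k.+1 km isT)).
  rewrite mulrCA -ler_pdivrMl; last by rewrite divr_gt0.
  by rewrite invf_div divfK ?gt_eqF// ltW.
(* For k >= 1 the bound |f^(k)| <= C x |f^(k+1)| has the power x^k to spare. *)
have steep k : (0 < k < d)%N -> forall T : R, \forall x \near +oo,
      T * `|derive1n k f x| <= x ^+ k.+1 * `|derive1n k.+1 f x|.
  move=> /andP[k0 kd] T; have [C C0 hC] := hlow k kd.
  near=> x.
  have x1 : 1 <= x by near: x; exact: eventually_ge.
  have hx : `|derive1n k f x| <= C * (x * `|derive1n k.+1 f x|) by near: x.
  have Tx : `|T| * C <= x by near: x; exact: eventually_ge.
  apply: (@le_trans _ _ (`|T| * (C * (x * `|derive1n k.+1 f x|)))).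
    apply: (@le_trans _ _ (`|T| * `|derive1n k f x|)); first by rewrite ler_wpM2r// ler_norm.
    by rewrite ler_wpM2l.
  have xk : `|T| * C <= x ^+ k.
    apply: le_trans Tx _; rewrite -(prednK k0) exprS.
    by rewrite ler_peMr ?exprn_ege1//; lra.
  have x0 : 0 <= x * `|derive1n k.+1 f x| by rewrite mulr_ge0//; lra.
  by have := ler_wpM2r x0 xk; rewrite exprSr; lra.
case: hNP => [[hN [B B0 hB]]|[C C0 hC]].
  have [|||K [eps [K0 eps0 h]]] := reduce d.+1.
  - by [].
  - move=> k; rewrite ltnS leq_eqVlt => /orP[/eqP ->|kd]; first by exists B.
    exact: hreg.
  - move=> k /andP[k0]; rewrite ltnS leq_eqVlt => /orP[/eqP ->|kd]; first exact: hN.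
    by apply: steep; rewrite k0.
  exists K => //; have e0 : 0 < eps / J by rewrite divr_gt0.
  have hd1 := hd0 _ e0.
  near=> x => X psi eX /andP[p0 pJ] hK.
  have hx : forall k, (k < d.+1)%N ->
      forall (X : nat) (psi : R), x = X%:R -> 0 <= psi -> K <= psi * `|f x| ->
      psi * `|derive1n k.+1 f x| <= eps -> small x X psi by near: x.
  apply: (hx d (ltnSn _)) => //.
  have hdx : `|derive1n d.+1 f x| <= eps / J by near: x.
  apply: (@le_trans _ _ (J * (eps / J))); first by rewrite ler_pM.
  by rewrite mulrCA divff ?mulr1// gt_eqF.
have [|||K [eps [K0 eps0 h]]] := reduce d => //.
- by move=> k kd; exact: hreg.
have e0 : 0 < eps / (C + 1) by rewrite divr_gt0//; lra.
have hC2 : \forall x \near +oo, `|derive1n d.+1 f x| * x ^+ d.+1 <= C.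
  by move: hC; apply: filterS => x [].
have hch j : \forall x \near +oo, is_derive (x : R) (1 : R) (derive1n j f) (derive1n j.+1 f x).
  exact: (hardy_is_derive hH (hardy_derive1n hH j hf)).
have hpoly := @polynomial_range R (fun j => derive1n j f) d c C _ J eta C0 e0 J0 eta0 d0 hch hC2 hlog.
exists K => //; near=> x => X psi eX /andP[p0 pJ] hK.
have hx : forall k, (k < d)%N ->
      forall (X : nat) (psi : R), x = X%:R -> 0 <= psi -> K <= psi * `|f x| ->
      psi * `|derive1n k.+1 f x| <= eps -> small x X psi by near: x.
(* Here the descent starts at order d. If psi |f^(d)| exceeds [eps], then boundedness of f^(d) keeps
   psi away from 0, the range of Weyl's theorem. *)
have [hk|hk] := leP (psi * `|derive1n d f x|) eps.
  have dd : (d.-1 < d)%N by rewrite prednK.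
  by apply: (hx d.-1 dd) => //; rewrite prednK.
have hpx : forall (X : nat) (psi : R), x = X%:R -> eps / (C + 1) <= psi <= J ->
    normc (\sum_(n < c * X) cis (psi * f (X%:R + n%:R))) <= eta * x by near: x; exact: hpoly.
apply: hpx => //; rewrite pJ andbT ler_pdivrMr; last by lra.
have hCx : `|derive1n d f x| <= C.
  have : `|derive1n d f x| <= C /\ `|derive1n d.+1 f x| * x ^+ d.+1 <= C by near: x.
  by case.
apply: (le_trans (ltW hk)); rewrite ler_wpM2l//; lra.
Unshelve. all: by end_near. Qed.

End HardyExponentialSums.

(** * Fejer kernels and counting *)

Section Fejer.
Variable R : realType.
Implicit Types (t : R) (s : seq nat).
Local Notation normc := (@Normc.normc R).

(** This is r times the Fejer kernel of mean 1. *)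
Definition fejer (r : nat) t : R := normc (\sum_(i < r) cis (i%:R * t)) ^+ 2.

Lemma Re_sum (I : Type) (r : seq I) (F : I -> R[i]) :
  complex.Re (\sum_(i <- r) F i) = \sum_(i <- r) complex.Re (F i).
Proof. by elim/big_rec2: _ => // i x y _ <-; case: y; case: (F i). Qed.

Lemma fejer_step (c : nat -> R) (r : nat) :
  2 * \sum_(j < r) (r - j)%:R * c j - r%:R + 2 * \sum_(j < r.+1) c j - 1
    = 2 * \sum_(j < r.+1) (r.+1 - j)%:R * c j - r.+1%:R.
Proof.
rewrite [X in _ = 2 * X - _](eq_bigr (fun j : 'I_r.+1 => c j + (r - j)%:R * c j)); last first.
  move=> j _; have jr : (j <= r)%N by rewrite -ltnS.
  by rewrite subSn// -[(r - j).+1%:R]natr1; ring.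
rewrite big_split /= [in RHS](@big_ord_recr _ _ _ r (fun j => (r - j)%:R * c j)) /= subnn mul0r addr0.
by rewrite -[r.+1%:R]natr1; ring.
Qed.

Lemma Re_cisN t : complex.Re (cis (- t)) = complex.Re (cis t).
Proof. by rewrite /= mulrN cosN. Qed.

(** The term j = 0 is counted twice in the symmetric sum, hence the subtracted r. *)
Lemma fejerE (r : nat) t :
  fejer r t = 2 * \sum_(j < r) (r - j)%:R * complex.Re (cis (j%:R * t)) - r%:R.
Proof.
elim: r => [|r IH].
  by rewrite /fejer !big_ord0 Normc.normc0 mulr0 subrr expr0n.
have -> : fejer r.+1 t = fejer r t + 2 * \sum_(j < r.+1) complex.Re (cis (j%:R * t)) - 1.
  rewrite /fejer big_ord_recr /=; set Z := \sum_(i < r) _; set w := cis _.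
  have -> : normc (Z + w) ^+ 2 = normc Z ^+ 2 + 1 + 2 * complex.Re (Z * cis (- (r%:R * t))).
    rewrite cisN -/w; have := normc_cis (r%:R * t); rewrite -/w => w1.
    have := normc_sq w; rewrite w1 expr1n !normc_sq.
    by case: (Z) => a b; case: (w) => c d /= e; lra.
  rewrite big_ord_recl /= mul0r mulr0 cos0.
  have -> : complex.Re (Z * cis (- (r%:R * t))) = \sum_(j < r) complex.Re (cis (j.+1%:R * t)).
    rewrite /Z mulr_suml Re_sum (reindex_inj rev_ord_inj).
    apply: eq_bigr => i _; rewrite -cisD -Re_cisN; congr (complex.Re (cis _)).
    by rewrite /= natrB//; ring.
  by ring.
rewrite IH; exact: (fejer_step (fun j => complex.Re (cis (j%:R * t))) r).
Qed.

(** All r exponentials have angle at most 1, hence real part at least 1/2. *)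
Lemma fejer_ge (r : nat) t : `|t| * r%:R <= 1 / 8 -> r%:R ^+ 2 / 4 <= fejer r t.
Proof.
move=> ht; rewrite /fejer.
have -> : r%:R ^+ 2 / 4 = (r%:R / 2) ^+ 2 :> R by field.
rewrite lerXn2r ?nnegrE ?divr_ge0 ?normc_ge0//.
apply: (@le_trans _ _ (complex.Re (\sum_(i < r) cis (i%:R * t)))); last first.
  rewrite (le_trans (ler_norm _))// -(@ler_pXn2r _ 2) ?nnegrE ?normc_ge0//.
  by rewrite normc_sq real_normK ?num_real// lerDl sqr_ge0.
rewrite Re_sum; apply: (@le_trans _ _ (\sum_(i < r) (1 / 2 : R))).
  by rewrite sumr_const card_ord -[leRHS]mulr_natl mul1r.
apply: ler_sum => i _; rewrite /= -cos_norm; apply: cos_ge_half.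
rewrite normr_ge0 /= normrM (normrM i%:R) (ger0_norm (ler0n R i)).
rewrite (ger0_norm (mulr_ge0 (ler0n R 2) (pi_ge0 R))).
have : i%:R * `|t| <= `|t| * r%:R by rewrite mulrC ler_wpM2l// ler_nat ltnW.
have : 0 <= i%:R * `|t| by rewrite mulr_ge0.
have := @pi_lt4 R; have := pi_ge0 R; nra.
Qed.

Lemma fejer_le (r : nat) t : t != 0 -> `|t| <= 1 / 8 -> fejer r t <= (t ^+ 2)^-1.
Proof.
move=> t0 ht; have nt0 : 0 < `|t| by rewrite normr_gt0.
have h := normc_1Bcis_ge ht.
have -> : (t ^+ 2)^-1 = `|t|^-1 ^+ 2 by rewrite exprVn real_normK ?num_real.
rewrite lerXn2r ?nnegrE ?normc_ge0 ?invr_ge0//.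
rewrite -[leRHS]mul1r ler_pdivlMr//.
have e : (\sum_(i < r) cis (i%:R * t)) * (1 - cis t) = 1 - cis (r%:R * t).
  elim: (r) => [|r' IH]; first by rewrite big_ord0 !mul0r cis0 subrr.
  by rewrite big_ord_recr /= mulrDl IH -[r'.+1%:R]natr1 mulrDl mul1r cisD; ring.
have : normc (\sum_(i < r) cis (i%:R * t)) * normc (1 - cis t) <= 2.
  rewrite -Normc.normcM e (le_trans (le_normcD _ _))// normcN normc_cis.
  by rewrite Normc.normc1; lra.
have := normc_ge0 (\sum_(i < r) cis (i%:R * t)); nra.
Qed.

Lemma cis_neq1_lt1 t : 0 < `|t| < 1 -> 1 - cis t != 0.
Proof.
move=> /andP[t0 t1]; apply/eqP => e.
have := normc_1Bcis t; rewrite e Normc.normc0.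
have h u : 0 < u < 1 -> 0 < `|sin (pi * u)|.
  move=> /andP[u0 u1]; rewrite normr_gt0 gt_eqF// sin_gt0_pi// mulr_gt0 ?pi_gt0//=.
  by rewrite -[ltRHS]mulr1 ltr_pM2l ?pi_gt0.
have : 0 < `|sin (pi * t)|.
  have [tp|tn] := ltP 0 t; first by apply: h; move: t1; rewrite gtr0_norm// tp.
  rewrite -normrN -sinN -mulrN; move: t0 t1; rewrite ler0_norm// => t0 t1.
  by apply: h; rewrite t0.
by lra.
Qed.

Lemma sqr_normc_sum_cis (I : Type) (r : seq I) (u : I -> R) :
  real_complex _ (normc (\sum_(i <- r) cis (u i)) ^+ 2)
    = \sum_(i <- r) \sum_(j <- r) cis (u i - u j).
Proof.
rewrite sqr_normc_sum; apply: eq_bigr => i _; apply: eq_bigr => j _.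
by rewrite cisD cisN.
Qed.

(** Orthogonality over J full periods; k N < Q keeps the numbers k x distinct modulo Q. *)
Lemma parseval s (k N Q J : nat) : uniq s -> (forall x, x \in s -> (x <= N)%N) ->
  (0 < k)%N -> (k * N < Q)%N ->
  \sum_(j < J * Q) normc (\sum_(x <- s) cis (j%:R / Q%:R * (k * x)%:R)) ^+ 2
    = (J * Q)%:R * (size s)%:R.
Proof.
move=> us hs k0 kQ; have Q0 : (0 < Q)%N by rewrite (leq_ltn_trans _ kQ).
have Qr : 0 < Q%:R :> R by rewrite ltr0n.
apply: (@complexI R); rewrite rmorph_sum /=.
under eq_bigr do rewrite sqr_normc_sum_cis.
rewrite exchange_big /=; under eq_bigr do rewrite exchange_big /=.
have geo (x y : nat) : x \in s -> y \in s ->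
    \sum_(j < J * Q) cis (j%:R / Q%:R * (k * x)%:R - j%:R / Q%:R * (k * y)%:R)
     = (if y == x then (J * Q)%:R else 0 : R[i]).
  move=> xs ys.
  pose th : R := ((k * x)%:R - (k * y)%:R) / Q%:R.
  rewrite (eq_bigr (fun j : 'I_(J * Q) => cis (j%:R * th))); last first.
    by move=> j _; congr cis; rewrite /th; field; rewrite gt_eqF.
  have [exy|xy] := eqVneq y x.
    have th0 : th = 0 by rewrite /th exy subrr mul0r.
    rewrite (eq_bigr (fun=> 1)); last by move=> j _; rewrite th0 mulr0 cis0.
    by rewrite sumr_const card_ord.
  have th1 : 0 < `|th| < 1.
    rewrite normr_gt0 mulf_neq0 ?invr_eq0 ?(gt_eqF Qr)//=; last first.
      rewrite subr_eq0 eqr_nat eqn_pmul2l//; by rewrite eq_sym.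
    rewrite normrM normfV (gtr0_norm Qr) ltr_pdivrMr// mul1r.
    have bnd z : z \in s -> (k * z)%:R < Q%:R :> R.
      by move=> /hs zN; rewrite ltr_nat (leq_ltn_trans _ kQ)// leq_mul2l zN orbT.
    have := bnd x xs; have := bnd y ys; have := ler0n R (k * x); have := ler0n R (k * y).
    by rewrite ltr_norml => *; apply/andP; split; lra.
  apply: (mulIf (cis_neq1_lt1 th1)); rewrite mul0r.
  have -> : (\sum_(j < J * Q) cis (j%:R * th)) * (1 - cis th) = 1 - cis ((J * Q)%:R * th).
    elim: (J * Q)%N => [|r' IH]; first by rewrite big_ord0 !mul0r cis0 subrr.
    by rewrite big_ord_recr /= mulrDl IH -[r'.+1%:R]natr1 mulrDl mul1r cisD; ring.
  have -> : (J * Q)%:R * th = (J * (k * x))%:R + (- (J * (k * y))%:Z)%:~R :> R.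
    by rewrite /th intrN -pmulrn !natrM; field; rewrite gt_eqF.
  by rewrite cisDint cis_nat subrr.
have -> : \sum_(x <- s) \sum_(y <- s) \sum_(j < J * Q)
    cis (j%:R / Q%:R * (k * x)%:R - j%:R / Q%:R * (k * y)%:R)
    = \sum_(x <- s) ((J * Q)%:R : R[i]).
  rewrite !big_seq; apply: eq_bigr => x xs.
  rewrite (eq_big_seq (fun y => if y == x then (J * Q)%:R else 0)); last first.
    by move=> y ys; rewrite geo.
  by rewrite -big_mkcond /= -big_filter filter_pred1_uniq// big_seq1.
rewrite big_const_seq count_predT iter_addr_0 -natrM (rmorph_nat (real_complex R)).
by rewrite [in RHS]natrM mulr_natr.
Qed.

End Fejer.

(** * Comparison of the two kernels *)

Section Counting.
Variable R : realType.
Implicit Types (s : seq nat) (v : nat -> R).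
Local Notation normc := (@Normc.normc R).

Lemma sum_uniq_le s (N : nat) (F : nat -> R) : uniq s -> (forall y, y \in s -> (y < N)%N) ->
  (forall y, 0 <= F y) -> \sum_(y <- s) F y <= \sum_(y < N) F y.
Proof.
move=> us hs F0.
have ps : perm_eq s [seq y <- iota 0 N | y \in s].
  apply: uniq_perm => //; first by rewrite filter_uniq// iota_uniq.
  by move=> y; rewrite mem_filter mem_iota add0n /=; case: (boolP (y \in s)) => //= /hs ->.
rewrite (perm_big _ ps) big_filter -(big_mkord xpredT) /index_iota subn0 big_mkcond /=.
by apply: ler_sum => y _; case: ifP.
Qed.

Lemma sum_seq_const s (B : R) : \sum_(x <- s) B = (size s)%:R * B.
Proof. by rewrite big_const_seq count_predT iter_addr_0 mulr_natl. Qed.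

Lemma sum_seq_le s (F : nat -> R) (B : R) :
  (forall x, x \in s -> F x <= B) -> \sum_(x <- s) F x <= (size s)%:R * B.
Proof.
move=> hF; apply: (@le_trans _ _ (\sum_(x <- s) B)).
  by rewrite !big_seq; apply: ler_sum.
by rewrite sum_seq_const.
Qed.

(** The function [g] plays the role of the arctangent: it takes values in [-1, 1] and 1 / (1 + z^2)
    is at most four times its increment from z to z + 1. The sum telescopes, uniformly in u. *)
Lemma inverse_square_sum (l N : nat) (u : R) : (0 < l)%N ->
  \sum_(y < N) (1 + (u + (l * y)%:R) ^+ 2)^-1 <= 8.
Proof.
move=> l0; pose g (z : R) := z / (1 + `|z|).
have p (z : R) : 0 < 1 + `|z| by rewrite ltr_pwDl.
have g1 (z : R) : `|g z| <= 1.
  by rewrite /g normrM normfV (gtr0_norm (p z)) ler_pdivrMr// mul1r lerDr.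
have mono (z w : R) : z <= w -> g z <= g w.
  move=> zw; rewrite /g ler_pdivrMr// mulrAC ler_pdivlMr//.
  case: (ler0P z) => z0; case: (ler0P w) => w0; nra.
have step (z : R) : (1 + z ^+ 2)^-1 <= 4 * (g (z + 1) - g z).
  have q : 0 < 1 + z ^+ 2 by have := sqr_ge0 z; lra.
  rewrite -[leLHS]mul1r ler_pdivrMr// /g.
  have [z0|z0] := lerP 0 z.
    rewrite (ger0_norm z0) ger0_norm; last by lra.
    have -> : (z + 1) / (1 + (z + 1)) - z / (1 + z) = ((1 + z) * (2 + z))^-1.
      by field; rewrite ?andbA; repeat (apply/andP; split); apply/eqP => e; lra.
    rewrite mulrAC ler_pdivlMr; last by rewrite mulr_gt0//; lra.
    nra.
  have [z1|z1] := lerP (z + 1) 0.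
    rewrite (ltr0_norm z0) ler0_norm//.
    have -> : (z + 1) / (1 - (z + 1)) - z / (1 - z) = ((- z) * (1 - z))^-1.
      by field; rewrite ?andbA; repeat (apply/andP; split); apply/eqP => e; lra.
    rewrite mulrAC ler_pdivlMr; last by rewrite mulr_gt0//; lra.
    nra.
  rewrite (ltr0_norm z0) gtr0_norm//.
  have -> : (z + 1) / (1 + (z + 1)) - z / (1 - z) = (1 - 2 * z - 2 * z ^+ 2) / ((2 + z) * (1 - z)).
    by field; rewrite ?andbA; repeat (apply/andP; split); apply/eqP => e; lra.
  rewrite mulrA mulrAC ler_pdivlMr; last by rewrite mulr_gt0//; lra.
  nra.
apply: (@le_trans _ _ (\sum_(y < N) 4 * (g (u + (l * y.+1)%:R) - g (u + (l * y)%:R)))).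
  apply: ler_sum => y _; apply: le_trans (step _) _; rewrite ler_pM2l// lerD2r.
  apply: mono; rewrite -addrA lerD2l mulnS addnC natrD lerD2l.
  by rewrite ler1n.
rewrite -mulr_sumr -(big_mkord xpredT (fun y => g (u + (l * y.+1)%:R) - g (u + (l * y)%:R))).
rewrite (telescope_sumr (fun y => g (u + (l * y)%:R)))//.
have := g1 (u + (l * N)%:R); have := g1 (u + (l * 0)%:R).
by rewrite !ler_norml => /andP[? ?] /andP[? ?]; lra.
Qed.

(** From |w| >= 1/2 follows 1 + w^2 <= 5 w^2, and 40 = 5 * 8. *)
Lemma tail_sum s (l N : nat) (u : R) : (0 < l)%N -> uniq s -> (forall y, y \in s -> (y <= N)%N) ->
  (forall y, y \in s -> 1 / 2 <= `|u + (l * y)%:R|) ->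
  \sum_(y <- s) ((u + (l * y)%:R) ^+ 2)^-1 <= 40.
Proof.
move=> l0 us hs hu; pose F y := (1 + (u + (l * y)%:R) ^+ 2)^-1.
have F0 y : 0 <= F y by rewrite invr_ge0 addr_ge0// sqr_ge0.
apply: (@le_trans _ _ (5 * \sum_(y <- s) F y)).
  rewrite mulr_sumr !big_seq; apply: ler_sum => y /hu hy.
  have h4 : 1 / 4 <= (u + (l * y)%:R) ^+ 2.
    rewrite -real_normK ?num_real//; set z := (`|_|) in hy *; nra.
  rewrite /F; set z := _ ^+ 2 in h4 *.
  have z0 : 0 < z by lra. have z1 : 0 < 1 + z by lra.
  by rewrite -[leLHS]mul1r ler_pdivrMr// mulrAC ler_pdivlMr//; lra.
have := @sum_uniq_le s N.+1 F us hs F0; have := inverse_square_sum N.+1 u l0.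
by rewrite /F; lra.
Qed.

Lemma triple_sum (M : nat) s (a b c : nat -> R) :
  \sum_(n < M) \sum_(x <- s) \sum_(y <- s) cis (a n + b x + c y)
    = (\sum_(n < M) cis (a n)) * (\sum_(x <- s) cis (b x)) * (\sum_(y <- s) cis (c y)).
Proof.
rewrite -mulrA mulr_suml; apply: eq_bigr => n _.
rewrite mulr_suml mulr_sumr; apply: eq_bigr => x _.
by rewrite !mulr_sumr; apply: eq_bigr => y _; rewrite !cisD mulrA.
Qed.

(** Truncated subtraction gives the coefficient 0 for j >= r. Both kernels have mean 1, so the
    weight at j = 0 vanishes. *)
Lemma fejer_compare (r S : nat) (t : R) : (0 < r)%N -> (r <= S)%N ->
  fejer r t / r%:R = fejer S t / S%:R + 2 * \sum_(j < S)
    ((r - j)%:R / r%:R - (S - j)%:R / S%:R) * complex.Re (cis (j%:R * t)).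
Proof.
move=> r0 rS; have S0 : (0 < S)%N by exact: leq_trans r0 rS.
pose c j := complex.Re (cis (j%:R * t)).
have r1 : r%:R != 0 :> R by rewrite pnatr_eq0 -lt0n.
have S1 : S%:R != 0 :> R by rewrite pnatr_eq0 -lt0n.
have er : \sum_(j < r) (r - j)%:R * c j = \sum_(j < S) (r - j)%:R * c j.
  rewrite -!(big_mkord xpredT (fun j => (r - j)%:R * c j)) (big_cat_nat _ rS)//=.
  have -> : \sum_(r <= j < S) (r - j)%:R * c j = 0; last by rewrite addr0.
  by rewrite big_nat big1// => j /andP[rj _]; rewrite (eqP rj) mul0r.
have -> : \sum_(j < S) ((r - j)%:R / r%:R - (S - j)%:R / S%:R) * c j =
   (\sum_(j < S) (r - j)%:R * c j) / r%:R - (\sum_(j < S) (S - j)%:R * c j) / S%:R.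
  rewrite !mulr_suml -sumrB; apply: eq_bigr => j _; ring.
rewrite !fejerE -/(c _); move: er; rewrite /c => ->.
by field; rewrite r1 S1.
Qed.

(* The left side bounds from below the sum of the normalized Fejer kernel of
   order r at the points t / Q, with t = v n - k x + l y; the same sum with order
   J * Q is small because |t| >= 1/2; and the two sums differ by exponential
   sums, controlled by E and by Parseval's identity modulo Q. *)
Lemma counting_bound s v (N M k l Q J r : nat) (E : R) : uniq s ->
  (forall x, x \in s -> (x <= N)%N) -> (0 < l)%N -> (l <= k)%N -> (k * N < Q)%N ->
  (0 < J)%N -> (0 < r <= J * Q)%N ->
  (forall n x y, (n < M)%N -> x \in s -> y \in s ->
    1 / 2 <= `|v n - (k * x)%:R + (l * y)%:R| <= Q%:R / 8) ->
  (forall j, (j < J * Q)%N ->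
    `|(r - j)%:R / r%:R - (J * Q - j)%:R / (J * Q)%:R| *
      normc (\sum_(n < M) cis (j%:R / Q%:R * v n)) <= E) ->
  r%:R / 4 * \sum_(n < M) \sum_(x <- s) \sum_(y <- s)
      (if `|v n - (k * x)%:R + (l * y)%:R| * (8 * r)%:R <= Q%:R then 1 else 0)
    <= 40 * (Q%:R / J%:R) * M%:R * (size s)%:R + 2 * E * (J * Q)%:R * (size s)%:R.
Proof.
move=> us hs l0 lk kQ J0 /andP[r0 rS] ht hE.
have k0 : (0 < k)%N by rewrite (leq_trans l0).
have lQ : (l * N < Q)%N by rewrite (leq_ltn_trans _ kQ)// leq_mul2r lk orbT.
have Q0 : (0 < Q)%N by rewrite (leq_ltn_trans _ kQ).
have Qr : 0 < Q%:R :> R by rewrite ltr0n.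
have Jr : 0 < J%:R :> R by rewrite ltr0n.
have rr : 0 < r%:R :> R by rewrite ltr0n.
set S := (J * Q)%N in rS hE *.
have S0 : 0 < S%:R :> R by rewrite ltr0n muln_gt0 J0.
pose t n x y : R := v n - (k * x)%:R + (l * y)%:R.
pose d j : R := (r - j)%:R / r%:R - (S - j)%:R / S%:R.
pose T j : R := complex.Re (\sum_(n < M) \sum_(x <- s) \sum_(y <- s) cis (j%:R * (t n x y / Q%:R))).
apply: (@le_trans _ _ (\sum_(n < M) \sum_(x <- s) \sum_(y <- s) fejer r (t n x y / Q%:R) / r%:R)).
  rewrite mulr_sumr; apply: ler_sum => n _.
  rewrite mulr_sumr; apply: ler_sum => x _.
  rewrite mulr_sumr; apply: ler_sum => y _.
  rewrite -/(t n x y) ler_pdivlMr//; case: ifPn => [htr|_]; last first.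
    by rewrite mulr0 mul0r /fejer sqr_ge0.
  rewrite mulr1 mulrAC -expr2; apply: fejer_ge.
  rewrite normrM normfV (gtr0_norm Qr) mulrAC ler_pdivrMr//.
  by move: htr; rewrite natrM; lra.
rewrite (eq_bigr (fun n : 'I_M => \sum_(x <- s) \sum_(y <- s)
   (fejer S (t n x y / Q%:R) / S%:R + 2 * \sum_(j < S) d j * complex.Re (cis (j%:R * (t n x y / Q%:R)))))); last first.
  move=> n _; apply: eq_bigr => x _; apply: eq_bigr => y _.
  exact: fejer_compare.
have -> : \sum_(n < M) \sum_(x <- s) \sum_(y <- s)
   (fejer S (t n x y / Q%:R) / S%:R + 2 * \sum_(j < S) d j * complex.Re (cis (j%:R * (t n x y / Q%:R))))
  = \sum_(n < M) \sum_(x <- s) \sum_(y <- s) fejer S (t n x y / Q%:R) / S%:R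
   + 2 * \sum_(j < S) d j * T j.
  have -> : 2 * \sum_(j < S) d j * T j = \sum_(n < M) \sum_(x <- s) \sum_(y <- s)
     2 * \sum_(j < S) d j * complex.Re (cis (j%:R * (t n x y / Q%:R))).
    under [RHS]eq_bigr => n _.
      under eq_bigr => x _ do rewrite -mulr_sumr exchange_big /=.
      rewrite -mulr_sumr exchange_big /=.
      over.
    rewrite -mulr_sumr exchange_big /=; congr (2 * _).
    apply: eq_bigr => j _; rewrite /T Re_sum mulr_sumr; apply: eq_bigr => n _.
    rewrite Re_sum mulr_sumr; apply: eq_bigr => x _.
    by rewrite Re_sum mulr_sumr.
  rewrite -big_split; apply: eq_bigr => n _.
  rewrite -big_split; apply: eq_bigr => x _.
  by rewrite -big_split.
apply: lerD.
  have -> : 40 * (Q%:R / J%:R) * M%:R * (size s)%:R = M%:R * ((size s)%:R * (40 * (Q%:R / J%:R))) :> R.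
    by ring.
  have b0 : 0 <= 40 * (Q%:R / J%:R) :> R by rewrite mulr_ge0// divr_ge0.
  apply: sum_ord_le => [|n _]; first by rewrite mulr_ge0.
  apply: sum_seq_le => x xs.
  apply: (@le_trans _ _ (Q%:R ^+ 2 / S%:R * \sum_(y <- s) ((v n - (k * x)%:R + (l * y)%:R) ^+ 2)^-1)).
    rewrite mulr_sumr !big_seq; apply: ler_sum => y ys.
    have /andP[h1 h2] := ht n x y (ltn_ord n) xs ys.
    rewrite [leRHS]mulrAC ler_pM2r ?invr_gt0//.
    have -> : Q%:R ^+ 2 * ((v n - (k * x)%:R + (l * y)%:R) ^+ 2)^-1 = ((t n x y / Q%:R) ^+ 2)^-1.
      have w0 : v n - (k * x)%:R + (l * y)%:R != 0 by rewrite -normr_gt0; lra.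
      by rewrite /t; move: w0; set w := v n - _ + _ => w0; field; rewrite w0 gt_eqF.
    apply: fejer_le.
      rewrite mulf_neq0 ?invr_eq0 ?(gt_eqF Qr)// -normr_gt0 /t; lra.
    by rewrite normrM normfV (gtr0_norm Qr) ler_pdivrMr// /t; lra.
  have -> : 40 * (Q%:R / J%:R) = Q%:R ^+ 2 / S%:R * 40 :> R.
    by rewrite /S natrM; field; rewrite !gt_eqF.
  rewrite ler_wpM2l ?divr_ge0 ?exprn_ge0//.
  apply: (@tail_sum s l N) => // y ys.
  by have /andP[] := ht n x y (ltn_ord n) xs ys.
have e0 : 0 <= E.
  have SS : (0 < S)%N by rewrite -(ltr0n R).
  by apply: le_trans (hE 0%N SS); rewrite mulr_ge0// normc_ge0.
pose A (c j : nat) := normc (\sum_(x <- s) cis (j%:R / Q%:R * (c * x)%:R)).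
have hT j : (j < S)%N -> d j * T j <= E * (A k j * A l j).
  move=> jS; apply: le_trans (ler_norm _) _; rewrite normrM.
  have -> : T j = complex.Re ((\sum_(n < M) cis (j%:R / Q%:R * v n)) *
     (\sum_(x <- s) cis (- (j%:R / Q%:R * (k * x)%:R))) * (\sum_(y <- s) cis (j%:R / Q%:R * (l * y)%:R))).
    rewrite -(triple_sum M s (fun n => j%:R / Q%:R * v n)
      (fun x => - (j%:R / Q%:R * (k * x)%:R)) (fun y => j%:R / Q%:R * (l * y)%:R)) /T; congr complex.Re; apply: eq_bigr => n _; apply: eq_bigr => x _.
    by apply: eq_bigr => y _; congr cis; rewrite /t; ring.
  rewrite -conj_sum_cis; set Z := _ * _ * _.
  have : `|complex.Re Z| <= normc Z.
    rewrite -(@ler_pXn2r _ 2) ?nnegrE ?normc_ge0//.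
    by rewrite normc_sq real_normK ?num_real// lerDl sqr_ge0.
  rewrite /Z !Normc.normcM normc_conj -/(A k j) -/(A l j) => h.
  apply: le_trans (ler_wpM2l (normr_ge0 _) h) _.
  have hA : 0 <= A k j * A l j by rewrite mulr_ge0// normc_ge0.
  by have := ler_wpM2r hA (hE j jS); rewrite -/(d j) !mulrA.
(* Separates the k-sum from the l-sum, whose squares have the same total by [parseval]. *)
have AB j : A k j * A l j <= (A k j ^+ 2 + A l j ^+ 2) / 2.
  have := sqr_ge0 (A k j - A l j); rewrite sqrrB; lra.
have hP : \sum_(j < S) (A k j ^+ 2 + A l j ^+ 2) / 2 = S%:R * (size s)%:R.
  rewrite -mulr_suml big_split /= (@parseval R s k N Q J us hs k0 kQ) (@parseval R s l N Q J us hs l0 lQ).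
  by rewrite -/S; field.
apply: (@le_trans _ _ (2 * \sum_(j < S) E * ((A k j ^+ 2 + A l j ^+ 2) / 2))).
  rewrite ler_pM2l//; apply: ler_sum => j _; apply: le_trans (hT j (ltn_ord j)) _.
  by rewrite ler_wpM2l.
by rewrite -mulr_sumr hP; lra.
Qed.

End Counting.

(** * Pairs of elements far apart and visits near a target *)

Section Pairs.
Variable R : realType.
Implicit Types (s : seq nat) (v : nat -> R).

Lemma sum_indicator s (P : pred nat) :
  \sum_(y <- s) (if P y then 1 else 0 : R) = (count P s)%:R.
Proof. by rewrite -big_mkcond big_const_seq iter_addr_0. Qed.

(** Each x has at most 2 D elements y at distance less than D, and exchanging x and y splits the
    remaining pairs evenly. *)
Lemma pair_count s (D : nat) : uniq s ->
  (size s)%:R * ((size s)%:R - 2 * D%:R) / 2 <=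
    \sum_(x <- s) \sum_(y <- s) (if (y + D <= x)%N then 1 else 0 : R).
Proof.
move=> us; set a : R := (size s)%:R.
pose far x y : R := if (y + D <= x)%N then 1 else 0.
pose F := \sum_(x <- s) \sum_(y <- s) far x y.
have eF : F = \sum_(x <- s) \sum_(y <- s) far y x by rewrite /F exchange_big.
have close x : a - 2 * D%:R <= \sum_(y <- s) (far x y + far y x).
  pose P y := ((x < y + D) && (y < x + D))%N.
  have cP : (count P s <= 2 * D)%N.
    rewrite -size_filter -(size_iota (x.+1 - D) (2 * D)); apply: uniq_leq_size.
      by rewrite filter_uniq.
    by move=> y; rewrite mem_filter mem_iota => /andP[/andP[h1 h2] _]; lia.
  have -> : a = \sum_(y <- s) (1 : R) by rewrite big_const_seq count_predT iter_addr_0.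
  have : \sum_(y <- s) 1 <= \sum_(y <- s) (far x y + far y x) + \sum_(y <- s) (if P y then 1 else 0 : R).
    rewrite -big_split; apply: ler_sum => y _ /=; rewrite /far /P.
    by case: (leqP (y + D) x); case: (leqP (x + D) y) => /=; lra.
  rewrite sum_indicator; have : (count P s)%:R <= 2 * D%:R :> R by rewrite -natrM ler_nat.
  by lra.
have : a * (a - 2 * D%:R) <= F + F.
  rewrite {2}eF /F -big_split /=.
  apply: (@le_trans _ _ (\sum_(x <- s) (a - 2 * D%:R))).
    by rewrite sum_seq_const.
  by apply: ler_sum => x _; rewrite -big_split; exact: close.
by rewrite ler_pdivrMr// -/F; lra.
Qed.

(** From the first index where [v] reaches [t0], the next m values stay within m G of it, since each
    step is at most G. *)
Lemma target_count v (M1 M m : nat) (t0 W G : R) : 0 <= G -> v 0%N <= t0 <= v M1 ->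
  (M1 + m <= M)%N -> (forall n, (n < M)%N -> `|v n.+1 - v n| <= G) -> m%:R * G <= W ->
  m%:R <= \sum_(n < M) (if `|v n - t0| <= W then 1 else 0 : R).
Proof.
move=> G0 /andP[v0 vM] mM hG hW.
have ex : exists n, t0 <= v n by exists M1.
case: (ex_minnP ex) => n0 h0 minn0.
have n0M1 : (n0 <= M1)%N by exact: minn0.
have hi i : (i < m)%N -> `|v (n0 + i)%N - t0| <= i.+1%:R * G.
  elim: i => [|i IH] im.
    rewrite addn0 mul1r ger0_norm ?subr_ge0//.
    case: n0 h0 minn0 n0M1 => [|n1] h0 minn0 n0M1; first by lra.
    have : v n1 < t0 by rewrite ltNge; apply/negP => /minn0; rewrite ltnn.
    have n1M : (n1 < M)%N by rewrite (leq_trans n0M1)// (leq_trans _ mM)// leq_addr.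
    by have := le_trans (ler_norm _) (hG n1 n1M); lra.
  have := IH (ltnW im); rewrite addnS => h1.
  have iM : (n0 + i < M)%N.
    by rewrite (leq_trans _ mM)// -addnS leq_add// ltnW.
  have h2 := hG _ iM.
  have -> : v (n0 + i).+1 - t0 = (v (n0 + i).+1 - v (n0 + i)%N) + (v (n0 + i)%N - t0) by ring.
  by rewrite (le_trans (ler_normD _ _))// -[i.+2%:R]natr1; lra.
pose F n : R := if `|v n - t0| <= W then 1 else 0.
have F0 n : 0 <= F n by rewrite /F; case: ifP.
have n0m : (n0 + m <= M)%N by rewrite (leq_trans _ mM)// leq_add2r.
rewrite -(big_mkord xpredT F) (@big_cat_nat _ _ _ (n0 + m)%N)//=.
rewrite (@big_cat_nat _ _ _ n0)//= ?leq_addr//.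
have -> : \sum_(n0 <= i < n0 + m) F i = m%:R.
  rewrite -{1}[n0]add0n big_addn addKn big_mkord (eq_bigr (fun=> 1)).
    by rewrite sumr_const card_ord.
  move=> i _; rewrite /F addnC ifT//; apply: le_trans (hi i (ltn_ord i)) _.
  by apply: le_trans hW; rewrite ler_wpM2r// ler_nat.
have z a b : 0 <= \sum_(a <= i < b) F i by apply: sumr_ge0.
by have := z 0%N n0; have := z (n0 + m)%N M; lra.
Qed.

End Pairs.

(** * Solutions of the equation *)

Section Solutions.
Variable R : realType.
Implicit Types (s : seq nat) (v : nat -> R).
Local Notation normc := (@Normc.normc R).

(* The shift by 1/2 makes every non-solution (n, x, y) satisfy
   |v n - 1/2 - k x + l y| >= 1/2. *)
Lemma find_solution s v (N c X k l q J r D m : nat) (B G E : R) : uniq s ->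
  (forall x, x \in s -> (x <= N)%N) -> (0 < l)%N -> (l <= k)%N -> (0 < N)%N ->
  (0 < X)%N -> (0 < J)%N -> (0 < r <= J * (q * N))%N ->
  (forall n, (n < c.+1 * X)%N -> `|v n| <= B * N%:R) ->
  8 * (B + 2 * k%:R + 1) <= q%:R ->
  v 0%N <= D%:R -> k.+1%:R * N%:R <= v (c * X)%N ->
  0 <= G -> (forall n, (n < c.+1 * X)%N -> `|v n.+1 - v n| <= G) ->
  (m <= X)%N -> m%:R * G * (8 * r)%:R <= (q * N)%:R ->
  (forall j, (j < J * (q * N))%N ->
    `|(r - j)%:R / r%:R - (J * (q * N) - j)%:R / (J * (q * N))%:R| *
      normc (\sum_(n < c.+1 * X) cis (j%:R / (q * N)%:R * v n)) <= E) ->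
  40 * ((q * N)%:R / J%:R) * (c.+1 * X)%:R * (size s)%:R
     + 2 * E * (J * (q * N))%:R * (size s)%:R
    < r%:R / 4 * (m%:R * ((size s)%:R * ((size s)%:R - 2 * D%:R) / 2)) ->
  exists x y n : nat, [/\ x \in s, y \in s, (n < c.+1 * X)%N &
    k%:Z * x%:Z - l%:Z * y%:Z = Num.floor (v n)].
Proof.
move=> us hs l0 lk N0 X0 J0 hr hB hq v0 vc G0 hG mX hm hE hfin; apply: contrapT => hno.
set Q := (q * N)%N in hr hm hE hfin.
have Nr : 1 <= N%:R :> R by rewrite ler1n.
have k1 : 1 <= k%:R :> R by rewrite ler1n (leq_trans l0).
have lkr : l%:R <= k%:R :> R by rewrite ler_nat.
have B0 : 0 <= B + 1.
  have := hB 0%N; rewrite muln_gt0 X0 => /(_ isT) h.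
  have : 0 <= B * N%:R by apply: le_trans h.
  by rewrite pmulr_lge0 ?ltr0n//; lra.
have QN : 8 * (B + 2 * k%:R + 1) * N%:R <= Q%:R by rewrite natrM ler_wpM2r.
have kQ : (k * N < Q)%N.
  rewrite -(ltr_nat R) natrM; apply: lt_le_trans QN.
  by rewrite ltr_pM2r; lra.
have xb x : x \in s -> (0 : R) <= x%:R /\ (x%:R : R) <= N%:R by move=> /hs xN; rewrite ler0n ler_nat.
pose w n := v n - 1 / 2.
have ht n x y : (n < c.+1 * X)%N -> x \in s -> y \in s ->
    1 / 2 <= `|w n - (k * x)%:R + (l * y)%:R| <= Q%:R / 8.
  move=> nM xs ys; apply/andP; split.
    rewrite leNgt; apply/negP => hlt; apply: hno; exists x, y, n; split=> //.
    apply/esym/floor_def; rewrite intrD intrB !intrM -!pmulrn.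
    move: hlt; rewrite ltr_norml /w !natrM => /andP[h1 h2].
    by apply/andP; split; lra.
  have := hB n nM; rewrite ler_norml => /andP[h1 h2].
  have [x0 xN] := xb x xs; have [y0 yN] := xb y ys.
  have h3 : k%:R * x%:R <= k%:R * N%:R :> R by rewrite ler_wpM2l.
  have h4 : l%:R * y%:R <= k%:R * N%:R :> R by rewrite ler_pM.
  have h5 : 0 <= k%:R * x%:R :> R by rewrite mulr_ge0.
  have h6 : 0 <= l%:R * y%:R :> R by rewrite mulr_ge0.
  have h7 : k%:R * N%:R >= N%:R :> R by rewrite ler_peMl.
  by rewrite ler_norml /w (natrM R k) (natrM R l); apply/andP; split; lra.
(* The shift by 1/2 multiplies the sum by a constant of modulus 1. *)
have hE' j : (j < J * Q)%N -> `|(r - j)%:R / r%:R - (J * Q - j)%:R / (J * Q)%:R| *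
      normc (\sum_(n < c.+1 * X) cis (j%:R / Q%:R * w n)) <= E.
  move=> /hE; suff -> : normc (\sum_(n < c.+1 * X) cis (j%:R / Q%:R * w n))
    = normc (\sum_(n < c.+1 * X) cis (j%:R / Q%:R * v n)) by [].
  rewrite (eq_bigr (fun n : 'I_(c.+1 * X) => cis (- (j%:R / Q%:R * (1 / 2))) * cis (j%:R / Q%:R * v n))).
    by rewrite -mulr_sumr Normc.normcM normc_cis mul1r.
  by move=> n _; rewrite -cisD /w; congr cis; ring.
have := counting_bound us hs l0 lk kQ J0 hr ht hE'.
apply/negP; rewrite -ltNge; apply: lt_le_trans hfin _.
have /andP[r0 _] := hr.
have rr : 0 < r%:R :> R by rewrite ltr0n.
rewrite ler_pM2l ?divr_gt0// exchange_big /=.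
under eq_bigr do rewrite exchange_big /=.
apply: (@le_trans _ _ (\sum_(x <- s) \sum_(y <- s) m%:R * (if (y + D <= x)%N then 1 else 0))).
  have hp := @pair_count R s D us.
  apply: le_trans (ler_wpM2l (ler0n R m) hp) _.
  rewrite mulr_sumr le_eqVlt; apply/orP; left; apply/eqP.
  by apply: eq_bigr => x _; rewrite mulr_sumr.
rewrite !big_seq; apply: ler_sum => x xs; rewrite !big_seq; apply: ler_sum => y ys.
case: ifPn => [xy|_]; last by rewrite mulr0; apply: sumr_ge0 => n _; case: ifP.
rewrite mulr1.
pose t0 : R := (k * x)%:R - (l * y)%:R + 1 / 2.
have e n : (if `|w n - (k * x)%:R + (l * y)%:R| * (8 * r)%:R <= Q%:R then 1 else 0 : R)
    = if `|v n - t0| <= Q%:R / (8 * r)%:R then 1 else 0.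
  rewrite ler_pdivlMr ?ltr0n ?muln_gt0//.
  by have -> : w n - (k * x)%:R + (l * y)%:R = v n - t0 by rewrite /w /t0; ring.
under [leRHS]eq_bigr do rewrite e.
(* The target lies in the range of v: k x - l y >= k (x - y) >= D >= v 0 by l <= k, and k x + 1/2 <=
   (k + 1) N. The crossing happens before c X, and the last X indices of the window leave room for m
   visits. *)
apply: (@target_count R v (c * X) (c.+1 * X) m t0 (Q%:R / (8 * r)%:R) G G0) => //;
  last by rewrite ler_pdivlMr// ltr0n muln_gt0.
  have [x0 xN] := xb x xs; have [y0 yN] := xb y ys.
  have xyr : y%:R + D%:R <= x%:R :> R by rewrite -natrD ler_nat.
  have h3 : k%:R * x%:R <= k%:R * N%:R :> R by rewrite ler_wpM2l.
  have h4 : l%:R * y%:R <= k%:R * y%:R :> R by rewrite ler_wpM2r.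
  have h5 : k%:R * (y%:R + D%:R) <= k%:R * x%:R :> R by rewrite ler_wpM2l//; lra.
  have h6 : D%:R <= k%:R * D%:R :> R by rewrite ler_peMl.
  have h7 : 0 <= l%:R * y%:R :> R by rewrite mulr_ge0.
  move: vc; rewrite -[k.+1%:R]natr1 /t0 !natrM => vc.
  by apply/andP; split; lra.
by rewrite mulSn addnC leq_add2r.
Qed.

End Solutions.

(** * Choice of the parameters *)

Section HardyDifference.
Variables (R : realType) (H : set (R -> R)).
Hypothesis hH : hardy_field H.
Implicit Types (f : R -> R).
Local Notation normc := (@Normc.normc R).

(** On [x, 2 x] the increment is x f'(z) with z <= 2 x, hence at least f(z) / (2 C). Iterated, this
    shows that boundedly many doublings of X carry f past all the targets. *)
Lemma hardy_growth f (C : R) : H f -> f x @[x --> +oo] --> +oo -> 0 < C ->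
  (\forall x \near +oo, `|f x| <= C * (x * `|f^`()%classic x|)) ->
  exists2 g : R, 0 < g & \forall x \near +oo, (1 + g) * f x <= f (2 * x).
Proof.
move=> hf foo C0 hC; have [M M1 hmono] := hardy_monotone hH hf.
have {}hmono x y : M <= x -> x <= y -> `|f x| <= `|f y|.
  case: hmono => [h|h]; first exact: h.
  have [] := @eventually_False R; near=> z.
  have Mz : M <= z by near: z; exact: eventually_ge.
  have h1 := h M z (lexx _) Mz.
  have : `|f M| + 1 <= f z by near: z; exact: (cvgry_ge foo).
  by have := ler_norm (f z); lra.
have /eventuallyP[M' M'1 hM] : \forall x \near +oo, [/\ 0 < f x, M <= x,
    is_derive (x : R) (1 : R) f (f^`()%classic x) & `|f x| <= C * (x * `|f^`()%classic x|)].
  near=> x; split; [near: x; exact: (cvgry_gt foo)|near: x; exact: eventually_ge| |by near: x].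
  by near: x; exact: (hardy_is_derive hH hf).
exists (2 * C)^-1; first by rewrite invr_gt0 mulr_gt0.
apply/eventuallyP; exists M' => // x Mx; have x0 : 0 < x by lra.
have [fx Mx' _ _] := hM x Mx.
have [||z /andP[z1 z2] e] := @mvt R f (f^`()%classic) x (2 * x).
- lra.
- by move=> z /andP[z1 _]; have [] := hM z (le_trans Mx z1).
have [fz _ _ hz] := hM z (le_trans Mx z1).
have [f2 _ _ _] : [/\ 0 < f (2 * x), M <= 2 * x, is_derive (2 * x) 1 f (f^`()%classic (2 * x)) &
   `|f (2 * x)| <= C * (2 * x * `|f^`()%classic (2 * x)|)] by apply: hM; lra.
have h1 : f x <= f z by have := hmono x z Mx' z1; rewrite !gtr0_norm.
have h2 : f x <= f (2 * x).
  by have := hmono x (2 * x) Mx'; rewrite !gtr0_norm//; apply; lra.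
have e2 : `|f^`()%classic z| * x = f (2 * x) - f x.
  rewrite -[RHS]ger0_norm ?subr_ge0// e normrM; congr (_ * _).
  by rewrite ger0_norm; lra.
rewrite gtr0_norm// in hz.
have h3 : C * (z * `|f^`()%classic z|) <= C * (2 * (f (2 * x) - f x)).
  rewrite -e2 ler_pM2l// [leRHS](_ : _ = 2 * x * `|f^`()%classic z|); last by ring.
  by rewrite ler_wpM2r.
have h4 : f x / (2 * C) <= f (2 * x) - f x by rewrite ler_pdivrMr ?mulr_gt0//; lra.
by rewrite mulrDl mul1r mulrC; lra.
Unshelve. all: by end_near. Qed.

(** The bound 1 serves frequencies whose exponential sum is small; j / r serves the low ones, whose
    sum is bounded trivially. *)
Lemma fejer_weight (r S j : nat) : (0 < r)%N -> (r <= S)%N -> (j < S)%N ->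
  `|(r - j)%:R / r%:R - (S - j)%:R / S%:R : R| <= 1 /\
  `|(r - j)%:R / r%:R - (S - j)%:R / S%:R : R| <= j%:R / r%:R.
Proof.
move=> r0 rS jS.
have rr : 0 < r%:R :> R by rewrite ltr0n.
have SS : 0 < S%:R :> R by rewrite ltr0n (leq_trans r0).
have rSr : r%:R <= S%:R :> R by rewrite ler_nat.
have jSr : j%:R <= S%:R :> R by rewrite ler_nat ltnW.
have j0 : 0 <= j%:R :> R by [].
have e2 : (S - j)%:R / S%:R = 1 - j%:R / S%:R :> R.
  by rewrite natrB ?(ltnW jS)// mulrBl divff// gt_eqF.
have s1 : j%:R / S%:R <= 1 :> R by rewrite ler_pdivrMr// mul1r.
have s0 : 0 <= j%:R / S%:R :> R by rewrite divr_ge0.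
have sr : j%:R / S%:R <= j%:R / r%:R :> R by rewrite ler_wpM2l// lef_pV2.
rewrite e2; have [jr|rj] := leqP j r.
  have e1 : (r - j)%:R / r%:R = 1 - j%:R / r%:R :> R.
    by rewrite natrB// mulrBl divff// gt_eqF.
  have r1 : j%:R / r%:R <= 1 :> R by rewrite ler_pdivrMr// mul1r ler_nat.
  by rewrite e1 !ler_norml; split; apply/andP; split; lra.
have -> : (r - j)%N = 0%N by apply/eqP; rewrite subn_eq0 ltnW.
have r1 : 1 <= j%:R / r%:R :> R by rewrite ler_pdivlMr// mul1r ler_nat ltnW.
by rewrite mul0r !ler_norml; split; apply/andP; split; lra.
Qed.

Lemma bernoulli (g : R) (n : nat) : 0 <= g -> n%:R * g <= (1 + g) ^+ n.
Proof.
move=> g0; suff : 1 + n%:R * g <= (1 + g) ^+ n by lra.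
elim: n => [|n IH]; first by rewrite mul0r addr0.
rewrite exprS -[n.+1%:R]natr1; have := ler_wpM2l (addr_ge0 ler01 g0) IH.
have : 0 <= n%:R * g * g by rewrite !mulr_ge0.
lra.
Qed.

(** In terms of P the two errors are at most P / 512 and P / 1024, and the main term is at least P /
    256; in the latter r cancels against the 1 / r in the bound on m. *)
Lemma main_term_dominates (q N J c X a r m D delta BG : R) : 0 < q -> 0 < N -> 0 < J ->
  0 < c -> 0 < X -> 0 < a -> 0 < r -> 0 < delta -> 0 < BG ->
  delta * N <= a -> D <= delta * N / 4 -> q * X / (8 * r * BG) / 2 <= m ->
  40 * c * 512 * BG / delta <= J ->
  40 * (q * N / J) * (c * X) * a + 2 * (delta / (2048 * BG * J) * X) * (J * (q * N)) * a
    < r / 4 * (m * (a * (a - 2 * D) / 2)).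
Proof.
move=> q0 N0 J0 c0 X0 a0 r0 d0 B0 ha hD hm hJ.
pose P := q * N * X * a * delta / BG.
have P0 : 0 < P by rewrite /P divr_gt0// !mulr_gt0.
have h1 : 40 * (q * N / J) * (c * X) * a <= P / 512.
  have -> : 40 * (q * N / J) * (c * X) * a = (40 * c * q * N * X * a) / J by ring.
  rewrite ler_pdivrMr//; have p : 0 <= P / 512 by lra.
  apply: le_trans (ler_wpM2l p hJ); rewrite /P le_eqVlt; apply/orP; left; apply/eqP.
  by field; rewrite !gt_eqF.
have h2 : 2 * (delta / (2048 * BG * J) * X) * (J * (q * N)) * a = P / 1024.
  by rewrite /P; field; rewrite !gt_eqF.
have h3 : P / 256 <= r / 4 * (m * (a * (a - 2 * D) / 2)).
  have m0 : 0 <= q * X / (8 * r * BG) / 2 by rewrite !divr_ge0 ?mulr_ge0// ltW.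
  have e0 : 0 <= a * (delta * N / 2) / 2 by rewrite !divr_ge0 ?mulr_ge0 ?divr_ge0 ?mulr_ge0// ltW.
  have e1 : a * (delta * N / 2) / 2 <= a * (a - 2 * D) / 2.
    by rewrite ler_pM2r// ler_pM2l//; clear -ha hD; lra.
  have e2 := ler_pM m0 e0 hm e1.
  have r4 : 0 <= r / 4 by rewrite divr_ge0// ltW.
  apply: le_trans (ler_wpM2l r4 e2); rewrite /P le_eqVlt; apply/orP; left; apply/eqP.
  by field; rewrite !gt_eqF.
clear -h1 h2 h3 P0; lra.
Qed.

(** The exponential sum bound is assumed for all c, eta and J, because these are fixed inside the
    proof from the growth constants of f, and K depends on them. *)
Lemma hardy_difference f (B : nat) (C delta : R) (k l : nat) : H f ->
  f x @[x --> +oo] --> +oo ->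
  (0 < B)%N -> (\forall x \near +oo, x * `|f^`()%classic x| <= B%:R * `|f x|) ->
  0 < C -> (\forall x \near +oo, `|f x| <= C * (x * `|f^`()%classic x|)) ->
  (forall (c : nat) (eta J : R), (0 < c)%N -> 0 < eta -> 0 < J ->
    exists2 K : R, 0 < K & \forall x \near +oo, forall (X : nat) (psi : R),
    x = X%:R -> 0 <= psi <= J -> K <= psi * `|f x| ->
    normc (\sum_(n < c * X) cis (psi * f (X%:R + n%:R))) <= eta * x) ->
  0 < delta <= 1 -> (0 < l)%N -> (l <= k)%N ->
  exists N0 : nat, forall (N : nat) (s : seq nat), (N0 <= N)%N -> uniq s ->
    (forall x, x \in s -> (x <= N)%N) -> delta * N%:R <= (size s)%:R ->
    exists x y n : nat, [/\ x \in s, y \in s, (0 < n)%N &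
      k%:Z * x%:Z - l%:Z * y%:Z = Num.floor (f n%:R)].
Proof.
move=> hf foo B0 hB C0 hC hexp /andP[d0 d1] l0 lk.
have [g g0 hg] := hardy_growth hf foo C0 hC.
pose BB : R := 2%:R ^+ B.
have BB1 : 1 <= BB by rewrite exprn_ege1// ler1n.
(* S doublings multiply f by (1 + g)^S, enough to pass from delta N / (8 BB), a lower bound for
   f(X), to (k + 1) N. *)
have [S hS] := nat_ge (8 * BB * k.+1%:R / (delta * g)).
have {}hS : 8 * BB * k.+1%:R / delta <= (1 + g) ^+ S.
  apply: le_trans (bernoulli S (ltW g0)); rewrite -ler_pdivrMr//.
  by apply: le_trans (hS S (leqnn _)); rewrite invfM mulrA.
pose c := (2 ^ S).-1; have c1 : c.+1 = (2 ^ S)%N by rewrite prednK// expn_gt0.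
pose L := c.+2.
pose B1 : R := L%:R ^+ B; have B11 : 1 <= B1 by rewrite exprn_ege1// ler1n.
have [BG BGE] : exists BG : R, BG = B%:R * B1 by exists (B%:R * B1).
have BG1 : 1 <= BG.
  have B1p : 0 <= B1 by lra.
  by rewrite BGE; apply: le_trans B11 _; rewrite ler_peMl// ler1n.
have BG0 : 0 < BG by lra.
have [q hq] : exists q : nat, 8 * (B1 + 2 * k%:R + 1) <= q%:R.
  by have [q h] := nat_ge (8 * (B1 + 2 * k%:R + 1)); exists q; exact: h.
have q8 : 8 <= q%:R :> R by apply: le_trans hq; have := ler0n R k; lra.
have q0 : (0 < q)%N by rewrite -(ltr0n R); lra.
have [J [J0 hJ]] : exists J : nat, (0 < J)%N /\ 40 * c.+1%:R * 512 * BG / delta <= J%:R.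
  have [J h] := nat_ge (40 * c.+1%:R * 512 * BG / delta); exists J.+1; split=> //.
  by apply: h.
have Jr : 0 < J%:R :> R by rewrite ltr0n.
pose eta := delta / (2048 * BG * J%:R).
have w0 : (0 : R) < 2048 by rewrite ltr0n.
have eta0 : 0 < eta := divr_gt0 d0 (mulr_gt0 (mulr_gt0 w0 BG0) Jr).
have [K K0 hK] := hexp c.+1 eta J%:R (ltn0Sn _) eta0 Jr.
(* If psi = j / Q satisfies psi f(X) < K, the lower bound on f(X) gives j <= 8 BB K q / delta, free
   of N; then (c + 1) j / r <= eta. The bound r >= q is for m <= X. *)
have [r [r1 r2]] : exists r : nat, q%:R <= r%:R :> R /\
    8 * BB * K * q%:R * c.+1%:R / (delta * eta) <= r%:R.
  have [r h] := nat_ge (Num.max (q%:R : R) (8 * BB * K * q%:R * c.+1%:R / (delta * eta))).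
  by exists r; have := h r (leqnn _); rewrite ge_max => /andP[].
have rr : 0 < r%:R :> R by clear -q8 r1; lra.
have r0 : (0 < r)%N by rewrite -(ltr0n R).
have [s2 [_ hreg2]] := regular_ratio hH hf (isT : (0 < 2)%N) hB.
have [sL [_ hregL]] := regular_ratio hH hf (ltn0Sn c.+1 : (0 < L)%N) hB.
have /eventuallyP[M0 M01 hM] : \forall x \near +oo,
   [/\ 0 < f x, (1 + g) * f x <= f (2 * x), is_derive (x : R) (1 : R) f (f^`()%classic x) &
       x * `|f^`()%classic x| <= B%:R * `|f x|] /\
   [/\ (forall y, x <= y <= 2%:R * x -> `|f y| <= BB * `|f x|),
       (forall y, x <= y <= L%:R * x -> `|f y| <= B1 * `|f x|) &
     forall (X : nat) (psi : R), x = X%:R -> 0 <= psi <= J%:R -> K <= psi * `|f x| ->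
    normc (\sum_(n < c.+1 * X) cis (psi * f (X%:R + n%:R))) <= eta * x].
  near=> x; split; split.
  - by near: x; exact: (cvgry_gt foo).
  - by near: x.
  - by near: x; exact: (hardy_is_derive hH hf).
  - by near: x.
  - have h : forall y, x <= y <= 2%:R * x ->
      [/\ s2 * f y = `|f y|, `|f y| <= 2%:R ^+ B * `|f x| & `|f x| <= 2%:R ^+ B * `|f y|] by near: x.
    by move=> y /h[].
  - have h : forall y, x <= y <= L%:R * x ->
      [/\ sL * f y = `|f y|, `|f y| <= L%:R ^+ B * `|f x| & `|f x| <= L%:R ^+ B * `|f y|] by near: x.
    by move=> y /h[].
  - by near: x.
have [X0 hX0] := nat_ge (Num.max M0 (8 * r%:R * BG / q%:R)).
have [N1 hN1] := nat_ge (Num.max (8 * f X0%:R / delta) (Num.max (8 / delta) r%:R)).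
exists N1 => N s N1N us hs ha.
have := hN1 N N1N; rewrite !ge_max => /and3P[n1 n2 n3].
rewrite ler_pdivrMr// in n1; rewrite ler_pdivrMr// in n2.
have Nr : 1 <= N%:R :> R by clear -n3 r1 q8; lra.
have N0 : (0 < N)%N by rewrite -(ltr0n R) (lt_le_trans ltr01 Nr).
have exX : exists n : nat, f n%:R <= delta * N%:R / 8 by exists X0; clear -n1; lra.
have [n2' hn2'] : exists n2 : nat, forall n : nat, f n%:R <= delta * N%:R / 8 -> (n <= n2)%N.
  have /eventuallyP[M2 _ h2] : \forall x \near +oo, delta * N%:R / 8 < f x.
    exact: (cvgry_gt foo).
  have [n2' h] := nat_ge M2; exists n2' => n hn; rewrite leqNgt; apply/negP => /ltnW/h/h2.
  by rewrite ltNge hn.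
(* Maximality also bounds f(X) from below: X + 1 <= 2 X, and f grows at most by the factor BB on
   [X, 2 X]. *)
case: (ex_maxnP exX hn2') => X hX maxX.
have X0X : (X0 <= X)%N by apply: maxX; clear -n1; lra.
have := hX0 X X0X; rewrite ge_max => /andP[MX Xr].
have X1 : 1 <= X%:R :> R := le_trans M01 MX.
have Xp : (0 < X)%N by rewrite -(ltr0n R) (lt_le_trans ltr01 X1).
have XR : 0 < X%:R :> R by rewrite ltr0n.
have [[fX0 _ _ _] [hX2 hXL hXexp]] := hM X%:R MX.
have fXN : f X%:R <= N%:R.
  by have h : delta * N%:R <= 1 * N%:R by [rewrite ler_wpM2r]; clear -h hX Nr; lra.
have fXlow : delta * N%:R / 8 <= BB * f X%:R.
  have : delta * N%:R / 8 < f X.+1%:R by rewrite ltNge; apply/negP => /maxX; rewrite ltnn.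
  move=> h; apply: (le_trans (ltW h)); apply: (le_trans (ler_norm _)).
  rewrite -[X in _ * X](gtr0_norm fX0); apply: hX2.
  by rewrite -natrM !ler_nat leqnSn /= mul2n -addnn -addn1 leq_add2l.
(* As delta N >= 8, truncation keeps D >= delta N / 8 >= f(X), while D <= delta N / 4 leaves size s
   - 2 D >= delta N / 2. *)
pose D := Num.truncn (delta * N%:R / 4).
have dN0 : 0 <= delta * N%:R / 4 by rewrite divr_ge0// mulr_ge0// ltW.
have /andP[D1 D2] := truncn_itv dN0; rewrite -/D -[D.+1%:R]natr1 in D1 D2.
(* The number of steps of size G that fit into the width Q / (8 r) around a target; it is at least
   1, so truncation loses at most half. *)
pose mm := q%:R * X%:R / (8 * r%:R * BG).
have rBG : 0 < 8 * r%:R * BG by rewrite !mulr_gt0.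
have mm1 : 1 <= mm.
  rewrite ler_pdivlMr// mul1r; move: Xr; rewrite ler_pdivrMr ?ltr0n//.
  by rewrite (mulrC X%:R).
have mm0 : 0 <= mm := le_trans ler01 mm1.
pose m := Num.truncn mm.
have /andP[m1 m2] := truncn_itv mm0; rewrite -/m -[m.+1%:R]natr1 in m1 m2.
have m1' : 1 <= m%:R :> R by rewrite ler1n truncn_gt0.
have mhalf : mm / 2 <= m%:R by clear -m1' m2; lra.
pose v n := f (X%:R + n%:R).
pose G := BG * N%:R / X%:R.
have inL n : (n <= c.+1 * X)%N -> (X%:R <= X%:R + n%:R :> R) && (X%:R + n%:R <= L%:R * X%:R :> R).
  by move=> nM; rewrite lerDl ler0n /= -natrD -natrM ler_nat /L mulSn leq_add2l.
have vB n : (n < c.+1 * X)%N -> `|v n| <= B1 * N%:R.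
  move=> nM; apply: le_trans (hXL _ (inL n (ltnW nM))) _.
  by rewrite gtr0_norm// ler_wpM2l// (le_trans ler01 B11).
have vG n : (n < c.+1 * X)%N -> `|v n.+1 - v n| <= G.
  move=> nM; have /andP[i1 i2] := inL n (ltnW nM); have /andP[i3 i4] := inL n.+1 nM.
  have nn : X%:R + n.+1%:R = X%:R + n%:R + 1 :> R by rewrite -[n.+1%:R]natr1 addrA.
  have [||z /andP[z1 z2] e] := @mvt R f (f^`()%classic) (X%:R + n%:R) (X%:R + n.+1%:R).
  - by rewrite nn lerDl.
  - by move=> z /andP[z1 _]; have [[]] := hM z (le_trans MX (le_trans i1 z1)).
  have Xz : X%:R <= z := le_trans i1 z1.
  have zL : z <= L%:R * X%:R := le_trans z2 i4.
  have [[_ _ _ hz] _] := hM z (le_trans MX Xz).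
  have hfz := hXL z (introT andP (conj Xz zL)).
  rewrite /v e nn addrAC subrr add0r mulr1 /G ler_pdivlMr//.
  apply: (@le_trans _ _ (z * `|f^`()%classic z|)); first by rewrite mulrC ler_wpM2r.
  apply: le_trans hz _; rewrite BGE -mulrA ler_wpM2l//.
  apply: le_trans hfz _; by rewrite gtr0_norm// ler_wpM2l// (le_trans ler01 B11).
have vc : k.+1%:R * N%:R <= v (c * X)%N.
  have hpow i : (1 + g) ^+ i * f X%:R <= f (2 ^+ i * X%:R).
    elim: i => [|i IH]; first by rewrite !expr0 !mul1r.
    have : X%:R <= 2 ^+ i * X%:R :> R by rewrite ler_peMl ?exprn_ege1 ?ler1n.
    move=> h; have [[_ h2 _ _] _] := hM (2 ^+ i * X%:R) (le_trans MX h).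
    by rewrite !exprS -!mulrA; apply: le_trans h2; rewrite ler_pM2l// addr_gt0.
  have vE : v (c * X)%N = f (2 ^+ S * X%:R).
    by rewrite /v -natrD -mulSn c1 natrM natrX.
  rewrite vE; apply: le_trans (hpow S); apply: le_trans (ler_wpM2r (ltW fX0) hS).
  rewrite -mulrA mulrAC -mulrA [leRHS](_ : _ = k.+1%:R * (8 * (BB * f X%:R) / delta)); last by ring.
  by rewrite ler_wpM2l// ler_pdivlMr//; clear -fXlow; lra.
have mX : (m <= X)%N.
  rewrite -(ler_nat R); apply: le_trans m1 _; rewrite ler_pdivrMr// mulrC ler_wpM2l//.
  have h : r%:R * 1 <= r%:R * BG by rewrite ler_wpM2l// ltW.
  by clear -h r1 rr; lra.
have hm : m%:R * G * (8 * r)%:R <= (q * N)%:R.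
  apply: (@le_trans _ _ (mm * G * (8 * r)%:R)); first by rewrite !ler_wpM2r// /G divr_ge0// mulr_ge0// ltW.
  rewrite !natrM /mm /G le_eqVlt; apply/orP; left; apply/eqP; field.
  by rewrite !gt_eqF.
have rJ : (0 < r <= J * (q * N))%N.
  rewrite r0 /=; apply: (@leq_trans N); first by rewrite -(ler_nat R).
  by rewrite mulnA leq_pmull// muln_gt0 J0.
have NN : 0 < N%:R :> R := lt_le_trans ltr01 Nr.
have hE j : (j < J * (q * N))%N ->
    `|(r - j)%:R / r%:R - (J * (q * N) - j)%:R / (J * (q * N))%:R| *
      normc (\sum_(n < c.+1 * X) cis (j%:R / (q * N)%:R * v n)) <= eta * X%:R.
  move=> jJ; have [w1 w2] := fejer_weight r0 (andP rJ).2 jJ.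
  have qN0 : 0 < (q * N)%:R :> R by rewrite ltr0n muln_gt0 q0.
  set psi := j%:R / (q * N)%:R.
  have psi0 : 0 <= psi <= J%:R.
    by rewrite divr_ge0//= ler_pdivrMr// -natrM ler_nat ltnW.
  have [hKp|hKp] := leP K (psi * `|f X%:R|).
    have := hXexp X psi erefl psi0 hKp => hsum.
    rewrite -[leRHS]mul1r; apply: ler_pM => //; exact: normc_ge0.
  have hsum : normc (\sum_(n < c.+1 * X) cis (psi * v n)) <= (c.+1 * X)%:R.
    apply: le_trans (normc_sum _ _ _) _; rewrite -[leRHS]mulr1.
    by apply: sum_ord_le => // n _; rewrite normc_cis.
  apply: (@le_trans _ _ (j%:R / r%:R * (c.+1 * X)%:R)).
    by apply: ler_pM => //; exact: normc_ge0.
  rewrite natrM mulrA ler_wpM2r// mulrAC ler_pdivrMr//.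
  have hj : j%:R * delta <= 8 * BB * K * q%:R.
    rewrite gtr0_norm// /psi mulrAC ltr_pdivrMr// natrM in hKp.
    have BB0 : 0 < 8 * BB by clear -BB1; lra.
    have h1 := ler_wpM2l (ler0n R j) fXlow.
    have h2 := ltr_pM2l BB0; move: (h2 (j%:R * f X%:R) (K * (q%:R * N%:R))); rewrite hKp => h3.
    rewrite -(ler_pM2r NN); clear -h1 h3; lra.
  have r2' := r2; rewrite (ler_pdivrMr _ _ (mulr_gt0 d0 eta0)) in r2'.
  rewrite -(ler_pM2r d0); have := ler_wpM2r (ler0n R c.+1) hj; clear -r2'; lra.
have hfin : 40 * ((q * N)%:R / J%:R) * (c.+1 * X)%:R * (size s)%:R
     + 2 * (eta * X%:R) * (J * (q * N))%:R * (size s)%:R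
    < r%:R / 4 * (m%:R * ((size s)%:R * ((size s)%:R - 2 * D%:R) / 2)).
  have sp : 0 < (size s)%:R :> R by apply: lt_le_trans ha; apply: mulr_gt0.
  have qr : 0 < q%:R :> R by rewrite ltr0n.
  rewrite !natrM.
  exact: (main_term_dominates qr NN Jr (ltr0Sn R c) XR sp rr d0 BG0 ha D1 mhalf hJ).
have G0 : 0 <= G by rewrite /G divr_ge0// mulr_ge0// ltW.
have v0 : v 0%N <= D%:R by rewrite /v addr0; clear -hX D2 n2; lra.
have [x [y [n [xs ys nM e]]]] := find_solution us hs l0 lk N0 Xp J0 rJ vB hq v0 vc G0 vG mX hm hE hfin.
exists x, y, (X + n)%N; split=> //; first by rewrite addn_gt0 Xp.
by rewrite e /v natrD.
Unshelve. all: by end_near. Qed.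

End HardyDifference.

(** * Upper density and slowly growing functions *)

Section UpperDensity.
Variable R : realType.
Implicit Types (A : set nat).

Lemma upper_density_frequently A : (0 < upper_density R A)%E ->
  exists2 delta : R, 0 < delta <= 1 & forall N0 : nat, exists N (s : seq nat),
    [/\ (N0 <= N)%N, uniq s, forall x, x \in s -> A x /\ (x <= N)%N &
        delta * N%:R <= (size s)%:R].
Proof.
pose B N := A `&` [set n | (1 <= n <= N)%N].
have finB N : finite_set (B N).
  by apply: (sub_finite_set _ (finite_II N.+1)) => n [_ /= /andP[_]]; rewrite ltnS.
move=> u0; have [d [d0 d1]] : exists d : R, 0 < d /\ (d%:E < upper_density R A)%E.
  move: u0; case: (upper_density R A) => [r| |] //; last by exists 1; rewrite ltr01 ltry.
  by rewrite lte_fin => r0; exists (r / 2); rewrite lte_fin; split; lra.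
exists (Num.min 1 d); first by rewrite lt_min ltr01 d0 ge_min lexx.
move=> N0; apply: contrapT => hN; move: d1; apply/negP; rewrite -leNgt.
rewrite /upper_density /limn_esup; apply: ge_ereal_inf.
(* Starting from N0 + 1 keeps N positive, away from the junk quotient at 0. *)
exists (ereal_sup ((fun N => ((#|` fset_set (B N)|%fset)%:R / N%:R : R)%:E) @` [set N | (N0.+1 <= N)%N])); last first.
  apply: ge_ereal_sup => _ [N /= N0N <-]; rewrite lee_fin leNgt; apply/negP => h; apply: hN.
  exists N, (enum_fset (fset_set (B N))); split; first exact: ltnW.
  - exact: fset_uniq.
  - by move=> x; rewrite in_fset_set// inE => -[Ax /= /andP[_ ->]].
  have NR : 0 < N%:R :> R by rewrite ltr0n (leq_trans _ N0N).
  rewrite -ler_pdivlMr//; apply: le_trans (ltW h).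
  by rewrite ge_min lexx orbT.
by exists [set N | (N0.+1 <= N)%N] => //; exact: nbhs_infty_ge.
Qed.

End UpperDensity.

(** * Functions whose derivative tends to 0 *)

Section SlowGrowth.
Variable R : realType.

(** Steps of size at most 1/2 skip no integer: at the first n with f(n) >= t the value is still
    below t + 1. *)
Lemma floor_surjective (f : R -> R) : f x @[x --> +oo] --> +oo ->
  (\forall x \near +oo, is_derive (x : R) (1 : R) f (f^`()%classic x)) ->
  (\forall x \near +oo, `|f^`()%classic x| <= 2^-1) ->
  exists T : nat, forall t : nat, (T <= t)%N ->
    exists2 n : nat, (0 < n)%N & Num.floor (f n%:R) = t%:Z.
Proof.
move=> foo hd h2.
have /eventuallyP[M M1 hM] : \forall x \near +oo,
    is_derive (x : R) (1 : R) f (f^`()%classic x) /\ `|f^`()%classic x| <= 2^-1.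
  by near=> x; split; near: x.
have [n0 hn0] := nat_ge M; have [T hT] := nat_ge (f n0%:R + 1).
exists T => t Tt.
have ex : exists n, (n0 <= n)%N && (t%:R <= f n%:R).
  have /eventuallyP[M2 _ hM2] : \forall x \near +oo, t%:R <= f x by exact: (cvgry_ge foo).
  have [n1 hn1] := nat_ge M2; exists (maxn n0 n1); rewrite leq_maxl /=.
  by apply/hM2/hn1/leq_maxr.
case: (ex_minnP ex) => -[|n] /andP[n0n tn] hmin.
  by exfalso; have := hT t Tt; rewrite leqn0 in n0n; rewrite (eqP n0n); lra.
have {}n0n : (n0 <= n)%N.
  rewrite leqNgt; apply/negP => nn0; have e : n.+1 = n0 by apply/eqP; rewrite eqn_leq nn0.
  by have := hT t Tt; rewrite -e; lra.
have nt : f n%:R < t%:R.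
  by rewrite ltNge; apply/negP => h; have := hmin n; rewrite n0n h ltnn => /(_ isT).
exists n.+1 => //; apply/floor_def; rewrite -pmulrn intrD -pmulrn tn /=.
have := hn0 n n0n => Mn.
have [||z /andP[z1 _] e] := @mvt R f (f^`()%classic) n%:R n.+1%:R.
- by rewrite ler_nat.
- by move=> z /andP[z1 _]; have [] := hM z (le_trans Mn z1).
have [_] := hM z (le_trans Mn z1); rewrite ler_norml => /andP[_ h].
by move: e; rewrite -[n.+1%:R]natr1 addrAC subrr add0r mulr1; lra.
Unshelve. all: by end_near. Qed.

End SlowGrowth.

Theorem theorem1p15 (R : realType) (alpha : R -> R)
    (halpha : sub_polynomial alpha)
    (halpha_oo : alpha x @[x --> +oo] --> +oo)
    (halpha_log : forall (p : {poly rat}) (c : R),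
        `|alpha x - c * (map_poly ratr p).[x]| / ln x @[x --> +oo] --> +oo)
    (k l : nat) (hk : (0 < k)%N) (hl : (0 < l)%N) (hkl : (l <= k)%N)
    (A : set nat) (hA : forall n, A n -> (0 < n)%N)
    (hdA : (0 < upper_density R A)%E) :
  exists x y n : nat, [/\ A x, A y, (0 < n)%N &
    k%:Z * x%:Z - l%:Z * y%:Z = Num.floor (alpha n%:R)].
Proof.
have [[H hH Ha] hlim] := halpha.
have [delta d01 hfreq] := upper_density_frequently hdA.
have [[|d] [decay _ reg low NP]] := hardy_structure hH Ha hlim halpha_oo.
  (* Here the derivative tends to 0: any y in A and any sufficiently large x in A make k x - l y an
     attained value. *)
  have [T hT] : exists T : nat, forall t : nat, (T <= t)%N ->
      exists2 n : nat, (0 < n)%N & Num.floor (alpha n%:R) = t%:Z.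
    apply: floor_surjective => //; first exact: (hardy_is_derive hH Ha).
    by apply: decay; rewrite invr_gt0.
  have unbounded m : exists2 x, A x & (m < x)%N.
    have /andP[d0 _] := d01; have [N0 hN0] := nat_ge (m.+2%:R / delta).
    have [N [s [NN us hs hsz]]] := hfreq N0.
    apply: contrapT => h; have : (size s <= m.+1)%N.
      rewrite -(size_iota 0 m.+1); apply: uniq_leq_size us _ => x /hs[Ax _].
      by rewrite mem_iota leq0n add0n ltnS leqNgt; apply/negP => mx; apply: h; exists x.
    have := hN0 N NN; rewrite ler_pdivrMr// mulrC => /le_trans/(_ hsz).
    by rewrite ler_nat => h1 /(leq_trans h1); rewrite ltnn.
  have [y Ay _] := unbounded 0%N; have [x Ax hx] := unbounded (l * y + T)%N.
  have hkx : (l * y + T <= k * x)%N by apply: leq_trans (ltnW hx) (leq_pmull _ hk).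
  have lykx : (l * y <= k * x)%N := leq_trans (leq_addr T _) hkx.
  have Tt : (T <= k * x - l * y)%N by rewrite leq_subRL.
  by have [n n0 hn] := hT _ Tt; exists x, y, n; split=> //; rewrite hn -!PoszM subzn.
have [B B0 hB] := reg 0%N isT; have [C C0 hC] := low 0%N isT.
have [N0 hN0] := hardy_difference hH Ha halpha_oo B0 hB C0 hC
  (fun c eta J => @hardy_exponential_sums R H hH alpha d.+1 c eta J Ha isT decay reg low (NP isT)
     halpha_log) d01 hl hkl.
have [N [s [NN us hs hsz]]] := hfreq N0.
have [x [y [n [xs ys n0 e]]]] := hN0 N s NN us (fun x xs => (hs x xs).2) hsz.
by exists x, y, n; split=> //; have [] := hs _ xs; have [] := hs _ ys.
Qed.
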